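(* Let $S$ be a simple smooth module over the superconformal current algebra $\mathfrak g$ with level $\ell\neq 0$. Then one of the following holds: (i) $S\cong H(z)^{\mathfrak g}$, where $H$ is a simple smooth module over the Heisenberg-Clifford superalgebra $\mathfrak{hc}$ and $z\in\mathbb C$; or (ii) $S$ is an induced $\mathfrak g$-module from a simple smooth $\mathfrak g^{(0,-n)}$-module for some $n\in\mathbb Z_+$; or (iii) $S\cong U^{\mathfrak g}\otimes H(z)^{\mathfrak g}$, where $U$ is a simple smooth module over the super Virasoro algebra $\mathfrak s$, $H$ is a simple smooth module over $\mathfrak{hc}$ and $z\in\mathbb C$.
   Context: Notation: $\mathbb N$ = non-negative integers, $\mathbb Z_+$ = positive integers; everything is over $\mathbb C$; modules over Lie superalgebras are $\mathbb Z_2$-graded. The superconformal current algebra $\mathfrak g$ is the Lie superalgebra with basis $\{L_m,H_m,G_p,F_p,\mathbf c_1,\mathbf c_2,\mathbf c_3 : m\in\mathbb Z,\ p\in\mathbb Z+\frac12\}$, where $L_m,H_m,\mathbf c_i$ are even and $G_p,F_p$ are odd, with $\mathbf c_i$ central and $[L_m,L_n]=(m-n)L_{m+n}+\delta_{m+n,0}\frac{m^3-m}{12}\mathbf c_1$, $[L_m,H_n]=-nH_{m+n}+\delta_{m+n,0}(m^2+m)\mathbf c_2$, $[H_m,H_n]=m\delta_{m+n,0}\mathbf c_3$, $[L_m,G_p]=(\frac m2-p)G_{m+p}$, $[G_p,G_q]=2L_{p+q}+\frac13(p^2-\frac14)\delta_{p+q,0}\mathbf c_1$, $[L_m,F_p]=-(\frac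 m2+p)F_{m+p}$, $[F_p,F_q]=\delta_{p+q,0}\mathbf c_3$, $[G_p,F_q]=H_{p+q}+(2p+1)\delta_{p+q,0}\mathbf c_2$, $[H_m,G_p]=mF_{m+p}$, $[H_m,F_p]=0$. It is $\frac12\mathbb Z$-graded by $\deg L_m=\deg H_m=m$, $\deg G_p=\deg F_p=p$, $\deg\mathbf c_i=0$. Subalgebras: $\mathfrak s=\mathrm{span}\{L_i,G_{i+\frac12},\mathbf c_1: i\in\mathbb Z\}$ (super Virasoro), $\mathfrak{hc}=\mathrm{span}\{H_i,F_{i+\frac12},\mathbf c_3: i\in\mathbb Z\}$ (Heisenberg-Clifford); for $m\in\mathbb N$, $n\in\mathbb Z$: $\mathfrak s^{(m)}=\mathrm{span}\{L_{m+i},G_{m+i+\frac12},\mathbf c_1: i\in\mathbb N\}$, $\mathfrak{hc}^{(n)}=\mathrm{span}\{H_{n+i},F_{n+i+\frac12},\mathbf c_3: i\in\mathbb N\}$, $\mathfrak g^{(m,n)}=\mathfrak s^{(m)}\oplus\mathfrak{hc}^{(n)}\oplus\mathbb C\mathbf c_2$. A module $V$ over a $\frac12\mathbb Z$-graded Lie superalgebra $L$ is smooth if for every $v\in V$ there is $n\in\frac12\mathbb N$ with $L_iv=0$ for all $i>n$ (subalgebras above carry the induced grading). A $\mathfrak g$-module has level $\ell$ if $\mathbf c_3$ acts as the scalar $\ell$. For an $\mathfrak s$-module $U$, $U^{\mathfrak g}$ is the $\mathfrak g$-module obtained by letting $\mathfrak{hc}+\mathbb C\mathbf c_2$ act by zero.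 For $z\in\mathbb C$ and a smooth $\mathfrak{hc}$-module $H$ on which $\mathbf c_3$ acts as a scalar $\ell\neq0$, $H(z)^{\mathfrak g}$ is the $\mathfrak g$-module structure on $H$ extending the $\mathfrak{hc}$-action, with $\mathbf c_1\mapsto\frac32-\frac{12z^2}{\ell}$, $\mathbf c_2\mapsto z$, $\mathbf c_3\mapsto \ell$ and $L_n\mapsto\frac1{2\ell}\sum_{k\in\mathbb Z}:H_kH_{-k+n}:+\frac{(n+1)z}{\ell}H_n-\frac1{2\ell}\sum_{r\in\mathbb Z+\frac12}(r+\frac12):F_rF_{-r+n}:$, $G_r\mapsto\frac1\ell\sum_{k\in\mathbb Z}H_kF_{-k+r}+\frac{(2r+1)z}{\ell}F_r$, where $:H_iH_j:$ is $H_iH_j$ if $i<j$ and $H_jH_i$ otherwise, and $:F_rF_s:$ is $F_rF_s$ if $r<s$ and $-F_sF_r$ otherwise. *)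

(* Defs.v *)
From HB Require Import structures.
From mathcomp Require Import all_boot all_order all_algebra.
From mathcomp Require Import generic_quotient ring_quotient.
From mathcomp Require Import finmap monalg.
From mathcomp Require Import boolp classical_sets fsbigop reals.
From mathcomp Require Import complex.
From mathcomp Require Import zify ring.

Set Implicit Arguments.
Unset Strict Implicit.
Unset Printing Implicit Defensive.

Import Order.TTheory GRing.Theory Num.Theory.

Local Open Scope classical_set_scope.
Local Open Scope quotient_scope.
Local Open Scope ring_scope.

Lemma linearE (K : numFieldType) (V Z : lmodType K) (f : V -> Z) : linear f ->
  (f 0 = 0) * {morph f : u v / u + v} * {morph f : u / - u}
  * (forall a u, f (a *: u) = a *: f u).
Proof.
move=> fP; have fD : {morph f : u v / u + v}.
  by move=> u v; rewrite -[u]scale1r fP !scale1r.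
have f0 : f 0 = 0 by apply: (addrI (f 0)); rewrite -fD !addr0.
have fZ a u : f (a *: u) = a *: f u by rewrite -[_ *: u]addr0 fP f0 addr0.
by split=> //; split=> // u; rewrite -scaleN1r fZ scaleN1r.
Qed.

Section Subspace.
Context {K : numFieldType} {V : lmodType K}.

Definition subspace (N : set V) : Prop :=
  N 0 /\ forall (a : K) u v, N u -> N v -> N (a *: u + v).

Definition lspan (E : set V) : set V :=
  [set v | forall N : set V, subspace N -> E `<=` N -> N v].

Lemma lspan_subspace (E : set V) : subspace (lspan E).
Proof.
split=> [N [N0 _] _ //|a u v Eu Ev N NP EN].
by case: (NP) => _; apply; [exact: Eu | exact: Ev].
Qed.

Definition in_lspan (E : set V) : {pred V} := fun v => `[< lspan E v >].

Lemma in_lspan_submod_closed (E : set V) : submod_closed (in_lspan E).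
Proof.
have [E0 EP] := lspan_subspace E; split=> [|a u v]; first exact/asboolP.
by move=> /asboolP Eu /asboolP Ev; apply/asboolP; exact: EP.
Qed.

HB.instance Definition _ (E : set V) :=
  GRing.isSubmodClosed.Build K V (in_lspan E) (in_lspan_submod_closed E).

End Subspace.

(* V / span E *)
Section LQuot.
Context {K : numFieldType} {V : lmodType K}.

Definition lquot (E : set V) : Type := Quotient.quot (in_lspan E).

Variable E : set V.

HB.instance Definition _ := GRing.Zmodule.on (lquot E).

Definition lpi (v : V) : lquot E := \pi_(Quotient.quot (in_lspan E)) v.
Definition lrepr (q : lquot E) : V := repr (q : Quotient.quot (in_lspan E)).

Lemma lreprK : cancel lrepr lpi.
Proof. exact: reprK. Qed.

Lemma lpi_eq u v : lpi u = lpi v <-> lspan E (u - v).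
Proof.
rewrite /lpi; split=> [/eqP|uv]; last apply/eqP.
  by rewrite -Quotient.idealrBE => /asboolP.
by rewrite -Quotient.idealrBE; apply/asboolP.
Qed.

Lemma lpiD u v : lpi (u + v) = lpi u + lpi v.
Proof. exact: (raddfD (\pi_(Quotient.quot (in_lspan E)))). Qed.

Definition lscale (a : K) (q : lquot E) : lquot E := lpi (a *: lrepr q).

Lemma lpiZ a v : lpi (a *: v) = lscale a (lpi v).
Proof.
apply/lpi_eq; rewrite -scalerBr -[_ *: _]addr0.
have [E0 EP] := lspan_subspace E; apply: (EP) => //.
by apply/lpi_eq; rewrite lreprK.
Qed.

Fact lscaleA a b q : lscale a (lscale b q) = lscale (a * b) q.
Proof. by rewrite -[q]lreprK -!lpiZ scalerA. Qed.

Fact lscale1 : left_id 1 lscale.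
Proof. by move=> q; rewrite -[q]lreprK -!lpiZ scale1r. Qed.

Fact lscaleDr : right_distributive lscale +%R.
Proof.
by move=> a q r; rewrite -[q]lreprK -[r]lreprK -lpiD -!lpiZ scalerDr lpiD.
Qed.

Fact lscaleDl q : {morph lscale^~ q : a b / a + b}.
Proof. by move=> a b; rewrite -[q]lreprK -!lpiZ scalerDl lpiD. Qed.

HB.instance Definition _ := GRing.Zmodule_isLmodule.Build K (lquot E)
  lscaleA lscale1 lscaleDr lscaleDl.

Lemma lpi_linear : linear lpi.
Proof. by move=> a u v; rewrite lpiD lpiZ. Qed.

Lemma lquot_lift (Z : lmodType K) (phi : V -> Z) :
  linear phi -> (forall v, E v -> phi v = 0) ->
  forall v, phi (lrepr (lpi v)) = phi v.
Proof.
move=> phiP phiE v; apply/eqP; rewrite -subr_eq0; apply/eqP.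
rewrite -(linearE phiP).1.2 -(linearE phiP).1.1.2.
suff /(_ [set v | phi v = 0]) : lspan E (lrepr (lpi v) - v).
  apply; last exact: phiE.
  split=> [|a x y /= xE yE]; first by rewrite /= (linearE phiP).
  by rewrite phiP xE yE scaler0 addr0.
by apply/lpi_eq; rewrite lreprK.
Qed.

End LQuot.

(* The linear extension to the free vector space {malg K[B]} of a function on
   its basis B. *)
Section LinearExtension.
Context {K : numFieldType} {B : choiceType} {Z : lmodType K}.
Implicit Types (g h : {malg K[B]}).

Definition lext (f : B -> Z) g : Z := \sum_(b <- msupp g) g@_b *: f b.

Lemma lextEw f (d : {fset B}) g : (msupp g `<=` d)%fset ->
  lext f g = \sum_(b <- d) g@_b *: f b.
Proof.
move=> gd; rewrite [LHS](big_fset_incl _ gd) // => b _ /mcoeff_outdom ->.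
by rewrite scale0r.
Qed.

Lemma lext_linear f : linear (lext f).
Proof.
move=> a g h; pose d := (msupp g `|` msupp h)%fset.
have gd : (msupp g `<=` d)%fset by rewrite fsubsetUl.
have hd : (msupp h `<=` d)%fset by rewrite fsubsetUr.
rewrite (lextEw f gd) (lextEw f hd) (@lextEw f d) //; last first.
  apply/fsubsetP => b; rewrite -mcoeff_neq0 mcoeffD mcoeffZ inE -!mcoeff_neq0.
  apply: contraNT; rewrite negb_or !negbK => /andP[/eqP-> /eqP->].
  by rewrite mulr0 addr0.
rewrite scaler_sumr -big_split /=; apply: eq_bigr => b _.
by rewrite mcoeffD mcoeffZ scalerDl scalerA.
Qed.

Lemma lextU f b : lext f << b >> = f b.
Proof. by rewrite (lextEw f msuppU_le) big_seq_fset1 mcoeffUU scale1r. Qed.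

End LinearExtension.

(* The tensor product A (x) B of vector spaces, divided by the relations
   a i (x) b = a (x) i b for i in I, where rA i is the right action of i on A
   and lB i its left action on B.  With I empty it is A (x) B itself; if the
   rA, lB are the actions of generators of an algebra U, it is A (x)_U B. *)
Section BalancedTensor.
Context {K : numFieldType} {A B : lmodType K} {I : Type}.
Variables (rA : I -> A -> A) (lB : I -> B -> B).

Inductive tens_rel : set {malg K[(A * B)%type]} :=
| TensAddl a a' b : tens_rel (<< (a + a', b) >> - << (a, b) >> - << (a', b) >>)
| TensAddr a b b' : tens_rel (<< (a, b + b') >> - << (a, b) >> - << (a, b') >>)
| TensScalel c a b : tens_rel (<< (c *: a, b) >> - c *: << (a, b) >>)
| TensScaler c a b : tens_rel (<< (a, c *: b) >> - c *: << (a, b) >>)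
| TensBalanced i a b : tens_rel (<< (rA i a, b) >> - << (a, lB i b) >>).

Definition tens : lmodType K := lquot tens_rel.

Definition tmul (a : A) (b : B) : tens := lpi tens_rel << (a, b) >>.

Lemma tmul_eq (u v : {malg K[(A * B)%type]}) :
  tens_rel (u - v) -> lpi tens_rel u = lpi tens_rel v.
Proof. by move=> uv; apply/lpi_eq => N _; apply. Qed.

Lemma tmul_linearl b : linear (tmul^~ b).
Proof.
move=> c u v; rewrite /tmul -lpi_linear.
transitivity (lpi tens_rel (<< (c *: u, b) >> + << (v, b) >>)).
  by apply: tmul_eq; rewrite opprD addrA; exact: TensAddl.
by apply: tmul_eq; rewrite opprD addrACA subrr addr0; exact: TensScalel.
Qed.

Lemma tmul_linearr a : linear (tmul a).
Proof.
move=> c u v; rewrite /tmul -lpi_linear.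
transitivity (lpi tens_rel (<< (a, c *: u) >> + << (a, v) >>)).
  by apply: tmul_eq; rewrite opprD addrA; exact: TensAddr.
by apply: tmul_eq; rewrite opprD addrACA subrr addr0; exact: TensScaler.
Qed.

Lemma tmul_balanced i a b : tmul (rA i a) b = tmul a (lB i b).
Proof. by apply: tmul_eq; exact: TensBalanced. Qed.

(* The map on the tensor product induced by a balanced bilinear map f. *)
Definition tlift {Z : lmodType K} (f : A -> B -> Z) (t : tens) : Z :=
  lext (fun ab : (A * B)%type => f ab.1 ab.2) (lrepr t).

Lemma tlift_tmul (Z : lmodType K) (f : A -> B -> Z) :
  (forall b, linear (f^~ b)) -> (forall a, linear (f a)) ->
  (forall i a b, f (rA i a) b = f a (lB i b)) ->
  forall a b, tlift f (tmul a b) = f a b.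
Proof.
move=> fl fr fb a b.
have extP := lext_linear (fun ab : (A * B)%type => f ab.1 ab.2).
rewrite /tlift lquot_lift ?lextU //.
have [[[_ extD] extN] extZ] := linearE extP.
move=> _ [a1 a2 b1|a1 b1 b2|c a1 b1|c a1 b1|i a1 b1];
  rewrite !extD !extN ?extZ !lextU /=.
- by rewrite (linearE (fl _)) -addrA -opprD subrr.
- by rewrite (linearE (fr _)) -addrA -opprD subrr.
- by rewrite (linearE (fl _)) subrr.
- by rewrite (linearE (fr _)) subrr.
- by rewrite fb subrr.
Qed.

End BalancedTensor.

Definition lcomb {K : numFieldType} {B : Type} {V : lmodType K} (f : B -> V)
  (s : seq (K * B)) : V := \sum_(t <- s) t.1 *: f t.2.

(* A 1/2 Z-graded Lie superalgebra over K, given by a homogeneous basis and its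
   structure constants: [x, y] is the linear combination of the basis elements
   t.2 with coefficients t.1, for t in lbr x y.  The degree of x is
   (ldeg2 x) / 2.  The two identities are equalities of linear combinations of
   basis elements, tested on an arbitrary linear form f. *)
Structure lieSuper (K : numFieldType) := LieSuper {
  lbasis : choiceType;
  lpar : lbasis -> bool;
  ldeg2 : lbasis -> int;
  lbr : lbasis -> lbasis -> seq (K * lbasis);
  lbr_par : forall x y t, t \in lbr x y -> lpar t.2 = lpar x (+) lpar y;
  lbr_deg : forall x y t, t \in lbr x y -> ldeg2 t.2 = ldeg2 x + ldeg2 y;
  lbr_skew : forall (f : lbasis -> K^o) x y,
    lcomb f (lbr x y) = - (-1) ^+ (lpar x && lpar y) * lcomb f (lbr y x);
  lbr_jacobi : forall (f : lbasis -> K^o) x y z,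
    lcomb (fun b => lcomb f (lbr x b)) (lbr y z) =
    lcomb (fun b => lcomb f (lbr b z)) (lbr x y)
    + (-1) ^+ (lpar x && lpar y) * lcomb (fun b => lcomb f (lbr y b)) (lbr x z)
}.

Section Subalgebra.
Context {K : numFieldType} (L : lieSuper K) (P : pred (lbasis L)).

Definition br_closed : Prop :=
  forall x y, P x -> P y -> forall t, t \in lbr x y -> P t.2.

Local Notation PB := {b : lbasis L | P b}.

Definition sub_br (x y : PB) : seq (K * PB) :=
  pmap (fun t => omap (pair t.1) (insub t.2)) (lbr (val x) (val y)).

Hypothesis Pbr : br_closed.

Definition ext0 {V : lmodType K} (f : PB -> V) (b : lbasis L) : V :=
  if insub b is Some c then f c else 0.

Lemma mem_sub_br x y t :
  t \in sub_br x y -> (t.1, val t.2) \in lbr (val x) (val y).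
Proof.
rewrite mem_pmap => /mapP[[c b] cb] /=; case: insubP => //= u _ ub [->] /=.
by rewrite ub.
Qed.

Lemma lcomb_sub (V : lmodType K) (f : PB -> V) x y :
  lcomb f (sub_br x y) = lcomb (ext0 f) (lbr (val x) (val y)).
Proof.
rewrite /lcomb /sub_br; elim: (lbr _ _) => [|[c b] s IH]; rewrite ?big_nil //=.
rewrite big_cons -IH /ext0 /=; case: insubP => [u _ _|_] /=.
  by rewrite big_cons.
by rewrite scaler0 add0r.
Qed.

Lemma lcomb_sub2 (f : PB -> K^o) (g : lbasis L -> seq (K * lbasis L))
    (h : PB -> seq (K * PB)) x y :
    (forall b, lcomb f (h b) = lcomb (ext0 f) (g (val b))) ->
  lcomb (fun b => lcomb f (h b)) (sub_br x y) =
  lcomb (fun b => lcomb (ext0 f) (g b)) (lbr (val x) (val y)).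
Proof.
move=> hg; rewrite lcomb_sub; apply: eq_big_seq => t tP; congr (_ *: _).
rewrite /ext0; case: insubP => [u _ <- //|].
by rewrite (Pbr (valP x) (valP y) tP).
Qed.

Fact sub_br_par x y t :
  t \in sub_br x y -> lpar (val t.2) = lpar (val x) (+) lpar (val y).
Proof. by move=> /mem_sub_br /lbr_par. Qed.

Fact sub_br_deg x y t :
  t \in sub_br x y -> ldeg2 (val t.2) = ldeg2 (val x) + ldeg2 (val y).
Proof. by move=> /mem_sub_br /lbr_deg. Qed.

Fact sub_br_skew (f : PB -> K^o) x y :
  lcomb f (sub_br x y) =
  - (-1) ^+ (lpar (val x) && lpar (val y)) * lcomb f (sub_br y x).
Proof. by rewrite !lcomb_sub lbr_skew. Qed.

Fact sub_br_jacobi (f : PB -> K^o) x y z :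
  lcomb (fun b => lcomb f (sub_br x b)) (sub_br y z) =
  lcomb (fun b => lcomb f (sub_br b z)) (sub_br x y)
  + (-1) ^+ (lpar (val x) && lpar (val y))
    * lcomb (fun b => lcomb f (sub_br y b)) (sub_br x z).
Proof.
rewrite (@lcomb_sub2 f (lbr (val x))) => [|b]; last exact: lcomb_sub.
rewrite (@lcomb_sub2 f (fun b => lbr b (val z))) => [|b]; last exact: lcomb_sub.
rewrite (@lcomb_sub2 f (lbr (val y))) => [|b]; last exact: lcomb_sub.
exact: lbr_jacobi.
Qed.

(* The subalgebra spanned by the basis elements satisfying P. *)
Definition lsub : lieSuper K :=
  LieSuper sub_br_par sub_br_deg sub_br_skew sub_br_jacobi.

End Subalgebra.

(* A super vector space, given by its projections spr false and spr true onto
   the even and the odd part, together with an operator for each element of the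
   basis of L.  The module axioms are stated separately, in is_module. *)
Structure rep (K : numFieldType) (L : lieSuper K) := Rep {
  rcar :> lmodType K;
  spr : bool -> rcar -> rcar;
  act : lbasis L -> rcar -> rcar
}.

Section Modules.
Context {K : numFieldType} {L : lieSuper K}.
Implicit Types V W : rep L.

Definition is_super V : Prop :=
  [/\ forall i, linear (@spr _ _ V i),
      forall v : V, spr false v + spr true v = v
    & forall i j (v : V), spr i (spr j v) = if i == j then spr j v else 0].

Definition is_module V : Prop :=
  [/\ is_super V,
      forall x, linear (@act _ _ V x),
      forall x i (v : V), act x (spr i v) = spr (i (+) lpar x) (act x v)
    & forall x y (v : V),
        act x (act y v) - (-1) ^+ (lpar x && lpar y) *: act y (act x v)
        = lcomb (fun b => act b v) (lbr x y)].

Definition submodule V (N : set V) : Prop :=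
  [/\ subspace N,
      forall i v, N v -> N (spr i v)
    & forall x v, N v -> N (act x v)].

Definition simple V : Prop :=
  (exists v : V, v != 0) /\
  forall N : set V, submodule N ->
    (forall v, N v -> v = 0) \/ (forall v, N v).

(* n is twice the bound on the degree. *)
Definition smooth V : Prop :=
  forall v : V, exists n : nat, forall x, n%:Z < ldeg2 x -> act x v = 0.

Definition isomorphic V W : Prop :=
  exists f : V -> W,
    [/\ linear f, bijective f,
        forall i v, f (spr i v) = spr i (f v)
      & forall x v, f (act x v) = act x (f v)].

(* The parity operator raised to the power e. *)
Definition twist V (e : bool) (v : V) : V := spr false v + (-1) ^+ e *: spr true v.

Definition tens_rep V W : rep L :=
  let noact T (i : void) (t : T) := t in
  @Rep K L (tens (@noact V) (@noact W))
    (fun i => tlift (fun v w =>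
       \sum_(j : bool) tmul _ _ (spr j v) (spr (i (+) j) w)))
    (fun x => tlift (fun v w =>
       tmul _ _ (act x v) w + tmul _ _ (twist (lpar x) v) (act x w))).

Lemma tens_rep_actE V W x (v : V) (w : W) : is_module V -> is_module W ->
  @act _ _ (tens_rep V W) x (tmul _ _ v w) =
  tmul _ _ (act x v) w + tmul _ _ (twist (lpar x) v) (act x w).
Proof.
move=> [[VP _ _] Va _ _] [_ Wa _ _].
have comp (X Y Z : lmodType K) (f : Y -> Z) (h : X -> Y) :
  linear f -> linear h -> linear (f \o h) by move=> fP hP c u t /=; rewrite hP fP.
have add (X Y : lmodType K) (f h : X -> Y) :
    linear f -> linear h -> linear (fun t => f t + h t).
  by move=> fP hP c u t; rewrite fP hP scalerDr addrACA.
rewrite /= tlift_tmul // => [b|a]; apply: add.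
- exact: comp (tmul_linearl _ _ _) (Va x).
- apply: comp (tmul_linearl _ _ _) _ => a u1 u2.
  by rewrite /twist !VP !scalerDr addrACA !scalerA mulrC.
- exact: tmul_linearr.
- exact: comp (tmul_linearr _ _ _) (Wa x).
Qed.

End Modules.

Section Enveloping.
Context {K : numFieldType} (L : lieSuper K).

Local Notation free := {malg K[{fmonom (lbasis L)}]}.

Definition fgen (x : lbasis L) : free := << fmu x >>.

Inductive uea_rel : set free :=
| UeaRel a x y b : uea_rel
    (a * (fgen x * fgen y - (-1) ^+ (lpar x && lpar y) *: (fgen y * fgen x)
          - lcomb fgen (lbr x y)) * b).

Definition uea : lmodType K := lquot uea_rel.

Definition uea_lmul (x : lbasis L) (u : uea) : uea :=
  lpi uea_rel (fgen x * lrepr u).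
Definition uea_rmul (x : lbasis L) (u : uea) : uea :=
  lpi uea_rel (lrepr u * fgen x).

Lemma free_mulrAr c (u v : free) : u * (c *: v) = c *: (u * v).
Proof.
apply/malgP => k; have uP := fsubset_refl (msupp u).
rewrite (mcoeffMlw k uP (msuppZ_le c v)) mcoeffZ mcoeffMl mulr_sumr.
apply: eq_bigr => k1 _; rewrite mulr_sumr.
by apply: eq_bigr => k2 _; rewrite mcoeffZ mulrnAr mulrCA.
Qed.

Lemma uea_lmulE x u : uea_lmul x (lpi uea_rel u) = lpi uea_rel (fgen x * u).
Proof.
apply: (@lquot_lift _ _ _ _ (fun v => lpi uea_rel (fgen x * v))) => [a v w|_ []].
  by rewrite mulrDr free_mulrAr lpi_linear.
move=> a y z b; rewrite -(linearE (lpi_linear uea_rel)).1.1.1; apply/lpi_eq.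
by rewrite subr0 2!mulrA => N _; apply; exact: UeaRel.
Qed.

Lemma uea_rmulE x u : uea_rmul x (lpi uea_rel u) = lpi uea_rel (u * fgen x).
Proof.
apply: (@lquot_lift _ _ _ _ (fun v => lpi uea_rel (v * fgen x))) => [a v w|_ []].
  by rewrite mulrDl -scalerAl lpi_linear.
move=> a y z b; rewrite -(linearE (lpi_linear uea_rel)).1.1.1; apply/lpi_eq.
by rewrite subr0 -(mulrA _ b) => N _; apply; exact: UeaRel.
Qed.

Definition fmonom_par (w : {fmonom (lbasis L)}) : bool := odd (count (@lpar _ L) w).

Definition uea_spr (i : bool) (u : uea) : uea :=
  lext (fun w => if fmonom_par w == i then lpi uea_rel << w >> else 0) (lrepr u).

(* U(L) (x)_{U(L_P)} W, where L_P is the subalgebra spanned by P. *)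
Definition induced (P : pred (lbasis L)) (Pbr : br_closed P)
    (W : rep (lsub Pbr)) : rep L :=
  @Rep K L (tens (fun x : lbasis (lsub Pbr) => uea_rmul (val x)) (@act _ _ W))
    (fun i => tlift (fun u w =>
       \sum_(j : bool) tmul _ _ (uea_spr j u) (spr (i (+) j) w)))
    (fun x => tlift (fun u w => tmul _ _ (uea_lmul x u) w)).

Lemma uea_lmul_linear x : linear (uea_lmul x).
Proof.
move=> a u v; rewrite -[u]lreprK -[v]lreprK -lpi_linear !uea_lmulE -lpi_linear.
by congr (lpi _ _); rewrite (mulrDr (fgen x)) free_mulrAr.
Qed.

Lemma induced_actE P (Pbr : @br_closed K L P) (W : rep (lsub Pbr)) x u (w : W) :
  @act _ _ (induced W) x (tmul _ _ u w) = tmul _ _ (uea_lmul x u) w.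
Proof.
pose rA (y : lbasis (lsub Pbr)) := @uea_rmul (val y).
pose lB := @act _ _ W; apply: (@tlift_tmul _ _ _ _ rA lB) => [b a u1 u2|a|y a b].
- by rewrite uea_lmul_linear; apply: (tmul_linearl rA lB).
- exact: (tmul_linearr rA lB).
- suff -> : uea_lmul x (rA y a) = rA y (uea_lmul x a).
    exact: (tmul_balanced rA lB).
  by rewrite -[a]lreprK uea_lmulE /rA !uea_rmulE uea_lmulE mulrA.
Qed.

End Enveloping.

Definition half {F : fieldType} (k : int) : F := k%:~R + 2^-1.

(* gG k and gF k stand for G_{k+1/2} and F_{k+1/2}. *)
Inductive gbasis :=
  gL of int | gH of int | gG of int | gF of int | gC1 | gC2 | gC3.

Definition gbasis_code (x : gbasis) : nat * int :=
  match x with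
  | gL m => (0%N, m) | gH m => (1%N, m) | gG k => (2%N, k) | gF k => (3%N, k)
  | gC1 => (4%N, 0) | gC2 => (5%N, 0) | gC3 => (6%N, 0)
  end.

Definition gbasis_decode (c : nat * int) : gbasis :=
  match c.1 with
  | 0%N => gL c.2 | 1%N => gH c.2 | 2%N => gG c.2 | 3%N => gF c.2
  | 4%N => gC1 | 5%N => gC2 | _ => gC3
  end.

Fact gbasis_codeK : cancel gbasis_code gbasis_decode.
Proof. by case. Qed.

HB.instance Definition _ := Equality.copy gbasis (can_type gbasis_codeK).
HB.instance Definition _ := Choice.copy gbasis (can_type gbasis_codeK).

Definition gpar (x : gbasis) : bool :=
  match x with gG _ | gF _ => true | _ => false end.

Definition gdeg2 (x : gbasis) : int :=
  match x with
  | gL m | gH m => m *+ 2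
  | gG k | gF k => k *+ 2 + 1
  | _ => 0
  end.

Section Bracket.
Context (K : numFieldType).
Implicit Types m n p q : int.
Local Notation comb := (seq (K * gbasis)).

Definition brLL m n : comb :=
  (m%:~R - n%:~R, gL (m + n))
    :: nseq (m + n == 0) ((m%:~R ^+ 3 - m%:~R) / 12, gC1).
Definition brLH m n : comb :=
  (- n%:~R, gH (m + n)) :: nseq (m + n == 0) (m%:~R ^+ 2 + m%:~R, gC2).
Definition brHH m n : comb := nseq (m + n == 0) (m%:~R, gC3).
Definition brLG m p : comb := [:: (m%:~R / 2 - half p, gG (m + p))].
Definition brGG p q : comb :=
  (2, gL (p + q + 1))
    :: nseq (p + q + 1 == 0) (3^-1 * (half p ^+ 2 - 4^-1), gC1).
Definition brLF m p : comb := [:: (- (m%:~R / 2 + half p), gF (m + p))].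
Definition brFF p q : comb := nseq (p + q + 1 == 0) (1, gC3).
Definition brGF p q : comb :=
  (1, gH (p + q + 1)) :: nseq (p + q + 1 == 0) (2 * half p + 1, gC2).
Definition brHG m p : comb := [:: (m%:~R, gF (m + p))].

Definition oppc (s : comb) : comb := [seq (- t.1, t.2) | t <- s].

Definition gbr (x y : gbasis) : comb :=
  match x, y with
  | gL m, gL n => brLL m n
  | gL m, gH n => brLH m n | gH n, gL m => oppc (brLH m n)
  | gH m, gH n => brHH m n
  | gL m, gG p => brLG m p | gG p, gL m => oppc (brLG m p)
  | gG p, gG q => brGG p q
  | gL m, gF p => brLF m p | gF p, gL m => oppc (brLF m p)
  | gF p, gF q => brFF p q
  | gG p, gF q => brGF p q | gF q, gG p => brGF p q
  | gH m, gG p => brHG m p | gG p, gH m => oppc (brHG m p)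
  | _, _ => [::]
  end.

Fact gbr_homog x y t : t \in gbr x y ->
  gpar t.2 = gpar x (+) gpar y /\ gdeg2 t.2 = gdeg2 x + gdeg2 y.
Proof.
pose homog (t : K * gbasis) :=
  (gpar t.2 == gpar x (+) gpar y) && (gdeg2 t.2 == gdeg2 x + gdeg2 y).
suff /allP h : all homog (gbr x y) by move=> /h /andP[/eqP-> /eqP->].
by rewrite {}/homog; case: x => [m|m|m|m|||]; case: y => [n|n|n|n|||];
  rewrite /= /oppc /= ?all_map ?all_nseq /= ?mulrnDl; lia.
Qed.

Fact gbr_par x y t : t \in gbr x y -> gpar t.2 = gpar x (+) gpar y.
Proof. by case/gbr_homog. Qed.

Fact gbr_deg x y t : t \in gbr x y -> gdeg2 t.2 = gdeg2 x + gdeg2 y.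
Proof. by case/gbr_homog. Qed.

Implicit Types f : gbasis -> K^o.

Let lcomb_nil f : lcomb f [::] = 0 :> K.
Proof. by rewrite /lcomb big_nil. Qed.

Let lcomb_cons f t s : lcomb f (t :: s) = t.1 * f t.2 + lcomb f s :> K.
Proof. by rewrite /lcomb big_cons. Qed.

Let lcomb_nseq f (b : bool) t : lcomb f (nseq b t) = b%:R * (t.1 * f t.2) :> K.
Proof. by case: b; rewrite /= ?lcomb_cons lcomb_nil ?mul0r ?mul1r ?addr0. Qed.

Let lcomb_opp f s : lcomb f (oppc s) = - lcomb f s :> K.
Proof.
by rewrite /lcomb big_map -sumrN; apply: eq_bigr => t _; rewrite scaleNr.
Qed.

Let lcombE := (lcomb_opp, lcomb_cons, lcomb_nseq, lcomb_nil).

Fact gbr_skew f x y :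
  lcomb f (gbr x y) = - (-1) ^+ (gpar x && gpar y) * lcomb f (gbr y x).
Proof.
case: x => [m|m|m|m|||]; case: y => [n|n|n|n|||] //=;
  rewrite /brLL /brHH /brGG /brFF ?lcombE /= ?(addrC n m); try by ring.
all: case: eqP => /= [e|_]; last by ring.
all: first [have -> : n = - m by lia | have -> : n = - m - 1 by lia].
all: by rewrite /half; field.
Qed.

Let central x := if x is (gC1 | gC2 | gC3) then true else false.

Let gbr_central f c : central c ->
  (forall x, gbr x c = [::]) * (forall x, gbr c x = [::])
  * (forall s, lcomb (fun b => lcomb f (gbr c b)) s = 0 :> K)
  * (forall s, lcomb (fun b => lcomb f (gbr b c)) s = 0 :> K).
Proof.
move=> cc; have c0 : (forall x, gbr x c = [::]) * (forall x, gbr c x = [::]).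
  by case: c cc => // _; split; case.
by split; [split|] => // s; apply: big1 => t _; rewrite c0 lcomb_nil scaler0.
Qed.

Ltac unify_args c := repeat match goal with |- context [c ?i] =>
  match goal with |- context [c ?j] =>
    tryif constr_eq i j then fail else rewrite (_ : j = i); last lia end end.
Ltac unify_indices :=
  unify_args gL; unify_args gH; unify_args gG; unify_args gF;
  repeat match goal with |- context [?i == 0] =>
    match goal with |- context [?j == 0] =>
      tryif constr_eq i j then fail else rewrite (_ : j = i); last lia end end.

Fact gbr_jacobi f x y z :
  lcomb (fun b => lcomb f (gbr x b)) (gbr y z) =
  lcomb (fun b => lcomb f (gbr b z)) (gbr x y)
  + (-1) ^+ (gpar x && gpar y) * lcomb (fun b => lcomb f (gbr y b)) (gbr x z).
Proof.
have [/(gbr_central f) cE|] := boolP (central x).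
  by rewrite !cE !lcomb_nil mulr0 addr0.
have [/(gbr_central f) cE|] := boolP (central y).
  by rewrite !cE !lcomb_nil mulr0 addr0.
have [/(gbr_central f) cE|] := boolP (central z).
  by rewrite !cE !lcomb_nil mulr0 addr0.
case: x => [m|m|m|m|||] //=; case: y => [n|n|n|n|||] //=;
case: z => [k|k|k|k|||] //= _ _ _;
rewrite /brLL /brLH /brHH /brLG /brGG /brLF /brFF /brGF /brHG ?lcombE /=
        ?lcombE /= ?mulr0 ?addr0 ?oppr0 // /half; unify_indices; try by field.
all: case: eqP => /= e; last by field.
all: first [have -> : k = - (m + n) by lia | have -> : k = - (m + n) - 1 by lia].
all: by field.
Qed.

End Bracket.

Definition scalg (K : numFieldType) : lieSuper K :=
  LieSuper (@gbr_par K) (@gbr_deg K) (@gbr_skew K) (@gbr_jacobi K).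

Section Subalgebras.
Context {K : numFieldType}.
Local Notation g := (scalg K).

Definition in_svir (x : gbasis) : bool :=
  match x with gL _ | gG _ | gC1 => true | _ => false end.
Definition in_hc (x : gbasis) : bool :=
  match x with gH _ | gF _ | gC3 => true | _ => false end.
Definition in_gmn (m : nat) (n : int) (x : gbasis) : bool :=
  match x with
  | gL i | gG i => m%:Z <= i
  | gH i | gF i => n <= i
  | _ => true
  end.

Fact svir_closed : @br_closed K g in_svir.
Proof.
move=> x y xP yP t; apply/allP: t.
by case: x xP => [?|?|?|?|||] // _; case: y yP => [?|?|?|?|||] //= _;
  rewrite /oppc ?all_map ?all_nseq /= ?all_nseq ?orbT.
Qed.

Fact hc_closed : @br_closed K g in_hc.
Proof.
move=> x y xP yP t; apply/allP: t.
by case: x xP => [?|?|?|?|||] // _; case: y yP => [?|?|?|?|||] //= _;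
  rewrite /oppc ?all_map ?all_nseq /= ?all_nseq ?orbT.
Qed.

Fact gmn_closed (m : nat) (n : int) : @br_closed K g (in_gmn m n).
Proof.
move=> x y xP yP t; apply/allP: t.
by case: x xP => [?|?|?|?|||] //= xP; case: y yP => [?|?|?|?|||] //= yP;
  rewrite /oppc ?all_map ?all_nseq /= ?all_map ?all_nseq ?orbT ?andbT //; lia.
Qed.

Definition svir : lieSuper K := lsub svir_closed.
Definition hc : lieSuper K := lsub hc_closed.
Definition gmn (m : nat) (n : int) : lieSuper K := lsub (@gmn_closed m n).

(* The operators of a module over hc or svir, extended by 0 to the other basis
   elements of g. *)
Definition act_hc (H : rep hc) (x : gbasis) (v : H) : H :=
  @ext0 K g in_hc H (fun c => @act K hc H c v) x.

Definition act_svir (U : rep svir) (x : gbasis) (v : U) : U :=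
  @ext0 K g in_svir U (fun c => @act K svir U c v) x.

Definition has_level (l : K) (V : rep g) : Prop :=
  forall v : V, @act K g V gC3 v = l *: v.

Definition hc_has_level (l : K) (H : rep hc) : Prop :=
  forall v : H, act_hc gC3 v = l *: v.

(* U^g *)
Definition svir_ext (U : rep svir) : rep g :=
  @Rep K g U (@spr K svir U) (@act_svir U).

Section Sugawara.
Variables (l z : K) (H : rep hc).
Local Notation opH k := (@act_hc H (gH k)).
Local Notation opF k := (@act_hc H (gF k)).

Definition normHH (i j : int) (v : H) : H :=
  if i < j then opH i (opH j v) else opH j (opH i v).

Definition normFF (i j : int) (v : H) : H :=
  if i < j then opF i (opF j v) else - opF j (opF i v).

Definition opL (n : int) (v : H) : H :=
  (2 * l)^-1 *: (\sum_(k \in [set: int]) normHH k (- k + n) v)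
  + ((n%:~R + 1) * z / l) *: opH n v
  - (2 * l)^-1 *:
      (\sum_(k \in [set: int]) (half k + 2^-1) *: normFF k (- k - 1 + n) v).

Definition opG (p : int) (v : H) : H :=
  l^-1 *: (\sum_(k \in [set: int]) opH k (opF (- k + p) v))
  + ((2 * half p + 1) * z / l) *: opF p v.

(* H(z)^g.  On a smooth module the sums above have finitely many nonzero terms
   on each vector; in opL the index k of the second sum stands for r = k + 1/2,
   so that -r + n = (-k - 1 + n) + 1/2. *)
Definition hc_ext : rep g :=
  @Rep K g H (@spr K hc H) (fun x v =>
    match x with
    | gL n => opL n v
    | gG p => opG p v
    | gC1 => (3 / 2 - 12 * z ^+ 2 / l) *: v
    | gC2 => z *: v
    | _ => act_hc x v
    end).

End Sugawara.
End Subalgebras.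

(* Main.v *)
From HB Require Import structures.
Require Import Defs.
From mathcomp Require Import all_boot all_order all_algebra.
From mathcomp Require Import finmap monalg.
From mathcomp Require Import boolp classical_sets cardinality fsbigop reals complex.
From mathcomp Require Import zify ring lra.

(** Let S be a simple smooth module of level l <> 0.

    S has countable dimension, so by the lemma of Schur in the form of Dixmier
    ([endomorphism_scalar]) c_1 and c_2 act by scalars c and z.  The Sugawara
    operators of H(z), written in terms of the action of hc on S, have the same
    brackets with hc as the L_n and G_r do.  Subtracting them leaves operators
    L'_n and G'_r that supercommute with hc and satisfy the relations of the
    super Virasoro algebra again ([pr_act]).  So S is a module over two supercommuting
    algebras, the decoupled super Virasoro algebra and hc.

    By smoothness some nonzero vectors are killed by all L'_n, G'_r of large
    degree.  For the least M such that A = {v killed in degrees > M} is nonzero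
    ([least_level]), L'_M is injective on A if M > 0.  There are two cases.

    If M = 0 and L'_0 has an eigenvector in A, of eigenvalue h, then the
    lowest weight vectors of weight h form an hc-module H, and an even one, w0,
    generates a super Virasoro module U.  A submodule of either one generates a
    submodule of S, and comparing eigenvalues of L'_0 shows that H and U are
    simple.  The map U (x) H -> S with x w0 (x) v |-> x v is well defined because
    H is generated by w0 under operators supercommuting with x; it is an
    isomorphism ([factor_iso]), which is the third alternative.

    Otherwise the sorted words in the L'_n, G'_r of negative degree are
    independent over A ([virasoro_independent]).  To see this one applies to a
    relation the letter of degree M + d, for a letter of degree -d in the longest
    word: it contracts that letter to a nonzero multiple of L'_M, acting on the
    coefficient, so the leading coefficients would span a finite-dimensional
    L'_0-stable space (M = 0) or be killed by L'_M (M > 0).  In the same way, with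
    c_3 in place of L'_M, the words in H_k, F_k of degree below -r are
    independent over the vectors killed by hc in degrees > r
    ([heisenberg_independent]).  For large r some nonzero vectors satisfy both
    conditions.  They form a module over g^(0,-r), and the words complementary
    to this subalgebra are independent over it ([creation_independent]); as S is
    simple, S is induced from it and it is simple ([induced_iso],
    [induced_simple]).  This is the second alternative.

    The first alternative is the case of the third in which U is trivial. *)

Set Implicit Arguments.
Unset Strict Implicit.
Unset Printing Implicit Defensive.

Import Order.TTheory GRing.Theory Num.Theory.

Local Open Scope classical_set_scope.
Local Open Scope ring_scope.

(** * Linear maps and spans *)

Section LinearMaps.
Context {K : numFieldType} {V Z : lmodType K}.
Variable f : V -> Z.
Hypothesis fP : linear f.

Lemma lin0 : f 0 = 0. Proof. by rewrite (Defs.linearE fP). Qed.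
Lemma linD u v : f (u + v) = f u + f v. Proof. by rewrite (Defs.linearE fP). Qed.
Lemma linN u : f (- u) = - f u. Proof. by rewrite (Defs.linearE fP). Qed.
Lemma linB u v : f (u - v) = f u - f v. Proof. by rewrite linD linN. Qed.
Lemma linZ a u : f (a *: u) = a *: f u. Proof. by rewrite (Defs.linearE fP). Qed.
Lemma lin_sum I (r : seq I) (P : pred I) (F : I -> V) :
  f (\sum_(i <- r | P i) F i) = \sum_(i <- r | P i) f (F i).
Proof. exact: (big_morph f linD lin0). Qed.
End LinearMaps.

Lemma linear_comp {K : numFieldType} {V Y Z : lmodType K} (f : Y -> Z) (g : V -> Y) :
  linear f -> linear g -> linear (fun v => f (g v)).
Proof. by move=> fP gP c u v; rewrite gP fP. Qed.

Lemma linear_add {K : numFieldType} {V Z : lmodType K} (f g : V -> Z) :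
  linear f -> linear g -> linear (fun v => f v + g v).
Proof. by move=> fP gP c u v; rewrite fP gP scalerDr addrACA. Qed.

Lemma linear_scale {K : numFieldType} {V Z : lmodType K} (f : V -> Z) (a : K) :
  linear f -> linear (fun v => a *: f v).
Proof. by move=> fP c u v; rewrite fP scalerDr !scalerA mulrC. Qed.

Lemma linear_opp {K : numFieldType} {V Z : lmodType K} (f : V -> Z) :
  linear f -> linear (fun v => - f v).
Proof. by move=> fP c u v; rewrite fP opprD scalerN. Qed.

Section Span.
Context {K : numFieldType} {V : lmodType K}.
Implicit Types (E F N : set V) (v : V).

Lemma subspace0 N : subspace N -> N 0. Proof. by case. Qed.
Lemma subspaceD N u v : subspace N -> N u -> N v -> N (u + v).
Proof. by move=> [_ NP] Nu Nv; rewrite -[u]scale1r; apply: NP. Qed.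
Lemma subspaceZ N a v : subspace N -> N v -> N (a *: v).
Proof. by move=> [N0 NP] Nv; rewrite -[_ *: _]addr0; apply: NP. Qed.
Lemma subspaceN N v : subspace N -> N v -> N (- v).
Proof. by move=> NP Nv; rewrite -scaleN1r; apply: subspaceZ. Qed.
Lemma subspaceB N u v : subspace N -> N u -> N v -> N (u - v).
Proof. by move=> NP Nu Nv; apply: subspaceD => //; apply: subspaceN. Qed.
Lemma subspace_sum N I (r : seq I) (P : pred I) (F : I -> V) : subspace N ->
  (forall i, P i -> N (F i)) -> N (\sum_(i <- r | P i) F i).
Proof.
move=> NP NF; apply: (big_ind N) => //; first exact: subspace0.
by move=> u v; apply: subspaceD.
Qed.
Lemma subspace_sum_seq N (I : eqType) (r : seq I) (F : I -> V) : subspace N ->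
  (forall i, i \in r -> N (F i)) -> N (\sum_(i <- r) F i).
Proof. by move=> NP NF; rewrite big_seq; apply: subspace_sum. Qed.

Lemma lspan_in E v : E v -> lspan E v.
Proof. by move=> Ev N _; apply. Qed.
Lemma lspan_le E N v : subspace N -> E `<=` N -> lspan E v -> N v.
Proof. by move=> NP EN; apply. Qed.
Lemma lspan_mono E F v : E `<=` lspan F -> lspan E v -> lspan F v.
Proof. by move=> EF; apply: lspan_le => //; exact: lspan_subspace. Qed.
Lemma lspan_subset E F v : E `<=` F -> lspan E v -> lspan F v.
Proof. by move=> EF; apply: lspan_mono => u /EF; exact: lspan_in. Qed.
Lemma lspan0 E : lspan E 0. Proof. exact: subspace0 (lspan_subspace E). Qed.
Lemma lspanD E u v : lspan E u -> lspan E v -> lspan E (u + v).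
Proof. exact: subspaceD (lspan_subspace E). Qed.
Lemma lspanN E v : lspan E v -> lspan E (- v).
Proof. exact: subspaceN (lspan_subspace E). Qed.
Lemma lspanB E u v : lspan E u -> lspan E v -> lspan E (u - v).
Proof. exact: subspaceB (lspan_subspace E). Qed.
Lemma lspanZ E a v : lspan E v -> lspan E (a *: v).
Proof. exact: subspaceZ (lspan_subspace E). Qed.
Lemma lspan_id N v : subspace N -> lspan N v -> N v.
Proof. by move=> NP; apply: lspan_le. Qed.
End Span.

Lemma lspan_map {K : numFieldType} {V Z : lmodType K} (f : V -> Z)
    (E : set V) (F : set Z) v : linear f ->
  (forall u, E u -> lspan F (f u)) -> lspan E v -> lspan F (f v).
Proof.
move=> fP fE; apply: (@lspan_le _ _ E [set u | lspan F (f u)]) => //.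
split=> [|a u w /= Fu Fw]; first by rewrite /= lin0 //; apply: lspan0.
by rewrite fP; apply: lspanD => //; apply: lspanZ.
Qed.

(** Collecting the terms of a combination according to s: each s then occurs
    once, with a single coefficient vector, as the independence statements
    below require. *)
Lemma lspan_family {K : numFieldType} {V A : lmodType K} (S : eqType)
    (g : S -> A -> V) (Q : set S) (N : set A) v :
  (forall s, linear (g s)) -> subspace N ->
  lspan [set x | exists s a, [/\ Q s, N a & x = g s a]] v ->
  exists (L : seq S) (a : S -> A),
    [/\ uniq L, forall s, s \in L -> Q s, forall s, N (a s)
      & v = \sum_(s <- L) g s (a s)].
Proof.
move=> gP NP.
pose M := [set x | exists (L : seq S) (a : S -> A),
    [/\ uniq L, forall s, s \in L -> Q s,
       (forall s, N (a s)) /\ (forall s, s \notin L -> a s = 0)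
      & x = \sum_(s <- L) g s (a s)]].
suff h : lspan [set x | exists s a, [/\ Q s, N a & x = g s a]] v -> M v.
  by move=> /h[L [a [? ? [? _] ?]]]; exists L, a.
apply: lspan_le => [|x [s [a [Qs Na ->]]]]; last first.
  exists [:: s], (fun t => if t == s then a else 0); split=> //.
  - by move=> t; rewrite inE => /eqP->.
  - split=> t; first by case: eqP => // _; exact: subspace0.
    by rewrite inE => /negPf->.
  - by rewrite big_seq1 eqxx.
split=> [|c u w [L [a [uL QL [Na a0] ->]]] [L' [a' [uL' QL' [Na' a0'] ->]]]].
  exists [::], (fun=> 0); split=> //; last by rewrite big_nil.
  by split=> // s; exact: subspace0.
have ext b T T' : uniq T -> uniq T' -> {subset T <= T'} ->
    (forall s, s \notin T -> b s = 0) ->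
    \sum_(s <- T) g s (b s) = \sum_(s <- T') g s (b s).
  move=> uT uT' TT' b0; rewrite [RHS](bigID (mem T)) /= [X in _ = _ + X]big1.
    rewrite addr0 -[RHS]big_filter; apply: perm_big; apply: uniq_perm => //.
      exact: filter_uniq.
    by move=> s; rewrite mem_filter andb_idr // => /TT'.
  by move=> s /b0 ->; rewrite lin0.
pose LL := undup (L ++ L').
have sL : {subset L <= LL} by move=> s sL; rewrite mem_undup mem_cat sL.
have sL' : {subset L' <= LL} by move=> s sL'; rewrite mem_undup mem_cat sL' orbT.
exists LL, (fun s => c *: a s + a' s); split.
- exact: undup_uniq.
- by move=> s; rewrite mem_undup mem_cat => /orP[/QL|/QL'].
- split=> s; first by case: NP => _; apply.
  rewrite mem_undup mem_cat negb_or => /andP[/a0-> /a0'->].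
  by rewrite scaler0 addr0.
- rewrite (ext a L LL) ?undup_uniq // (ext a' L' LL) ?undup_uniq //.
  by rewrite scaler_sumr -big_split; apply: eq_bigr => s _; rewrite gP.
Qed.

Section FiniteSpan.
Context {K : numFieldType} {V : lmodType K}.

Lemma lspan_seq (s : seq V) v : lspan [set` s] v ->
  exists c : 'I_(size s) -> K, v = \sum_i c i *: s`_i.
Proof.
apply: (@lspan_le _ _ _ [set v | exists c : 'I_(size s) -> K, v = \sum_i c i *: s`_i]).
  split=> [|a u w [c ->] [c' ->]].
    by exists (fun=> 0); rewrite big1 // => i _; rewrite scale0r.
  exists (fun i => a * c i + c' i); rewrite scaler_sumr -big_split.
  by apply: eq_bigr => i _; rewrite scalerDl scalerA.
move=> w /= ws; have lt : (index w s < size s)%N by rewrite index_mem.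
exists (fun i => (i == Ordinal lt)%:R); rewrite (bigD1 (Ordinal lt)) //=.
rewrite eqxx scale1r nth_index // big1 ?addr0 // => i /negPf->.
by rewrite scale0r.
Qed.

(** Too many vectors in the span of s: their coefficient matrix has a nonzero
    row kernel. *)
Lemma dependent (s : seq V) (u : 'I_(size s).+1 -> V) :
  (forall i, lspan [set` s] (u i)) ->
  exists2 c : 'I_(size s).+1 -> K, exists i, c i != 0 & \sum_i c i *: u i = 0.
Proof.
move=> us; have /choice[q uq] i : exists c : 'I_(size s) -> K,
   u i = \sum_j c j *: s`_j by apply: lspan_seq.
pose Q : 'M[K]_((size s).+1, size s) := \matrix_(i, j) q i j.
have /rowV0Pn[c /sub_kermxP cQ c0] : kermx Q != 0.
  by rewrite -mxrank_eq0 mxrank_ker -lt0n subn_gt0 ltnS rank_leq_col.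
exists (fun i => c ord0 i).
  apply/existsP; apply: contraT => /existsPn c00; case/eqP: c0.
  by apply/rowP => i; rewrite mxE; apply/eqP; rewrite -[_ == _]negbK c00.
rewrite (eq_bigr (fun i => \sum_j (c ord0 i * q i j) *: s`_j)); last first.
  move=> i _; rewrite uq scaler_sumr; apply: eq_bigr => j _.
  by rewrite scalerA.
rewrite exchange_big big1 // => j _; rewrite -scaler_suml.
move/matrixP: cQ => /(_ ord0 j); rewrite !mxE => cQ.
apply/eqP; rewrite scaler_eq0; apply/orP; left; apply/eqP.
by apply: etrans cQ; apply: eq_bigr => i _; rewrite mxE.
Qed.
End FiniteSpan.

(** * Eigenvectors, and operators on spaces of countable dimension *)

Section PolyOperator.
Context {K : numFieldType} {V : lmodType K}.
Variable T : V -> V.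
Hypothesis TP : linear T.
Implicit Types (p q : {poly K}) (v : V).

Definition polyop p v : V := \sum_(i < size p) p`_i *: iter i T v.

Lemma polyop_widen n p v : (size p <= n)%N ->
  polyop p v = \sum_(i < n) p`_i *: iter i T v.
Proof.
move=> pn; rewrite /polyop (big_ord_widen n (fun i => p`_i *: iter i T v)) //.
rewrite big_mkcond; apply: eq_bigr => i _; case: ltnP => // /(nth_default 0) ->.
by rewrite scale0r.
Qed.

Lemma polyopD p q v : polyop (p + q) v = polyop p v + polyop q v.
Proof.
rewrite (polyop_widen v (size_polyD p q)) (polyop_widen v (leq_maxl _ (size q))).
rewrite (polyop_widen v (leq_maxr (size p) _)).
by rewrite -big_split; apply: eq_bigr => i _; rewrite coefD scalerDl.
Qed.

Lemma polyopZ c p v : polyop (c *: p) v = c *: polyop p v.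
Proof.
rewrite !(@polyop_widen (size p)) ?size_scale_leq // scaler_sumr.
by apply: eq_bigr => i _; rewrite coefZ scalerA.
Qed.

Lemma polyop0 v : polyop 0 v = 0. Proof. by rewrite /polyop size_poly0 big_ord0. Qed.

Lemma polyop_sum (I : Type) (r : seq I) (F : I -> {poly K}) v :
  polyop (\sum_(i <- r) F i) v = \sum_(i <- r) polyop (F i) v.
Proof.
by elim: r => [|i r IH]; rewrite ?big_nil ?polyop0 // !big_cons polyopD IH.
Qed.

Lemma iter_linear i : linear (iter i T).
Proof. by elim: i => // i IH c u v; rewrite !iterS IH TP. Qed.

Lemma polyop_linear p : linear (polyop p).
Proof.
move=> c u v; rewrite /polyop scaler_sumr -big_split; apply: eq_bigr => i _.
by rewrite iter_linear scalerDr !scalerA mulrC.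
Qed.

Lemma polyopC c v : polyop c%:P v = c *: v.
Proof. by rewrite (@polyop_widen 1%N) ?size_polyC_leq1 // big_ord1 coefC. Qed.

Lemma polyopMX p v : polyop (p * 'X) v = T (polyop p v).
Proof.
rewrite (@polyop_widen (size p).+1); last first.
  by rewrite (leq_trans (size_polyMleq _ _)) // size_polyX addn2.
rewrite big_ord_recl coefMX scale0r add0r /polyop (lin_sum TP).
by apply: eq_bigr => i _; rewrite coefMX /= (linZ TP).
Qed.

Lemma polyop_comm p v : polyop p (T v) = T (polyop p v).
Proof.
rewrite /polyop (lin_sum TP); apply: eq_bigr => i _.
by rewrite (linZ TP) -iterSr.
Qed.

Lemma polyopMXsubC p a v : polyop (p * ('X - a%:P)) v = T (polyop p v) - a *: polyop p v.
Proof.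
by rewrite mulrBr polyopD polyopMX mulrC mul_polyC -scaleNr polyopZ scaleNr.
Qed.

Lemma polyopMXsubCr p a v : polyop (p * ('X - a%:P)) v = polyop p (T v - a *: v).
Proof.
by rewrite polyopMXsubC (linB (polyop_linear p)) (linZ (polyop_linear p)) polyop_comm.
Qed.

Lemma polyop_eigen p v a : T v = a *: v -> polyop p v = p.[a] *: v.
Proof.
move=> Tv; rewrite /polyop horner_coef scaler_suml; apply: eq_bigr => i _.
rewrite -scalerA; congr (_ *: _).
by elim: (i : nat) => [|k IH] /=; rewrite ?scale1r // IH (linZ TP) Tv scalerA mulrC exprS mulrC.
Qed.

Lemma polyop_stable (N : set V) p v : subspace N -> (forall u, N u -> N (T u)) ->
  N v -> N (polyop p v).
Proof.
move=> NP NT Nv; apply: subspace_sum => // i _; apply: subspaceZ => //.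
by elim: (i : nat) => //= k; apply: NT.
Qed.
End PolyOperator.

Section Eigenvectors.
Context {K : numClosedFieldType} {V : lmodType K}.
Variable T : V -> V.
Hypothesis TP : linear T.

Lemma polyop_eigenvector (N : set V) p v : subspace N -> (forall u, N u -> N (T u)) ->
  N v -> v != 0 -> p != 0 -> polyop T p v = 0 ->
  exists a w, [/\ N w, w != 0 & T w = a *: w].
Proof.
move=> NP NT Nv v0; have [n] := ubnP (size p); elim: n p => // n IH p pn p0 pv.
have [p1|p1] := leqP (size p) 1.
  move: pv p0; rewrite (size1_polyC p1) polyopC => /eqP; rewrite scaler_eq0.
  by rewrite (negPf v0) orbF => /eqP->; rewrite eqxx.
have /closed_rootP[a /factor_theorem[q pq]] : size p != 1%N by case: (size p) p1 => [|[]].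
have q0 : q != 0 by apply: contraNneq p0; rewrite pq => ->; rewrite mul0r.
have [qv|qv] := eqVneq (polyop T q v) 0.
  apply: IH qv => //; move: pn; rewrite pq size_Mmonic ?monicXsubC //.
  by rewrite size_XsubC addn2.
exists a, (polyop T q v); split=> //; first exact: polyop_stable.
by apply/eqP; rewrite -subr_eq0 -polyopMXsubC // -pq pv.
Qed.

(** A finite-dimensional stable subspace contains an eigenvector: v and its
    images under T are dependent, so a nonzero polynomial in T kills v, and
    over an algebraically closed field one peels off its linear factors. *)
Lemma stable_eigenvector (s : seq V) v :
  (forall u, u \in s -> lspan [set` s] (T u)) -> v \in s -> v != 0 ->
  exists a w, [/\ lspan [set` s] w, w != 0 & T w = a *: w].
Proof.
move=> sT vs v0; have sT' u : lspan [set` s] u -> lspan [set` s] (T u).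
  exact: (lspan_map TP).
have sv : lspan [set` s] v by apply: lspan_in.
have [|c [i ci] cv] := @dependent _ _ s (fun i => iter i T v).
  by move=> i; elim: (i : nat) => //= k; apply: sT'.
pose p := \poly_(i < (size s).+1) c (inord i).
apply: (@polyop_eigenvector (lspan [set` s]) p v) => //.
- exact: lspan_subspace.
- apply: contraNneq ci => p0; have := coef_poly (size s).+1 (fun i => c (inord i)) i.
  by rewrite -/p p0 coef0 ltn_ord inord_val => <-.
- rewrite (@polyop_widen _ _ _ (size s).+1) ?size_poly // -[RHS]cv.
  by apply: eq_bigr => j _; rewrite coef_poly ltn_ord inord_val.
Qed.

(** With P a the product of the X - b over the b != a in s, clearing
    denominators turns a relation into p(T) v = 0, where p is the sum of the c
    a P a. As T has no eigenvector, p = 0, and evaluation at a gives c a =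
    0. *)
Lemma resolvent_independent (v : V) (u : K -> V) (s : seq K) (c : K -> K) :
  (forall a w, T w = a *: w -> w = 0) -> v != 0 ->
  (forall a, T (u a) - a *: u a = v) -> uniq s ->
  \sum_(a <- s) c a *: u a = 0 -> forall a, a \in s -> c a = 0.
Proof.
move=> noeig v0 uv us cu a as_.
pose P a := \prod_(b <- s | b != a) ('X - b%:P : {poly K}).
pose p := \sum_(a <- s) c a *: P a.
have Pv b : b \in s -> polyop T (P b) v = polyop T (\prod_(b <- s) ('X - b%:P)) (u b).
  move=> bs; rewrite [in RHS](perm_big _ (perm_to_rem bs)) big_cons /= [in RHS]mulrC.

  rewrite (polyopMXsubCr TP) uv; congr (polyop _ _ _).
  rewrite /P (rem_filter _ us) big_filter.
  by apply: eq_bigl => x.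
have pv : polyop T p v = 0.
  rewrite /p polyop_sum (eq_big_seq (fun b => polyop T (\prod_(b <- s) ('X - b%:P)) (c b *: u b))).
    by rewrite -(lin_sum (polyop_linear TP _)) cu (lin0 (polyop_linear TP _)).
  by move=> b bs; rewrite polyopZ Pv // (linZ (polyop_linear TP _)).
have [p0|p0] := eqVneq p 0; last first.
  have [] := @polyop_eigenvector setT p v => // b [w [_ w0 /noeig wz]].
  by rewrite wz eqxx in w0.
move/(congr1 (fun q => q.[a])): p0; rewrite /p horner_sum horner0.
rewrite (bigD1_seq a) //= big1 ?addr0.
  rewrite hornerZ => /eqP; rewrite mulf_eq0 => /orP[/eqP //|].
  rewrite /P horner_prod prodf_seq_eq0 => /hasP[b _ /andP[ba]].
  by rewrite hornerXsubC subr_eq0 eq_sym (negPf ba).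
move=> b ba; rewrite hornerZ /P horner_prod; apply/eqP; rewrite mulf_eq0.
apply/orP; right; rewrite prodf_seq_eq0; apply/hasP; exists a => //=.
by rewrite hornerXsubC subrr eqxx eq_sym ba.
Qed.

(** Otherwise the vectors (T - a)^-1 v form an independent family indexed by
    the uncountable field K. Each finite part of the countable generating
    sequence contains only finitely many of them, so countably many finite
    lists would exhaust K. *)
Lemma countable_not_resolvent (b : nat -> V) :
  (forall f : nat -> K, exists a, forall n, f n != a) ->
  (forall v, lspan (range b) v) ->
  (forall a w, T w = a *: w -> w = 0) ->
  (forall a v, exists w, T w - a *: w = v) -> forall v : V, v = 0.
Proof.
move=> unc bP noeig surj v; apply/eqP; apply: contraT => v0.
have /choice[u uv] a : exists w, T w - a *: w = v by apply: surj.
pose bs n := [seq b i | i <- iota 0 n].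
have bsP w : exists n, lspan [set` bs n] w.
  move: (bP w); apply: (@lspan_le _ _ _ [set w | exists n, lspan [set` bs n] w]); last first.
    move=> _ [n _ <-]; exists n.+1; apply: lspan_in => /=; apply/mapP.
    by exists n => //; rewrite mem_iota; lia.
  have mono n m x : (n <= m)%N -> lspan [set` bs n] x -> lspan [set` bs m] x.
    move=> nm; apply: lspan_subset => y /= /mapP[k]; rewrite mem_iota => ilt ->.
    by apply/mapP; exists k => //; rewrite mem_iota; lia.
  split=> [|c x y [n xn] [m ym]]; first by exists 0%N; apply: lspan0.
  exists (maxn n m); apply: lspanD; first apply: lspanZ.
    by apply: mono xn; rewrite leq_max leqnn.
  by apply: mono ym; rewrite leq_max leqnn orbT.
have fin n : exists L : seq K, forall a, lspan [set` bs n] (u a) -> a \in L.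
  apply: contrapT => /forallNP noL.
  have long k : exists L : seq K,
      [/\ uniq L, size L = k & forall a, a \in L -> lspan [set` bs n] (u a)].
    elim: k => [|k [L [uL sL LP]]]; first by exists [::].
    have /existsNP[a /not_implyP[aP aL]] := noL L.
    exists (a :: L); split=> /=; rewrite ?sL //.
      by rewrite uL andbT; apply/negP.
    by move=> c; rewrite inE => /orP[/eqP->|/LP].
  have [L [uL sL LP]] := long (size (bs n)).+1.
  have [|c [i ci] cu] := @dependent _ _ (bs n) (fun i => u L`_i).
    by move=> i; apply: LP; rewrite mem_nth // sL.
  have iL (j : 'I_(size (bs n)).+1) : index L`_j L = j.
    by rewrite index_uniq // sL.
  have := @resolvent_independent v u L (fun a => c (inord (index a L))) noeig v0 uv uL.
  have -> : \sum_(a <- L) c (inord (index a L)) *: u a = 0.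
    rewrite (big_nth 0) sL big_mkord -[RHS]cu; apply: eq_bigr => j _.
    by rewrite iL inord_val.
  move=> /(_ erefl L`_i); rewrite mem_nth ?sL // iL inord_val => /(_ isT) c0.
  by rewrite c0 eqxx in ci.
have /choice[L LP] := fin.
(* f runs through the entries of all the lists L n *)
pose f (m : nat) := if (choice.unpickle m : option (nat * nat)) is Some ni then (L ni.1)`_ni.2 else 0.
have [a fa] := unc f; have [n /LP aL] := bsP (u a).
by have := fa (choice.pickle (n, index a (L n))); rewrite /f choice.pickleK /= nth_index // eqxx.
Qed.
End Eigenvectors.

(** Nested intervals [x n, x n + 3^-n]: the n-th step keeps the left or the
    right third of an interval, whichever avoids f n. *)
Lemma real_uncountable (R : realType) (f : nat -> R) : exists a, forall n, f n != a.
Proof.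
pose d n : R := 3^-1 ^+ n.
pose x := fix x n := if n is m.+1 then
  if f m < x m + d m / 2 then x m + 2 / 3 * d m else x m else 0.
have d0 n : 0 < d n by rewrite exprn_gt0 // invr_gt0.
have dS n : d n.+1 = d n / 3 by rewrite /d exprSr.
have xS n : x n <= x n.+1 /\ x n.+1 + d n.+1 <= x n + d n.
  by have := d0 n; rewrite dS /=; case: ifP => _ ?; split; lra.
have xm n k : x n <= x (n + k)%N /\ x (n + k)%N + d (n + k)%N <= x n + d n.
  elim: k => [|k [h1 h2]]; first by rewrite addn0.
  rewrite addnS; have [h3 h4] := xS (n + k)%N; split; first exact: le_trans h1 h3.
  exact: le_trans h4 h2.
have bound m n : x m <= x n + d n.
  have [mn|/ltnW nm] := leqP m n.
    have [h _] := xm m (n - m)%N; rewrite subnKC // in h.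
    by apply: le_trans h _; rewrite lerDl ltW.
  have [_ h] := xm n (m - n)%N; rewrite subnKC // in h.
  by apply: le_trans h; rewrite lerDl ltW.
have sx : has_sup (range x).
  split; first by exists (x 0%N); exists 0%N.
  by exists (x 0%N + d 0%N) => _ [m _ <-]; apply: bound.
exists (sup (range x)) => n; apply/eqP => fn.
have ub : x n.+1 <= sup (range x) by apply: ub_le_sup; [case: sx|exists n.+1].
have lb : sup (range x) <= x n.+1 + d n.+1.
  by apply: ge_sup => [|_ [m _ <-]]; [case: sx | apply: bound].
have := d0 n; move: ub lb; rewrite dS -fn /=; case: ltP => h ? ? ?; lra.
Qed.

Lemma complex_uncountable (R : realType) (f : nat -> R[i]) :
  exists a, forall n, f n != a.
Proof.
have [a ha] := real_uncountable (fun n => complex.Re (f n)).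
by exists (Complex a 0) => n; apply: contra_neq (ha n) => ->.
Qed.

(** * Sorted words in the basis of the algebra *)

Section LinearCombinations.
Context {K : numFieldType} {B : Type} {V : lmodType K}.
Implicit Types (f : B -> V).

Lemma lcomb_nil f : lcomb f [::] = 0.
Proof. by rewrite /lcomb big_nil. Qed.
Lemma lcomb_cons f t s : lcomb f (t :: s) = t.1 *: f t.2 + lcomb f s.
Proof. by rewrite /lcomb big_cons. Qed.
Lemma lcomb_nseq f (b : bool) t :
  lcomb f (nseq b t) = if b then t.1 *: f t.2 else 0.
Proof. by case: b; rewrite /= ?lcomb_cons lcomb_nil ?addr0. Qed.
End LinearCombinations.

Lemma lcomb_oppc {K : numFieldType} {V : lmodType K} (f : gbasis -> V)
  (s : seq (K * gbasis)) :
  lcomb f (Defs.oppc s) = - lcomb f s.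
Proof.
by rewrite /lcomb big_map -sumrN; apply: eq_bigr => t _; rewrite scaleNr.
Qed.

Definition lcombE := (@lcomb_oppc, @lcomb_cons, @lcomb_nseq, @lcomb_nil).

Lemma lcomb_in {K : numFieldType} {B : eqType} {V : lmodType K} (f : B -> V) s
    (N : set V) : subspace N -> (forall t, t \in s -> N (f t.2)) ->
  N (lcomb f s).
Proof.
move=> NP Nf; apply: subspace_sum_seq => // t ts; apply: subspaceZ => //.
exact: Nf.
Qed.

Lemma lspan_setU {K : numFieldType} {V : lmodType K} (E F : set V) v :
  lspan (E `|` F) v -> exists e f, [/\ lspan E e, lspan F f & v = e + f].
Proof.
apply: (@lspan_le _ _ _ [set v | exists e f, [/\ lspan E e, lspan F f & v = e + f]]).
  split=> [|c u w [e [f [Ee Ff ->]]] [e' [f' [Ee' Ff' ->]]]].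
    by exists 0, 0; rewrite addr0; split=> //; apply: lspan0.
  exists (c *: e + e'), (c *: f + f'); split; last by rewrite scalerDr addrACA.
    by apply: lspanD => //; apply: lspanZ.
  by apply: lspanD => //; apply: lspanZ.
move=> u [Eu|Fu]; [exists u, 0|exists 0, u]; rewrite ?addr0 ?add0r.
  by split=> //; [apply: lspan_in|apply: lspan0].
by split=> //; [apply: lspan0|apply: lspan_in].
Qed.

(** A representation of the whole algebra on an ungraded space; parity enters
    only through the signs. The Sugawara-modified operators satisfy this too,
    so that the arguments on words below apply to both actions. *)
Definition is_act {K : numFieldType} {V : lmodType K} (a : gbasis -> V -> V) : Prop :=
  (forall x, linear (a x)) /\ forall x y v,
    a x (a y v) - (-1) ^+ (gpar x && gpar y) *: a y (a x v)
    = lcomb (a^~ v) (gbr K x y).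

Definition wl (x : gbasis) : nat := `|gdeg2 x|%N.
Definition hcl (x : gbasis) : bool := in_hc x.
(** Super Virasoro letters come first, so that a sorted word splits into a
    super Virasoro and a Heisenberg-Clifford word (std_split). *)
Definition kl (x y : gbasis) : bool :=
  (~~ hcl x && hcl y) || ((hcl x == hcl y) && (wl x < wl y)%N).
(** Odd letters may not repeat, as the square of an odd letter is half of a
    bracket. *)
Definition ltl (x y : gbasis) : bool := kl x y || ((x == y) && ~~ gpar x).

Notation word := (seq gbasis).
Definition wt (s : word) : nat := sumn [seq wl x | x <- s].
(** The sorted words are the Poincare-Birkhoff-Witt monomials. *)
Definition std (s : word) : bool := pairwise ltl s.

Lemma wt_cons x s : wt (x :: s) = (wl x + wt s)%N. Proof. by []. Qed.
Lemma wt_cat s t : wt (s ++ t) = (wt s + wt t)%N.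
Proof. by rewrite /wt map_cat sumn_cat. Qed.
Lemma wt_rem x s : x \in s -> wt s = (wl x + wt (rem x s))%N.
Proof. by move=> xs; rewrite -wt_cons /wt; apply: perm_sumn; apply/perm_map/perm_to_rem. Qed.

Lemma kl_trans : transitive kl.
Proof. by move=> y x z; rewrite /kl; case: (hcl x) (hcl y) (hcl z) => [] [] [] //=; lia. Qed.

Lemma ltl_trans : transitive ltl.
Proof.
move=> y x z /orP[xy|/andP[/eqP-> yp]] /orP[yz|/andP[/eqP<- zp]]; rewrite /ltl.
- by rewrite (kl_trans xy yz).
- by rewrite xy.
- by rewrite yz.
- by rewrite eqxx yp orbT.
Qed.

Lemma ltl_anti : antisymmetric ltl.
Proof.
move=> x y /andP[/orP[xy|/andP[/eqP-> //]]] /orP[yx|/andP[/eqP<- //]].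
by move: xy yx; rewrite /kl; case: (hcl x) (hcl y) => [] [] //=; lia.
Qed.

Lemma std_perm s t : std s -> std t -> perm_eq s t -> s = t.
Proof.
move=> ss st; apply: (sorted_eq ltl_trans ltl_anti).
  by rewrite (sorted_pairwise ltl_trans).
by rewrite (sorted_pairwise ltl_trans).
Qed.

Lemma kl_total x y : gdeg2 x < 0 -> gdeg2 y < 0 -> [\/ kl x y, kl y x | x = y].
Proof.
move=> x0 y0; rewrite /kl; case hx: (hcl x); case hy: (hcl y) => /=;
  try by [constructor 1|constructor 2].
all: case: (ltngtP (wl x) (wl y)) => h; [by constructor 1| by constructor 2|].
all: constructor 3; move: h x0 y0 hx hy; rewrite /wl /hcl.
all: case: x => [m|m|m|m|||] //; case: y => [n|n|n|n|||] //= *; try lia.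
all: congr (_ _); lia.
Qed.

Section Words.
Context {K : numFieldType} {V : lmodType K} (a : gbasis -> V -> V).
Hypothesis aP : is_act a.

Lemma act_linear x : linear (a x). Proof. exact: aP.1. Qed.

Definition wact (s : word) (v : V) : V := foldr a v s.

Lemma wact_linear s : linear (wact s).
Proof. by elim: s => [|x s IH] c u v //=; rewrite IH act_linear. Qed.

Lemma wact_cat s t v : wact (s ++ t) v = wact s (wact t v).
Proof. by rewrite /wact foldr_cat. Qed.

Lemma act_swap x y v : a x (a y v) =
  (-1) ^+ (gpar x && gpar y) *: a y (a x v) + lcomb (a^~ v) (gbr K x y).
Proof. by rewrite -aP.2 addrC subrK. Qed.

Variable P : pred gbasis.
Hypothesis Pbr : forall x y, P x -> P y -> forall t, t \in gbr K x y -> P t.2.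
Hypothesis Pneg : forall x, P x -> gdeg2 x < 0.

Definition low (n k : nat) (v : V) : set V :=
  [set u | exists s, [/\ all P s, wt s = n, (size s <= k)%N & u = wact s v]].

Definition slow (n k : nat) (v : V) : set V :=
  [set u | exists s, [/\ all P s, std s, wt s = n, (size s <= k)%N & u = wact s v]].

Lemma low_cons n k v y u : P y -> lspan (low n k v) u ->
  lspan (low (wl y + n) k.+1 v) (a y u).
Proof.
move=> Py; apply: (lspan_map (act_linear y)) => _ [s [sP sn sk ->]].
by apply: lspan_in; exists (y :: s); rewrite /= Py sP wt_cons sn.
Qed.

Lemma low_cat n k v t u : all P t -> lspan (low n k v) u ->
  lspan (low (wt t + n) (size t + k) v) (wact t u).
Proof.
move=> tP; elim: t tP => //= y t IH /andP[Py tP] lu.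
by rewrite wt_cons -addnA addSn; apply: low_cons => //; exact: IH.
Qed.

Lemma low_br x y s v : P x -> P y -> all P s ->
  lspan (low (wl x + (wl y + wt s)) (size s).+1 v)
    (lcomb (a^~ (wact s v)) (gbr K x y)).
Proof.
move=> Px Py sP; apply: lcomb_in => [|t ts]; first exact: lspan_subspace.
have Pt := Pbr Px Py ts.
have td : wl t.2 = (wl x + wl y)%N.
  have [_ td] := gbr_homog ts; have := Pneg Px; have := Pneg Py.
  by rewrite /wl td; lia.
apply: lspan_in; exists (t.2 :: s); split=> //=; first by rewrite Pt.
by rewrite wt_cons td addnA.
Qed.

(** Moving y across s1 costs a sign and brackets; a bracket keeps the weight
    and makes the word shorter by one letter. *)
Lemma low_move y s1 s2 v : P y -> all P (s1 ++ s2) ->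
  exists c : K, lspan (low (wt (y :: s1 ++ s2)) (size (s1 ++ s2)) v)
    (wact (y :: s1 ++ s2) v - c *: wact (s1 ++ y :: s2) v).
Proof.
move=> Py; elim: s1 => [|x s1 IH] /= sP.
  by exists 1; rewrite scale1r subrr; apply: lspan0.
have /andP[Px {}/IH[c IH]] := sP; exists ((-1) ^+ (gpar y && gpar x) * c).
rewrite act_swap -scalerA addrAC -scalerBr -(linZ (act_linear x)).
rewrite -(linB (act_linear x)); apply: lspanD.
  apply: lspanZ; have := low_cons Px IH.
  by rewrite !wt_cons addnCA.
by apply: low_br => //; case/andP: sP.
Qed.

(** The spanning half of the Poincare-Birkhoff-Witt theorem, by induction on
    the length. The weight is preserved exactly and the length does not grow;
    graded_independent relies on both to control its error terms. *)
Lemma straighten s v : all P s -> lspan (slow (wt s) (size s) v) (wact s v).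
Proof.
have [k] := ubnP (size s); elim: k s => // k IHk [_ _|y s] /=.
  by apply: lspan_in; exists [::].
rewrite ltnS => sk /andP[Py sP].
have lowP n m u : (m <= size s)%N -> lspan (low n m v) u -> lspan (slow n (size s).+1 v) u.
  move=> ms; apply: lspan_mono => _ [t [tP tn tm ->]].
  have tk : (size t < k)%N by lia.
  have := IHk t tk tP; apply: lspan_subset => _ [t' [? ? ? ? ->]].
  by exists t'; split=> //; lia.
have := IHk s sk sP; apply: (lspan_map (act_linear y)) => _ [t [tP ts tw tk ->]].
rewrite wt_cons -tw.
pose n := find (fun z => ~~ kl z y) t.
pose t1 := take n t; pose t2 := drop n t; have tE : t = t1 ++ t2 by rewrite cat_take_drop.
have t1y : all (kl^~ y) t1.
  apply/(all_nthP y) => j; rewrite size_take => jn.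
  have jn' : (j < n)%N by move: jn; case: ifP => //; lia.
  by rewrite nth_take //; have := before_find y jn'; move/negbFE.
have [c cP] := @low_move y t1 t2 v Py (eq_ind _ (all P) tP _ tE).
rewrite -tE in cP.
have lc : lspan (slow (wl y + wt t) (size s).+1 v) (wact (y :: t) v - c *: wact (t1 ++ y :: t2) v).
  exact: lowP tk cP.
rewrite -(subrK (c *: wact (t1 ++ y :: t2) v) (a y (wact t v))); apply: lspanD => //.
apply: lspanZ.
have ss : std t1 /\ std t2 /\ allrel ltl t1 t2.
  by move: ts; rewrite tE /std pairwise_cat => /and3P[].
have /andP[P1 P2] : all P t1 && all P t2 by rewrite -all_cat -tE.
have sz : size t = (size t1 + size t2)%N by rewrite tE size_cat.
have wE : (wl y + wt t)%N = (wt t1 + (wl y + wt t2))%N by rewrite tE wt_cat addnCA.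
have good : all (ltl y) t2 -> lspan (slow (wl y + wt t) (size s).+1 v) (wact (t1 ++ y :: t2) v).
  move=> yt2; apply: lspan_in; exists (t1 ++ y :: t2); split=> //.
  - by rewrite all_cat /= P1 Py P2.
  - rewrite /std pairwise_cat /= yt2; have [h1 [h2 r12]] := ss.
    rewrite (h1 : pairwise ltl t1) (h2 : pairwise ltl t2) !andbT.
    rewrite allrel_consr r12 andbT; apply: sub_all t1y => z; rewrite /ltl.
    by move=> ->.
  - by rewrite wt_cat wt_cons.
  - by rewrite size_cat /= addnS -sz ltnS.
case E: t2 good => [|z t3] good; first exact: good.
have zy : ~~ kl z y.
  have nt : (n < size t)%N.
    by rewrite ltnNge; apply/negP => /drop_oversize; rewrite -/t2 E.
  have -> : z = nth y t n by rewrite -[n in RHS]addn0 -nth_drop -/t2 E.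
  by apply: (@nth_find _ y (fun z => ~~ kl z y)); rewrite has_find.
have Pz : P z by move: P2; rewrite E => /andP[].
have zt3 : all (ltl z) t3 by case: ss => _ []; rewrite E /std /= => /andP[].
case: (kl_total (Pneg Py) (Pneg Pz)) => [yz|zy'|yz].
- apply: good => /=; rewrite {1}/ltl yz /=; apply: sub_all zt3 => u.
  by apply: ltl_trans; rewrite /ltl yz.
- by rewrite zy' in zy.
rewrite -yz in E good zt3 *; have [yp|yp] := boolP (gpar y); last first.
  by apply: good => /=; rewrite {1}/ltl eqxx yp orbT.
(* an odd letter may not be repeated: its square is half of a bracket *)
rewrite wact_cat /=.
have -> : a y (a y (wact t3 v)) = 2^-1 *: lcomb (a^~ (wact t3 v)) (gbr K y y).
  rewrite -aP.2 yp /= expr1 scaleN1r opprK -mulr2n -scaler_nat scalerA.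
  by rewrite mulVf ?scale1r // pnatr_eq0.
rewrite (linZ (wact_linear t1)); apply: lspanZ.
have P3 : all P t3 by move: P2; rewrite E => /andP[].
have := low_cat P1 (@low_br y y t3 v Py Py P3); rewrite wE E wt_cons.
move=> h; apply: lowP h; rewrite -addSnnS; move: sz tk; rewrite E /=.
by clear; lia.
Qed.

Variable N : set V.
Hypothesis NP : forall x w, ~~ P x -> N w -> N (a x w).

(** A submodule as soon as the letters outside P preserve N. *)
Definition wspan : set V :=
  lspan [set u | exists s w, [/\ all P s, N w & u = wact s w]].

Lemma wspan_stable x u : wspan u -> wspan (a x u).
Proof.
apply: (lspan_map (act_linear x)) => _ [s [w [sP Nw ->]]].
have Pw y u' : P y -> wspan u' -> wspan (a y u').
  move=> Py; apply: (lspan_map (act_linear y)) => _ [t [w' [tP Nw' ->]]].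
  by apply: lspan_in; exists (y :: t), w'; rewrite /= Py.
elim: s sP x => [|z s IH] /= sP x.
  have [Px|Px] := boolP (P x).
    by apply: lspan_in; exists [:: x], w; rewrite /= Px.
  by apply: lspan_in; exists [::], (a x w); split=> //; exact: NP.
have /andP[Pz {}sP] := sP; rewrite act_swap; apply: lspanD.
  by apply: lspanZ; apply: Pw => //; exact: IH.
by apply: lcomb_in => [|t _]; [exact: lspan_subspace | exact: IH].
Qed.

Lemma wspan_std u : wspan u ->
  lspan [set u | exists s w, [/\ all P s && std s, N w & u = wact s w]] u.
Proof.
apply: lspan_mono => _ [s [w [sP Nw ->]]].
have := @straighten s w sP; apply: lspan_subset => _ [t [tP ts _ _ ->]].
by exists t, w; rewrite tP ts.
Qed.
End Words.

(** * Independence of words from leading terms *)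

Section Independence.
Context {K : numFieldType} {V : lmodType K} (a : gbasis -> V -> V).
Hypothesis aP : is_act a.
Variable P : pred gbasis.
Hypothesis Pbr : forall x y, P x -> P y -> forall t, t \in gbr K x y -> P t.2.
Hypothesis Pneg : forall x, P x -> gdeg2 x < 0.
Local Notation wact := (wact a).

Variables (A : set V) (X : V -> V) (e : gbasis -> V -> V) (kappa : gbasis -> K)
  (d0 : bool).
Hypothesis AP : subspace A.
Hypothesis XA : forall v, A v -> A (X v).
Hypothesis eP : forall y, linear (e y).
Hypothesis kappa0 : forall y, P y -> kappa y != 0.

(** The weight filtration on the span of the P-words over A. *)
Definition fil (n : nat) : set V :=
  lspan [set u | exists s b, [/\ all P s, (wt s < n)%N, A b & u = wact s b]].

(** The signed number of occurrences of y met when an operator that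
    supercommutes with the letters up to a contraction with y is moved through
    s. *)
Fixpoint cnt (y : gbasis) (s : word) : K :=
  if s is z :: s' then (z == y)%:R + (-1) ^+ (gpar y && gpar z) * cnt y s' else 0.

(** The error allowed in moving e y through s. Its three parts are: words with
    X applied to v but shorter than rem y s, words of the same weight without
    X (only when d0 holds), and words of smaller weight with any
    coefficient. *)
Definition lead_err (y : gbasis) (s : word) (v : V) : set V :=
  [set u | exists t, [/\ all P t, (wl y + wt t)%N = wt s, ((size t).+2 <= size s)%N
                       & u = wact t (X v)]]
  `|` [set u | exists t, [/\ d0, all P t, (wl y + wt t)%N = wt s & u = wact t v]]
  `|` [set u | exists t b, [/\ all P t, A b, (wl y + wt t < wt s)%N & u = wact t b]].

Hypothesis lead : forall y s v, P y -> all P s -> std s -> A v ->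
  lspan (lead_err y s v)
    (e y (wact s v) - (cnt y s * kappa y) *: wact (rem y s) (X v)).

Hypothesis Xinj : forall L : seq V, (forall v, v \in L -> A v) ->
  (forall v, v \in L -> if d0 then lspan [set` L] (X v) else X v = 0) ->
  forall v, v \in L -> v = 0.

Lemma cnt_notin y s : y \notin s -> cnt y s = 0.
Proof.
elim: s => //= z s IH; rewrite inE negb_or eq_sym => /andP[/negPf-> /IH->].
by rewrite mulr0 addr0.
Qed.

Lemma cnt_head y s : P y -> std (y :: s) -> cnt y (y :: s) != 0.
Proof.
move=> Py ss; have [yp|yp] := boolP (gpar y).
  rewrite /= eqxx cnt_notin ?mulr0 ?addr0 ?oner_neq0 //.
  move: ss => /andP[/allP ys _]; apply/negP => /ys.
  by rewrite /ltl yp andbF orbF /kl ltnn !andbF orbF andNb.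
have -> t : cnt y t = (count_mem y t)%:R.
  by elim: t => //= z t ->; rewrite (negPf yp) expr0 mul1r natrD.
by rewrite pnatr_eq0 /= eqxx.
Qed.

Lemma std_rem y s : std s -> std (rem y s).
Proof. exact: subseq_pairwise (rem_subseq y s). Qed.

Lemma all_rem y s : all P s -> all P (rem y s).
Proof. by move=> /allP sP; apply/allP => z /mem_rem /sP. Qed.

(** The operator e y lowers the weight filtration by the weight of y. *)
Lemma fil_e n y u : P y -> fil n u -> fil (n - wl y) (e y u).
Proof.
move=> Py; apply: (lspan_map (eP y)) => _ [s0 [b [s0P s0n Ab ->]]].
have := @straighten _ _ _ aP _ Pbr Pneg _ b s0P.
apply: (lspan_map (eP y)) => _ [s [sP ss sw _ ->]].
rewrite -(subrK ((cnt y s * kappa y) *: wact (rem y s) (X b)) (e y _)).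
apply: lspanD; last first.
  have [ys|ys] := boolP (y \in s); last first.
    by rewrite cnt_notin // mul0r scale0r; apply: lspan0.
  apply: lspanZ; apply: lspan_in; exists (rem y s), (X b); split=> //.
  - exact: all_rem.
  - by have := wt_rem ys; lia.
  - exact: XA.
have := lead Py sP ss Ab; apply: lspan_subset => u' [[[t [tP tw ts ->]]|]|].
- by exists t, (X b); split=> //; [lia|exact: XA].
- by move=> [t [_ tP tw ->]]; exists t, b; split=> //; lia.
- by move=> [t [c [tP Ac tw ->]]]; exists t, c; split=> //; lia.
Qed.

Lemma size_wt s : all P s -> (size s <= wt s)%N.
Proof.
elim: s => //= x s IH /andP[Px /IH]; rewrite wt_cons.
by have := Pneg Px; rewrite /wl; lia.
Qed.

Lemma fil_le m n u : (m <= n)%N -> fil m u -> fil n u.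
Proof.
move=> mn; apply: lspan_subset => _ [s [b [? ? ? ->]]].
by exists s, b; split=> //; lia.
Qed.

(** By induction on the weight, and for fixed weight from the long words down
    to the short ones. Applying e y, where y is the first letter of l0,
    removes a letter y from each word and applies X to its coefficient, up to
    the errors in lead_err. The word rem y l0 then receives the nonzero
    multiple cnt * kappa of X (b l0), and only longer words can disturb it.
    Hence X sends each b s to 0, or, if d0 holds, into the span of the b s,
    and Xinj concludes. *)
Lemma graded_independent n (L : seq word) (b : word -> V) : uniq L ->
  (forall s, s \in L -> [/\ all P s, std s & wt s = n]) -> (forall s, A (b s)) ->
  fil n (\sum_(s <- L) wact s (b s)) -> forall s, s \in L -> b s = 0.
Proof.
elim/ltn_ind: n L b => n IHn L b uL LP Ab bL.
have [n0|n0] := posnP n.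
  have Lnil s : s \in L -> s = [::].
    by move=> /LP[sP _ sn]; apply/nilP; rewrite /nilp -leqn0 -n0 -sn; exact: size_wt.
  move=> s sL; move: (bL); rewrite (bigD1_seq s) //= big_seq_cond big1.
    rewrite addr0 (Lnil s sL) => /(_ [set 0]) h; apply: h.
      split=> // c u w /= -> ->; by rewrite scaler0 addr0.
    by move=> u [t [c [_ tn _ _]]]; move: tn; rewrite n0.
  by move=> t /andP[/Lnil ->]; rewrite (Lnil s sL) eqxx.
(* the space that has to contain each X (b s) *)
pose E : set V := if d0 then lspan [set` [seq b s | s <- L]] else [set 0].
have EP : subspace E.
  rewrite /E; case: d0; first exact: lspan_subspace.
  by split=> // c u w /= -> ->; rewrite scaler0 addr0.
have EA v : E v -> A v.
  rewrite /E; case: d0 => [|-> //]; last exact: subspace0.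
  by apply: lspan_le => // u /mapP[s _ ->].
suff XE s : s \in L -> E (X (b s)).
  move=> s sL; apply: (@Xinj [seq b s | s <- L]); last exact: map_f.
    by move=> v /mapP[t _ ->].
  by move=> v /mapP[t tL ->]; have := XE _ tL; rewrite /E; case: d0.
have [m] := ubnP (n - size s)%N; elim: m s => // m IHm l0; rewrite ltnS => ml l0L.
have [l0P l0s l0n] := LP _ l0L.
case El: l0 => [|y nu0]; first by move: l0n n0; rewrite El => <-.
have /andP[Py nu0P] : P y && all P nu0 by move: l0P; rewrite El.
have nu0s : std nu0 by move: l0s; rewrite El => /andP[].
have nu0w : (wl y + wt nu0)%N = n by rewrite -l0n El.
have y0 : (0 < wl y)%N by have := Pneg Py; rewrite /wl; lia.
(* G1: smaller weight; G2: other sorted words; G3: nu0 with coefficient in E *)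
pose G1 := [set u | exists s b, [/\ all P s, (wt s < n - wl y)%N, A b & u = wact s b]].
pose G2 := [set u | exists s c, [/\ [/\ all P s, std s, wt s = (n - wl y)%N & s != nu0],
                                  A c & u = wact s c]].
pose G3 := [set u | exists2 c, E c & u = wact nu0 c].
pose G := lspan (G1 `|` (G2 `|` G3)).
have straightG t v : all P t -> (wl y + wt t)%N = n -> A v ->
    E v \/ (size t < size nu0)%N -> G (wact t v).
  move=> tP tw Av Ev; have := @straighten _ _ _ aP _ Pbr Pneg _ v tP.
  apply: lspan_subset => _ [t' [t'P t's t'w t'k ->]].
  have [t'nu|t'nu] := eqVneq t' nu0; last first.
    by right; left; exists t', v; split=> //; split=> //; rewrite t'w -tw addKn.
  right; right; exists v; rewrite -?t'nu //.
  by case: Ev => // /(leq_ltn_trans t'k); rewrite t'nu ltnn.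
have errG s u : s \in L -> lead_err y s (b s) u -> G u.
  move=> sL; have [sP ss sn] := LP _ sL; move=> [[[t [tP tw tk ->]]|]|].
  - apply: straightG; rewrite -?sn //; first exact: XA.
    have [sl|sl] := leqP (size s) (size l0).
      by right; move: (leq_trans tk sl); rewrite El.
    left; apply: IHm => //; apply: leq_trans ml.
    rewrite ltn_sub2l //.
    by apply: leq_trans sl _; rewrite -sn size_wt.
  - move=> [t [d0t tP tw ->]]; apply: straightG => //; first by rewrite tw.
    by left; rewrite /E d0t; apply: lspan_in => /=; exact: map_f.
  - move=> [t [c [tP Ac tw ->]]]; apply: lspan_in; left; exists t, c.
    by split=> //; rewrite -sn ltn_subRL.
have leadG s : s \in L -> s != l0 -> G (e y (wact s (b s))).
  move=> sL sl; have [sP ss sn] := LP _ sL.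
  rewrite -(subrK ((cnt y s * kappa y) *: wact (rem y s) (X (b s))) (e y _)).
  apply: lspanD.
    have := lead Py sP ss (Ab s); apply: lspan_mono => u; exact: errG.
  have [ys|ys] := boolP (y \in s); last first.
    by rewrite cnt_notin // mul0r scale0r; apply: lspan0.
  apply: lspanZ; apply: lspan_in; right; left; exists (rem y s), (X (b s)).
  split=> //; last exact: XA.
  split; [exact: all_rem|exact: std_rem|by rewrite -sn (wt_rem ys) addKn|].
  apply: contraNneq sl => rnu; apply/eqP; apply: std_perm => //.
  by rewrite El -rnu; exact: perm_to_rem.
have : G (wact nu0 ((cnt y l0 * kappa y) *: X (b l0))).
  have -> : wact nu0 ((cnt y l0 * kappa y) *: X (b l0)) =
      e y (\sum_(s <- L) wact s (b s))
      - (e y (wact l0 (b l0)) - (cnt y l0 * kappa y) *: wact (rem y l0) (X (b l0)))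
      - \sum_(s <- L | s != l0) e y (wact s (b s)).
    rewrite (lin_sum (eP y)) (bigD1_seq l0) //= El /= eqxx (linZ (wact_linear aP _)).
    by rewrite opprB [X in _ = X - _]addrC addrA subrK addrK.
  apply: lspanB; first apply: lspanB.
  - by apply: lspan_subset (fil_e Py bL) => u uG1; left.
  - by have := lead Py l0P l0s (Ab l0); apply: lspan_mono => u; exact: errG.
  - rewrite big_seq_cond; apply: subspace_sum => [|s /andP[]]; last exact: leadG.
    exact: lspan_subspace.
move=> /lspan_setU[f [gh [G1f /lspan_setU[g [h [G2g G3h ->]]] eqG]]].
have {G3h}[c0 Ec0 hE] : G3 h.
  move: G3h; apply: lspan_id; split=> [|k u w [c Ec ->] [c' Ec' ->]].
    by exists 0; rewrite ?lin0 //; [exact: subspace0|exact: wact_linear].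
  by exists (k *: c + c'); [case: EP => _; apply|rewrite (wact_linear aP)].
have [|L' [c [uL' L'P Ac gE]]] := @lspan_family _ V V _ (fun s => wact s)
   [set s | [/\ all P s, std s, wt s = (n - wl y)%N & s != nu0]] A g _ AP G2g.
  exact: wact_linear.
pose b' s := if s == nu0 then (cnt y l0 * kappa y) *: X (b l0) - c0 else - c s.
have := IHn (n - wl y)%N _ (nu0 :: L') b'.
rewrite /= uL' andbT => /(_ _ _ _ _ _ nu0); rewrite mem_head /b' eqxx => h'.
have {h'}: (cnt y l0 * kappa y) *: X (b l0) - c0 = 0.
  apply: h' => //.
  - by rewrite ltn_subrL y0 n0.
  - by apply/negP => /L'P[_ _ _]; rewrite eqxx.
  - move=> s; rewrite inE => /orP[/eqP->|/L'P[? ? ? ?] //].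
    by split=> //; rewrite -nu0w addKn.
  - move=> s; case: eqP => _; last exact: subspaceN.
    by apply: subspaceB => //; [apply: subspaceZ => //; exact: XA|exact: EA].
  - rewrite big_cons eqxx (linB (wact_linear aP _)) eqG hE gE.
    rewrite [X in _ - _ + X](eq_big_seq (fun s => - wact s (c s))); last first.
      move=> s /L'P[_ _ _ /negPf->]; exact: (linN (wact_linear aP _)).
    by rewrite sumrN addrA addrK addrK.
move/eqP; rewrite subr_eq0 => /eqP cX.
have k0 : cnt y l0 * kappa y != 0.
  by rewrite mulf_neq0 ?kappa0 // El cnt_head // -El.
rewrite -El -[X (b l0)](scalerK k0) cX; exact: subspaceZ.
Qed.

(** Passing to leading terms: g s agrees with wact s up to smaller weight, so
    the words of highest weight in a relation have zero coefficients. *)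
Lemma filtered_independent (g : word -> V -> V) (L : seq word) (b : word -> V) :
  (forall s, linear (g s)) ->
  uniq L -> (forall s, s \in L -> all P s && std s) ->
  (forall s v, s \in L -> A v -> fil (wt s) (g s v - wact s v)) ->
  (forall s, A (b s)) -> \sum_(s <- L) g s (b s) = 0 ->
  forall s, s \in L -> b s = 0.
Proof.
move=> gl uL LP gP Ab gb s0 s0L.
pose B := \max_(s <- L) wt s.
have wB s : s \in L -> (wt s <= B)%N by move=> sL; apply: leq_bigmax_seq.
have [m] := ubnP (B - wt s0)%N; elim: m s0 s0L => // m IHm s0 s0L ms0.
pose L0 := [seq s <- L | wt s == wt s0].
apply: (@graded_independent (wt s0) L0); rewrite ?filter_uniq ?mem_filter ?eqxx //.
  by move=> s; rewrite mem_filter => /andP[/eqP sw /LP/andP[]].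
have -> : \sum_(s <- L0) wact s (b s) =
   \sum_(s <- L) ((if wt s == wt s0 then wact s (b s) else 0) - g s (b s)).
  by rewrite sumrB gb subr0 big_filter big_mkcond.
apply: subspace_sum_seq => [|s sL]; first exact: lspan_subspace.
case: ltngtP => [sw|sw|sw].
- rewrite sub0r -[g s _](subrK (wact s (b s))); apply: lspanN; apply: lspanD.
    exact: (fil_le (ltnW sw) (gP s _ sL (Ab s))).
  by apply: lspan_in; exists s, (b s); split=> //; case/andP: (LP s sL).
- have -> : b s = 0 by apply: IHm => //; have := wB _ sL; lia.
  by rewrite (lin0 (gl s)) subr0; exact: lspan0.
- by rewrite -opprB; apply: lspanN; rewrite -sw; exact: (gP s _ sL (Ab s)).
Qed.
End Independence.

(** * Super Virasoro words *)

Definition inLG (x : gbasis) : bool := match x with gL _ | gG _ => true | _ => false end.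
Definition LGlow (x : gbasis) : bool := match x with gL i | gG i => i < 0 | _ => false end.
(** The doubled degree is even for L and odd for G. *)
Definition LGlet (c : int) : gbasis :=
  if (c %% 2)%Z == 0 then gL (c %/ 2)%Z else gG (c %/ 2)%Z.

Lemma LGletL i : LGlet (i *+ 2) = gL i.
Proof.
rewrite /LGlet; have -> : ((i *+ 2) %% 2)%Z == 0 by lia.
by congr gL; lia.
Qed.
Lemma LGletG i : LGlet (i *+ 2 + 1) = gG i.
Proof.
rewrite /LGlet; have -> : ((i *+ 2 + 1) %% 2)%Z == 0 = false by lia.
by congr gG; lia.
Qed.
Lemma LGlet_in c : inLG (LGlet c). Proof. by rewrite /LGlet; case: ifP. Qed.
Lemma LGlet_deg c : gdeg2 (LGlet c) = c.
Proof. by rewrite /LGlet; case: eqP => /= h; lia. Qed.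
Lemma inLG_K x : inLG x -> LGlet (gdeg2 x) = x.
Proof. by case: x => // i _; [exact: LGletL|exact: LGletG]. Qed.
Lemma LGlowE x : LGlow x = inLG x && (gdeg2 x < 0).
Proof. by case: x => //= i; lia. Qed.
Lemma LGlow_lg x : LGlow x -> inLG x. Proof. by rewrite LGlowE => /andP[]. Qed.
Lemma LGlow_neg x : LGlow x -> gdeg2 x < 0. Proof. by rewrite LGlowE => /andP[]. Qed.
Lemma LGlow_wl x : LGlow x -> gdeg2 x = - (wl x)%:Z.
Proof. by move=> /LGlow_neg; rewrite /wl; lia. Qed.
Lemma LGlow_br (K : numFieldType) x y : LGlow x -> LGlow y -> forall t, t \in gbr K x y -> LGlow t.2.
Proof.
move=> xs ys t; apply/allP: t; case: x xs => //= i i0; case: y ys => //= j j0;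
  rewrite /Defs.oppc /= ?all_nseq /=; lia.
Qed.

Section Virasoro.
Context {K : numFieldType} {V : lmodType K} (a : gbasis -> V -> V) (c1 : K).
Hypothesis aP : is_act a.
Hypothesis c1P : forall v, a gC1 v = c1 *: v.
Variable M : nat.
Local Notation wact := (wact a).
Local Notation act_linear := (act_linear aP).
Local Notation M2 := (M%:Z *+ 2).

(** Both kinds of super Virasoro letters are determined by their degree, so
    that all their brackets have one form: a multiple of the letter whose
    degree is the sum, and a central term in degree 0. *)
Lemma inLG_swap x z : inLG x -> inLG z -> exists g k : K, forall u,
  a x (a z u) = (-1) ^+ (gpar x && gpar z) *: a z (a x u)
     + (g *: a (LGlet (gdeg2 x + gdeg2 z)) u
     + (if gdeg2 x + gdeg2 z == 0 then k *: u else 0)).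
Proof.
case: x => // i _; case: z => // j _ /=.
- exists (i%:~R - j%:~R), ((i%:~R ^+ 3 - i%:~R) / 12 * c1) => u.
  rewrite (act_swap aP) /= !lcombE /= -mulrnDl LGletL; congr (_ + (_ + _)).
  have -> : ((i + j) *+ 2 == 0) = (i + j == 0) by lia.
  by case: ifP => _; rewrite ?c1P ?scalerA.
- exists (i%:~R / 2 - Defs.half j), 0 => u.
  have -> : i *+ 2 + (j *+ 2 + 1) = (i + j) *+ 2 + 1 by lia.
  by rewrite (act_swap aP) /= !lcombE /= scale0r if_same LGletG.
- exists (- (j%:~R / 2 - Defs.half i)), 0 => u.
  have -> : i *+ 2 + 1 + j *+ 2 = (j + i) *+ 2 + 1 by lia.
  rewrite (act_swap aP) /= !lcombE /= scale0r if_same LGletG scaleNr.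
  by rewrite !addr0.
- exists 2, (3^-1 * (Defs.half i ^+ 2 - 4^-1) * c1) => u.
  have -> : i *+ 2 + 1 + (j *+ 2 + 1) = (i + j + 1) *+ 2 by lia.
  rewrite (act_swap aP) /= !lcombE /= LGletL; congr (_ + (_ + _)).
  have -> : ((i + j + 1) *+ 2 == 0) = (i + j + 1 == 0) by lia.
  by case: ifP => _; rewrite ?c1P ?scalerA.
Qed.

(** The bound is the degree M + 1/2, doubled: all letters above L_M kill v. *)
Definition LGann : set V :=
  [set v | forall x, inLG x -> (M.*2.+1)%:Z <= gdeg2 x -> a x v = 0].

Lemma LGann_subspace : subspace LGann.
Proof.
split=> [x _ _|k u v uA vA x xl xd]; first exact: (lin0 (act_linear x)).
by rewrite act_linear uA // vA // scaler0 addr0.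
Qed.

(** Letters of nonnegative degree only raise the degree in a bracket with a
    letter that kills v. *)
Lemma LGann_stable x v : inLG x -> 0 <= gdeg2 x -> LGann v -> LGann (a x v).
Proof.
move=> xl x0 vA y yl yd; have [g [k ->]] := inLG_swap yl xl.
rewrite vA // (lin0 (act_linear x)) scaler0 add0r ifF ?addr0; last lia.
by rewrite vA ?scaler0 ?LGlet_in // LGlet_deg; lia.
Qed.

(** The letter that brackets with y to a multiple of L_M: their degrees add up
    to M. For y of negative degree the multiple, vkappa y, is not zero. *)
Definition partner (y : gbasis) : gbasis :=
  match y with gL i => gL (M%:Z - i) | gG j => gG (M%:Z - j - 1) | _ => y end.
Definition vkappa (y : gbasis) : K :=
  match y with gL i => (M%:Z - i *+ 2)%:~R | _ => 2 end.

Lemma partner_inLG y : inLG y -> inLG (partner y). Proof. by case: y. Qed.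
Lemma partner_deg y : LGlow y -> gdeg2 (partner y) = M2 + (wl y)%:Z.
Proof. by rewrite /wl; case: y => //= i i0; lia. Qed.
Lemma partner_par y : gpar (partner y) = gpar y. Proof. by case: y. Qed.
Lemma vkappa0 y : LGlow y -> vkappa y != 0.
Proof. by case: y => //= i i0; rewrite ?pnatr_eq0 // intr_eq0; lia. Qed.

Lemma partner_swap y : LGlow y -> exists k : K, forall u,
  a (partner y) (a y u) = (-1) ^+ (gpar y && gpar y) *: a y (a (partner y) u)
    + (vkappa y *: a (gL M) u + (if M == 0%N then k *: u else 0)).
Proof.
case: y => // i i0 /=.
- exists (((M%:Z - i)%:~R ^+ 3 - (M%:Z - i)%:~R) / 12 * c1) => u.
  rewrite (act_swap aP) /= !lcombE /= subrK -intrB -addrA -opprD -mulr2n.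
  congr (_ + (_ + _)); rewrite -[M%:Z == 0]/(M == 0%N).
  by case: ifP => _; rewrite ?c1P ?scalerA.
- exists (3^-1 * (Defs.half (M%:Z - i - 1) ^+ 2 - 4^-1) * c1) => u.
  rewrite (act_swap aP) /= !lcombE /=.
  have -> : M%:Z - i - 1 + i + 1 = M by lia.
  congr (_ + (_ + _)); rewrite -[M%:Z == 0]/(M == 0%N).
  by case: ifP => _; rewrite ?c1P ?scalerA.
Qed.

(** The results of moving an operator of degree c / 2 through s, when that
    operator is absorbed: the weight of the word drops by c. *)
Definition vlow (c : int) (s : word) (v : V) : set V :=
  [set u | exists t, [/\ all LGlow t, (wt t)%:Z + c = (wt s)%:Z & u = wact t v]].
(** The results in which a letter y of degree between 0 and M reaches v; it is
    a bracket of the operator with letters of s, so that the word is strictly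
    shorter when y differs from the operator itself. *)
Definition vmid (c : int) (s : word) (v : V) : set V :=
  [set u | exists t y, [/\ [/\ inLG y, 0 <= gdeg2 y, gdeg2 y <= M2 & gdeg2 y <= c],
     all LGlow t, (wt t)%:Z + c = (wt s)%:Z + gdeg2 y,
     (size t <= size s)%N /\ (gdeg2 y < c -> (size t < size s)%N)
     & u = wact t (a y v)]].
Definition vmids (c : int) (s : word) (v : V) : set V :=
  [set u | exists t y, [/\ [/\ inLG y, 0 <= gdeg2 y & gdeg2 y < M2],
     all LGlow t, (wt t)%:Z + c = (wt s)%:Z + gdeg2 y & u = wact t (a y v)]].

Lemma wt_consz z s : LGlow z -> (wt (z :: s))%:Z = (wt s)%:Z - gdeg2 z.
Proof. by move=> zs; rewrite wt_cons (LGlow_wl zs); lia. Qed.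

(** An operator of degree at least 0 is moved through the word letter by
    letter, and each bracket is again a letter, of smaller degree. If it
    reaches v its degree has to be at most M, since v is in LGann. *)
Lemma raise_word x s v : inLG x -> 0 <= gdeg2 x -> all LGlow s -> LGann v ->
  lspan (vlow (gdeg2 x) s v `|` vmid (gdeg2 x) s v) (a x (wact s v)).
Proof.
move=> + + + Av; elim: s x => [|z s IH] x xl x0 /=.
  have [xM|xM] := lerP (gdeg2 x) M2; last first.
    by rewrite Av ?xl //; [move=> _; exact: lspan0|lia].
  move=> _; apply: lspan_in; right; exists [::], x.
  by split=> //; split=> //; rewrite ltxx.
move=> /andP[zs sP]; have [g [k ->]] := inLG_swap xl (LGlow_lg zs).
have wz := wt_consz s zs; have zn := LGlow_neg zs.
apply: lspanD.
  apply: lspanZ; have := IH x xl x0 sP; apply: (lspan_map (act_linear z)).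
  move=> u [[t [tP tw ->]]|[t [y [yP tP tw [tk tk'] ->]]]]; apply: lspan_in.
    left; exists (z :: t); split=> //=; first by rewrite zs.
    by rewrite wz wt_consz // -tw; lia.
  right; exists (z :: t), y; split=> //=; first by rewrite zs.
  by rewrite wz wt_consz //; lia.
apply: lspanD.
  apply: lspanZ; set c' := gdeg2 x + gdeg2 z.
  have [c0|c0] := lerP 0 c'; last first.
    have ls : LGlow (LGlet c') by rewrite LGlowE LGlet_in LGlet_deg.
    apply: lspan_in; left; exists (LGlet c' :: s); split=> //=; first by rewrite ls.
    by rewrite wz wt_consz // LGlet_deg /c'; lia.
  have := IH (LGlet c') (LGlet_in c'); rewrite LGlet_deg => /(_ c0 sP).
  apply: lspan_subset => u [[t [tP tw ->]]|[t [y [[yl y0 yM yc] tP tw [tk tk'] ->]]]].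
    by left; exists t; split=> //; rewrite wz; move: tw; rewrite /c'; lia.
  right; exists t, y; split=> //.
  - by split=> //; move: yc; rewrite /c'; lia.
  - by rewrite wz; move: tw; rewrite /c'; lia.
  - by split=> [|_]; [exact: leqW|].
case: eqP => c0; last exact: lspan0.
apply: lspanZ; apply: lspan_in; left; exists s; split=> //.
by rewrite wz; lia.
Qed.

(** The case of L_M itself: apart from the term in which it reaches v
    unchanged, only letters of degree less than M do. *)
Lemma raise_wordL s v : all LGlow s -> LGann v ->
  lspan (vlow M2 s v `|` vmids M2 s v)
    (a (gL M) (wact s v) - wact s (a (gL M) v)).
Proof.
move=> + Av; elim: s => [|z s IH] /= sP; first by rewrite subrr; exact: lspan0.
have /andP[zs {}/IH IH] := sP; have sP' : all LGlow s by case/andP: sP.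
have wz := wt_consz s zs; have zn := LGlow_neg zs.
have [g [k ->]] := @inLG_swap (gL M) z isT (LGlow_lg zs).
rewrite expr0 scale1r addrAC -(linB (act_linear z)); apply: lspanD.
  move: IH; apply: (lspan_map (act_linear z)).
  move=> u [[t [tP tw ->]]|[t [y [yP tP tw ->]]]]; apply: lspan_in.
    left; exists (z :: t); split=> //=; first by rewrite zs.
    by rewrite wz wt_consz // -tw; lia.
  right; exists (z :: t), y; split=> //=; first by rewrite zs.
  by rewrite wz wt_consz //; lia.
apply: lspanD.
  apply: lspanZ; set c' := gdeg2 (gL M) + gdeg2 z.
  have [c0|c0] := lerP 0 c'; last first.
    have ls : LGlow (LGlet c') by rewrite LGlowE LGlet_in LGlet_deg.
    apply: lspan_in; left; exists (LGlet c' :: s); split=> //=; first by rewrite ls.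
    by rewrite wz wt_consz // LGlet_deg /c' /=; lia.
  have := @raise_word (LGlet c') s v (LGlet_in c'); rewrite LGlet_deg => /(_ c0 sP' Av).
  apply: lspan_subset => u [[t [tP tw ->]]|[t [y [[yl y0 yM yc] tP tw [tk tk'] ->]]]].
    by left; exists t; split=> //; rewrite wz; move: tw; rewrite /c' /=; lia.
  right; exists t, y; split=> //.
  - by split=> //; move: yc; rewrite /c' /=; lia.
  - by rewrite wz; move: tw; rewrite /c' /=; lia.
case: eqP => c0; last exact: lspan0.
apply: lspanZ; apply: lspan_in; left; exists s; split=> //.
by rewrite wz; move: c0 => /=; lia.
Qed.

Local Notation verr := (lead_err a LGlow LGann (a (gL M)) (M == 0%N)).

Lemma verr_low y s v t : LGann v -> all LGlow t ->
  (wt t)%:Z + (wl y)%:Z + M2 = (wt s)%:Z -> verr y s v (wact t v).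
Proof.
move=> Av tP tw; have [M0|M0] := eqVneq M 0%N.
  by left; right; exists t; split=> //; move: tw; rewrite M0; lia.
by right; exists t, v; split=> //; lia.
Qed.

Lemma verr_mid y s v t x : LGann v -> all LGlow t -> inLG x -> 0 <= gdeg2 x ->
  (wt t)%:Z + (wl y)%:Z < (wt s)%:Z -> verr y s v (wact t (a x v)).
Proof.
move=> Av tP xl x0 tw; right; exists t, (a x v); split=> //; last by lia.
exact: LGann_stable.
Qed.

Lemma verr_cons y z s v u : LGlow z -> lspan (verr y s v) u ->
  lspan (verr y (z :: s) v) (a z u).
Proof.
move=> zs; apply: (lspan_map (act_linear z)).
move=> w [[[t [tP tw tk ->]]|[t [d tP tw ->]]]|[t [b [tP Ab tw ->]]]]; apply: lspan_in.
- by left; left; exists (z :: t); rewrite /= zs; split=> //; rewrite !wt_cons -tw addnCA.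
- by left; right; exists (z :: t); rewrite /= zs; split=> //; rewrite !wt_cons -tw addnCA.
- right; exists (z :: t), b; rewrite /= zs; split=> //.
  by rewrite !wt_cons addnCA ltn_add2l.
Qed.

Lemma LGlow_wl_inj x y : LGlow x -> LGlow y -> wl x = wl y -> x = y.
Proof.
move=> xs ys xy; rewrite -(inLG_K (LGlow_lg xs)) -(inLG_K (LGlow_lg ys)).
by rewrite (LGlow_wl xs) (LGlow_wl ys) xy.
Qed.

(** The operator partner y has degree M + |y| and kills v, so it has to be
    bracketed on its way. A bracket with a letter y gives L_M, which is moved
    on to v. A bracket with a different letter z gives a letter of another
    degree than M; it can become L_M only by a further bracket, at the price
    of a second letter. The remaining terms have smaller weight, or, for M =
    0, the same weight without L_M. *)
Lemma virasoro_lead y s v : LGlow y -> all LGlow s -> std s -> LGann v ->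
  lspan (verr y s v) (a (partner y) (wact s v)
    - (cnt y s * vkappa y) *: wact (rem y s) (a (gL M) v)).
Proof.
move=> ys sP ss Av; have pl := partner_inLG (LGlow_lg ys); have pd := partner_deg ys.
elim: s sP ss => [_ _|z s IH] /=.
  by rewrite mul0r scale0r subr0 Av // ?pd; [exact: lspan0|have := LGlow_neg ys; rewrite /wl; lia].
move=> /andP[zs sP] /andP[zall ss]; have {}IH := IH sP ss.
have wz := wt_consz s zs; have zn := LGlow_neg zs; have yw := LGlow_wl ys; have zw := LGlow_wl zs.
have [zy|zy] := eqVneq z y.
  rewrite {z}zy in zs zall wz zn zw *; have [k ->] := partner_swap ys.
  set w := wact s v in IH *; set sg := (-1) ^+ _.
  have e2 : (sg * cnt y s * vkappa y) *: wact s (a (gL M) v)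
     = sg *: a y ((cnt y s * vkappa y) *: wact (rem y s) (a (gL M) v)).
    have [yin|yin] := boolP (y \in s); last first.
      by rewrite cnt_notin // mulr0 mul0r !scale0r (lin0 (act_linear y)) scaler0.
    rewrite (linZ (act_linear y)) scalerA mulrA; congr (_ *: _).
    case: {+}s zall ss yin => // z s' /= /andP[yz _] /andP[/allP zs' _].
    rewrite inE => /orP[/eqP->|/zs' zy]; first by rewrite eqxx.
    have -> : z = y by apply: ltl_anti; rewrite zy yz.
    by rewrite eqxx.
  rewrite -[true%:R]/(1 : K) mulrDl mul1r scalerDl e2 opprD [- _ - _]addrC addrACA -scalerBr.
  rewrite -(linB (act_linear y)); apply: lspanD.
    by apply: lspanZ; exact: verr_cons.
  rewrite addrAC -scalerBr; apply: lspanD.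
    apply: lspanZ; have := raise_wordL sP Av.
    apply: lspan_mono => u [[t [tP tw ->]]|[t [x [[xl x0 xM] tP tw ->]]]]; apply: lspan_in.
      by apply: verr_low => //; rewrite wz; move: tw; lia.
    by apply: verr_mid => //; rewrite wz; move: tw; lia.
  case M0: (M == 0%N); last exact: lspan0.
  apply: lspanZ; apply: lspan_in; rewrite -M0 /w; apply: verr_low => //.
  by rewrite wz (eqP M0); lia.
have [g [k ->]] := inLG_swap pl (LGlow_lg zs).
rewrite -[false%:R]/(0 : K) partner_par add0r -mulrA -scalerA.
rewrite [wact (z :: _) _]/= addrAC -scalerBr -(linZ (act_linear z)) -(linB (act_linear z)); apply: lspanD.
  by apply: lspanZ; exact: verr_cons.
set c' := _ + gdeg2 z.
have zwl : wl z <> wl y by move=> /(LGlow_wl_inj zs ys)/eqP; rewrite (negPf zy).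
apply: lspanD.
  apply: lspanZ; have [c0|c0] := lerP 0 c'; last first.
    have ls : LGlow (LGlet c') by rewrite LGlowE LGlet_in LGlet_deg.
    apply: lspan_in; apply: (@verr_low _ _ _ (LGlet c' :: s)) => //=; first by rewrite ls.
    by rewrite wz wt_consz // LGlet_deg /c' pd; lia.
  have := @raise_word (LGlet c') s v (LGlet_in c'); rewrite LGlet_deg => /(_ c0 sP Av).
  apply: lspan_subset => u [[t [tP tw ->]]|[t [x [[xl x0 xM xc] tP tw [tk tk'] ->]]]].
    by apply: verr_low => //; rewrite wz; move: tw; rewrite /c' pd; lia.
  have [xlt|xge] := ltrP (gdeg2 x) M2.
    by apply: verr_mid => //; rewrite wz; move: tw; rewrite /c' pd; lia.
  have xE : x = gL M by rewrite -(inLG_K xl) -LGletL; congr LGlet; lia.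
  left; left; exists t; split=> //; rewrite -?xE //.
    by apply/eqP; rewrite -eqz_nat PoszD wz; move: tw xM xge; rewrite /c' pd; lia.
  rewrite [size (z :: s)]/= ltnS.
  have xlt : gdeg2 x < c'.
    move: xM xc xge zwl; rewrite /c' pd zw; clear.
    lia.
  exact: tk' xlt.
case c0: (c' == 0); last exact: lspan0.
apply: lspanZ; apply: lspan_in; apply: verr_low => //.
by rewrite wz; move: c0; rewrite /c' pd; clear; lia.
Qed.
End Virasoro.

(** Independence of super Virasoro words over the vectors killed in degrees
    above M. For M > 0 the leading terms force L_M b = 0 on the coefficients
    b; for M = 0 they make the finite-dimensional span of the coefficients
    stable under L_0, and it would contain an eigenvector. The operators g s
    stand for a second action with the same leading terms. *)
Lemma virasoro_independent {K : numClosedFieldType} {V : lmodType K}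
    (a : gbasis -> V -> V) (c1 : K) (M : nat) (g : word -> V -> V)
    (L : seq word) (b : word -> V) :
  is_act a -> (forall v, a gC1 v = c1 *: v) ->
  (forall h v, LGann a M v -> a (gL M) v = h *: v -> M = 0%N \/ h = 0 -> v = 0) ->
  (forall s, linear (g s)) -> uniq L ->
  (forall s, s \in L -> all LGlow s && std s) ->
  (forall s v, s \in L -> LGann a M v ->
     fil a LGlow (LGann a M) (wt s) (g s v - wact a s v)) ->
  (forall s, LGann a M (b s)) -> \sum_(s <- L) g s (b s) = 0 ->
  forall s, s \in L -> b s = 0.
Proof.
move=> aP c1P noeig gl uL LP gP Ab gb.
have AP := LGann_subspace aP M.
move=> s; apply: (@filtered_independent K V a aP LGlow (@LGlow_br K) LGlow_neg (LGann a M) (a (gL M))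
   (fun y => a (partner M y)) (@vkappa K M) (M == 0%N) AP _ _ _ _ _ g L b) => // {s}.
- by move=> v; apply: (LGann_stable aP c1P).
- by move=> y; exact: act_linear.
- exact: vkappa0.
- by move=> y s v; apply: (virasoro_lead aP c1P).
move=> T TA TX v vT; apply/eqP; apply: contraT => v0.
have [M0|M0] := eqVneq M 0%N.
  have [|h [w [Tw /eqP w0 Xw]]] := @stable_eigenvector _ _ (a (gL M)) (act_linear aP _) T v _ vT v0.
    by move=> u uT; have := TX u uT; rewrite M0 eqxx.
  case: w0; apply: (noeig h) => //; last by left.
  by move: Tw; apply: lspan_le.
move/eqP: v0; case; apply: (noeig 0) => //; [exact: TA| |by right].
by rewrite scale0r; have := TX v vT; rewrite (negPf M0).
Qed.

(** * Heisenberg-Clifford words *)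

(** The Heisenberg-Clifford letters outside g^(0,-r). *)
Definition HFlow (r : nat) (x : gbasis) : bool :=
  match x with gH i | gF i => i < - r%:Z | _ => false end.

Lemma HFlow_neg r x : HFlow r x -> gdeg2 x < 0.
Proof. by case: x => //= i; lia. Qed.
Lemma HFlow_br (K : numFieldType) r x y : HFlow r x -> HFlow r y ->
  forall t, t \in gbr K x y -> HFlow r t.2.
Proof.
move=> xs ys t; apply/allP: t; case: x xs => //= i i0; case: y ys => //= j j0;
  rewrite /Defs.oppc /= ?all_nseq /=; lia.
Qed.

Section Heisenberg.
Context {K : numFieldType} {V : lmodType K} (a : gbasis -> V -> V) (l : K).
Hypothesis aP : is_act a.
Hypothesis l0 : l != 0.
Hypothesis c3P : forall v, a gC3 v = l *: v.
Variable r : nat.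
Local Notation wact := (wact a).
Local Notation act_linear := (act_linear aP).

(** Both bounds say that the degree is larger than r, as gF k has degree k +
    1/2. *)
Definition HFann : set V :=
  [set v | forall k, (r%:Z < k -> a (gH k) v = 0) /\ (r%:Z <= k -> a (gF k) v = 0)].

(** The letter that pairs with y under the form given by c_3. *)
Definition hpartner (y : gbasis) : gbasis :=
  match y with gH i => gH (- i) | gF j => gF (- j - 1) | _ => y end.
Definition hkappa (y : gbasis) : K :=
  match y with gH i => (- i)%:~R * l | _ => l end.

Lemma hkappa0 y : HFlow r y -> hkappa y != 0.
Proof. by case: y => //= i i0; rewrite mulf_neq0 // intr_eq0; lia. Qed.

Lemma hpartner_swap y z u : HFlow r y -> HFlow r z ->
  a (hpartner y) (a z u) = (-1) ^+ (gpar y && gpar z) *: a z (a (hpartner y) u)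
    + (if z == y then hkappa y *: u else 0).
Proof.
case: y => // i i0; case: z => // j j0; rewrite (act_swap aP) /= !lcombE //=.
- have -> : (- i + j == 0) = (gH j == gH i).
    by apply/eqP/eqP => [h|[->]]; [congr gH; lia|lia].
  by rewrite c3P scalerA.
- have -> : (- i - 1 + j + 1 == 0) = (gF j == gF i).
    by apply/eqP/eqP => [h|[->]]; [congr gF; lia|lia].
  by rewrite c3P scale1r.
Qed.

(** Here there are no errors: the partner of y supercommutes with every other
    letter of HFlow, and its bracket with y is a nonzero scalar because l
    is. *)
Lemma heisenberg_lead y s v : HFlow r y -> all (HFlow r) s -> std s -> HFann v ->
  a (hpartner y) (wact s v) = (cnt y s * hkappa y) *: wact (rem y s) v.
Proof.
move=> ys + + Av; elim: s => [_ _|z s IH] /=.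
  rewrite mul0r scale0r; case: y ys => //= i i0.
    by apply: (Av (- i)).1; lia.
  by apply: (Av (- i - 1)).2; lia.
move=> /andP[zs sP] /andP[zall ss]; have {}IH := IH sP ss.
rewrite (hpartner_swap _ ys zs) IH (linZ (act_linear z)) scalerA mulrA.
have [zy|zy] := eqVneq z y; last first.
  by rewrite addr0 -[false%:R]/(0 : K) add0r.
rewrite -[true%:R]/(1 : K) mulrDl mul1r scalerDl addrC; congr (_ + _).
have [yin|yin] := boolP (y \in s); last first.
  by rewrite cnt_notin // mulr0 mul0r !scale0r.
congr (_ *: _); rewrite zy in zall *.
case: s zall ss yin {sP IH} => // x s' /= /andP[yx _] /andP[/allP xs' _].
rewrite inE => /orP[/eqP->|/xs' xy]; first by rewrite eqxx.
have -> : x = y by apply: ltl_anti; rewrite xy yx.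
by rewrite eqxx.
Qed.

Lemma heisenberg_independent (L : seq word) (b : word -> V) : uniq L ->
  (forall s, s \in L -> all (HFlow r) s && std s) -> (forall s, HFann (b s)) ->
  \sum_(s <- L) wact s (b s) = 0 -> forall s, s \in L -> b s = 0.
Proof.
move=> uL LP Ab gb.
have AP : subspace HFann.
  split=> [k|c u v uA vA k]; split=> hk; rewrite ?(lin0 (act_linear _)) //;
  by rewrite act_linear ?(uA k).1 ?(vA k).1 ?(uA k).2 ?(vA k).2 ?scaler0 ?addr0.
move=> s; apply: (@filtered_independent K V a aP (HFlow r) (@HFlow_br K r) (@HFlow_neg r) HFann id
   (fun y => a (hpartner y)) hkappa false AP _ _ _ _ _ wact L b) => // {s}.
- by move=> y; exact: act_linear.
- exact: hkappa0.
- move=> y s v yP sP ss Av; rewrite heisenberg_lead // subrr; exact: lspan0.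
- exact: wact_linear.
- by move=> s v _ _; rewrite subrr; exact: lspan0.
Qed.
End Heisenberg.

(** * Sums over the integers *)

Section LocallyFiniteSums.
Context {K : numFieldType} {V : lmodType K}.
Implicit Types (F G : int -> V).

Definition zsum F : V := \sum_(k \in [set: int]) F k.
Definition bounded F : Prop := exists N : nat, forall k, (N < `|k|)%N -> F k = 0.

Definition zrange (N : nat) : seq int := [seq i%:Z - N%:Z | i <- iota 0 N.*2.+1].

Lemma zsumE N F : (forall k, (N < `|k|)%N -> F k = 0) ->
  zsum F = \sum_(k <- zrange N) F k.
Proof.
move=> F0; rewrite /zsum (fsbigE (zrange N)) //.
- by apply: eq_bigl => k; rewrite in_setT.
- by rewrite map_inj_uniq ?iota_uniq // => i j; lia.
- move=> k _ kN; apply: F0; rewrite ltnNge; apply: contra kN => kN.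
  by apply/mapP; exists (absz (k + N%:Z)%R); rewrite ?mem_iota; lia.
Qed.

Lemma eq_zsum F G : F =1 G -> zsum F = zsum G.
Proof. by move=> FG; apply: eq_fsbigr => k _; exact: FG. Qed.

Lemma bounded_add F G : bounded F -> bounded G -> bounded (fun k => F k + G k).
Proof.
move=> [N NF] [M MG]; exists (maxn N M) => k kN.
by rewrite NF ?MG ?addr0 //; lia.
Qed.

Lemma bounded_scale (c : int -> K) F : bounded F -> bounded (fun k => c k *: F k).
Proof. by move=> [N NF]; exists N => k kN; rewrite NF // scaler0. Qed.

Lemma bounded_if1 c F : bounded (fun k => if k == c then F k else 0).
Proof. by exists `|c|%N => k kc; case: eqP => // kE; move: kc; rewrite kE ltnn. Qed.

Lemma zsumD F G : bounded F -> bounded G ->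
  zsum (fun k => F k + G k) = zsum F + zsum G.
Proof.
move=> [N NF] [M MG]; rewrite (@zsumE (maxn N M)); last first.
  by move=> k kN; rewrite NF ?MG ?addr0 //; lia.
rewrite big_split; congr (_ + _); apply/esym/zsumE => k kN.
  by apply: NF; lia.
by apply: MG; lia.
Qed.

Lemma zsum1 c F : (forall k, k != c -> F k = 0) -> zsum F = F c.
Proof.
move=> Fc; rewrite /zsum (fsbigE [:: c]) // => [|k _]; last by rewrite inE; exact: Fc.
by rewrite big_cons big_nil in_setT /= addr0.
Qed.

Lemma zsum_if1 c F : zsum (fun k => if k == c then F k else 0) = F c.
Proof. by rewrite (@zsum1 c) ?eqxx // => k /negPf->. Qed.

Lemma zsum_shift c F : zsum F = zsum (fun k => F (k + c)).
Proof.
rewrite /zsum (reindex_fsbigT (fun k => k + c)) //.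
by exists (fun k => k - c) => k; rewrite ?addrK ?subrK.
Qed.

Lemma zsum_rev c F : zsum F = zsum (fun k => F (c - k)).
Proof.
rewrite /zsum (reindex_fsbigT (fun k => c - k)) //.
by exists (fun k => c - k) => k; rewrite subKr.
Qed.
End LocallyFiniteSums.

Lemma zsum_lin {K : numFieldType} {V W : lmodType K} (f : V -> W) (F : int -> V) :
  linear f -> bounded F -> f (zsum F) = zsum (fun k => f (F k)).
Proof.
move=> fP [N NF]; rewrite (zsumE NF) (lin_sum fP) (@zsumE _ _ N) // => k kN.
by rewrite NF // lin0.
Qed.

(** An injective map preserves the support, so this holds for infinite
    supports too, where both sums are 0. *)
Lemma zsum_inj {K : numFieldType} {V W : lmodType K} (f : V -> W) (F : int -> V) :
  linear f -> injective f -> f (zsum F) = zsum (fun k => f (F k)).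
Proof.
move=> fP finj; have f0 := lin0 fP.
have EF : finite_support 0 [set: int] F = finite_support 0 [set: int] (fun k => f (F k)).
  rewrite /finite_support !unlock; congr fset_set; apply/seteqP.
  split=> k /= [_ Fk]; split=> //; first by move=> fFk; apply: Fk; apply: finj; rewrite f0.
  by move=> Fk0; apply: Fk; rewrite Fk0.
by rewrite /zsum (lin_sum fP) EF.
Qed.

Lemma zsumZ {K : numFieldType} {V : lmodType K} (c : K) (F : int -> V) :
  bounded F -> zsum (fun k => c *: F k) = c *: zsum F.
Proof.
move=> BF; rewrite (zsum_lin (f := fun v => c *: v)) // => b u v.
by rewrite scalerDr !scalerA mulrC.
Qed.

(** The sum of k over the k between -p and 0, counted with signs. It is the
    correction from reordering the normally ordered products in G_sgG. *)
Lemma zsum_step {K : numFieldType} {V : lmodType K} (p : int) (v : V) :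
  let F := fun q k : int => (k%:~R * ((0 <= k)%R%:R - (- q <= k)%R%:R)) *: v in
  bounded (F p) /\ zsum (F p) = ((p%:~R ^+ 2 + p%:~R) / 2 : K) *: v.
Proof.
move=> F.
have BF q : bounded (F q).
  exists `|q|%N => k kq; rewrite /F.
  have -> : (0 <= k) = (- q <= k) by lia.
  by rewrite subrr mulr0 scale0r.
split=> //.
have FS q : zsum (F (q + 1)) = zsum (F q) + (q%:~R + 1) *: v.
  have -> : (q%:~R + 1) *: v = zsum (fun k => if k == - q - 1 then (- k)%R%:~R *: v else 0).
    by rewrite zsum_if1; congr (_ *: _); rewrite opprB opprK addrC intrD.
  rewrite -zsumD //; last exact: bounded_if1.
  apply: eq_zsum => k; rewrite /F; case: eqP => [->|kq].
    have -> : (- (q + 1) <= - q - 1) by lia.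
    have -> : (- q <= - q - 1) = false by lia.
    by rewrite -scalerDl; congr (_ *: _); rewrite rmorphN /=; ring.
  by have -> : (- (q + 1) <= k) = (- q <= k) by [lia]; rewrite addr0.
have F0 : zsum (F 0) = 0.
  by apply: fsbig1 => k _; rewrite /F oppr0 subrr mulr0 scale0r.
elim/int_rec: p => [|n IH|n IH].
- by rewrite F0 expr0n /= addr0 mul0r scale0r.
- rewrite intS addrC FS IH -scalerDl; congr (_ *: _); rewrite intrD /=; by field.
- move: IH; have -> : - n%:Z = - n.+1%:Z + 1 by lia.
  rewrite FS => /(canRL (addrK _)) ->.
  rewrite -scalerBl; congr (_ *: _); rewrite intrD; by field.
Qed.

(** * The decoupled super Virasoro action *)

Section Sugawara.
Context {K : numFieldType} {V : lmodType K} (a : gbasis -> V -> V) (l z : K).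
Hypothesis aP : is_act a.
Hypothesis a_smooth : forall v, exists n : nat, forall x, n%:Z < gdeg2 x -> a x v = 0.
Hypothesis l0 : l != 0.
Hypothesis c2P : forall v, a gC2 v = z *: v.
Hypothesis c3P : forall v, a gC3 v = l *: v.
Local Notation act_linear := (act_linear aP).
Local Notation act0 := (lin0 (act_linear _)).
Local Notation actD := (linD (act_linear _)).
Local Notation actN := (linN (act_linear _)).
Local Notation actB := (linB (act_linear _)).
Local Notation actZ := (linZ (act_linear _)).
Local Notation half := (@Defs.half K).
Implicit Types (i j k m n p q : int) (v : V).

Local Notation H k := (a (gH k)).
Local Notation F k := (a (gF k)).
Local Notation G k := (a (gG k)).
Local Notation L k := (a (gL k)).

Lemma swapHH i j v : H i (H j v) = H j (H i v) + (if i + j == 0 then (i%:~R * l) *: v else 0).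
Proof.
rewrite (act_swap aP) /= lcombE expr0 scale1r /= c3P scalerA.
by [].
Qed.
Lemma swapHF i j v : H i (F j v) = F j (H i v).
Proof. by rewrite (act_swap aP) /= lcombE expr0 scale1r addr0. Qed.
Lemma swapFF i j v : F i (F j v) = - F j (F i v) + (if i + j + 1 == 0 then l *: v else 0).
Proof. by rewrite (act_swap aP) /= lcombE expr1 scaleN1r /= c3P scale1r. Qed.
Lemma swapGH p m v : G p (H m v) = H m (G p v) - m%:~R *: F (m + p) v.
Proof.
by rewrite (act_swap aP) /= !lcombE expr0 scale1r /= addr0 scaleNr.
Qed.
Lemma swapGF p q v : G p (F q v) = - F q (G p v) +
  (H (p + q + 1) v + (if p + q + 1 == 0 then ((2 * half p + 1) * z) *: v else 0)).
Proof. by rewrite (act_swap aP) /= !lcombE expr1 scaleN1r /= c2P !scalerA scale1r. Qed.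
Lemma swapLH m n v : L m (H n v) = H n (L m v) +
  (- n%:~R *: H (m + n) v + (if m + n == 0 then ((m%:~R ^+ 2 + m%:~R) * z) *: v else 0)).
Proof. by rewrite (act_swap aP) /= !lcombE expr0 scale1r /= c2P !scalerA. Qed.
Lemma swapLF m p v : L m (F p v) = F p (L m v) - (m%:~R / 2 + half p) *: F (m + p) v.
Proof. by rewrite (act_swap aP) /= !lcombE expr0 scale1r /= addr0 scaleNr. Qed.
Lemma swapLG m p v : L m (G p v) = G p (L m v) + (m%:~R / 2 - half p) *: G (m + p) v.
Proof. by rewrite (act_swap aP) /= !lcombE expr0 scale1r /= addr0. Qed.
Lemma swapGG p q v : G p (G q v) = - G q (G p v) + (2 *: L (p + q + 1) v +
  (if p + q + 1 == 0 then (3^-1 * (half p ^+ 2 - 4^-1)) *: a gC1 v else 0)).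
Proof. by rewrite (act_swap aP) /= !lcombE expr1 scaleN1r. Qed.

Definition nHH i j v := if i < j then H i (H j v) else H j (H i v).
Definition nFF i j v := if i < j then F i (F j v) else - F j (F i v).

(** The image of L_n on H(z), in terms of an arbitrary smooth action of hc. *)
Definition sgL n v : V :=
  (2 * l)^-1 *: zsum (fun k => nHH k (- k + n) v)
  + ((n%:~R + 1) * z / l) *: H n v
  - (2 * l)^-1 *: zsum (fun k => (half k + 2^-1) *: nFF k (- k - 1 + n) v).

(** The image of G_(p+1/2) on H(z). *)
Definition sgG p v : V :=
  l^-1 *: zsum (fun k => H k (F (- k + p) v))
  + ((2 * half p + 1) * z / l) *: F p v.

Lemma bounded_HF p v : bounded (fun k => H k (F (- k + p) v)).
Proof.
have [n nv] := a_smooth v; exists (n + `|p|)%N => k kn.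
have [k0|k0] := lerP 0 k.
  by rewrite swapHF nv ?act0 //= ; lia.
by rewrite [F _ v]nv ?act0 //=; lia.
Qed.

Lemma bounded_HH m v : bounded (fun k => nHH k (- k + m) v).
Proof.
have [n nv] := a_smooth v; exists (n + `|m|)%N => k kn; rewrite /nHH.
by case: ltP => km; rewrite [X in a _ X]nv ?act0 //=; lia.
Qed.

Lemma bounded_FF m v : bounded (fun k => nFF k (- k - 1 + m) v).
Proof.
have [n nv] := a_smooth v; exists (n + `|m| + 1)%N => k kn; rewrite /nFF.
by case: ltP => km; rewrite [X in a _ X]nv ?act0 ?oppr0 //=; lia.
Qed.

Lemma nHH_linear i j : linear (nHH i j).
Proof. by move=> c u v; rewrite /nHH; case: ifP => _; rewrite !act_linear. Qed.
Lemma nFF_linear i j : linear (nFF i j).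
Proof.
by move=> c u v; rewrite /nFF; case: ifP => _; rewrite !act_linear ?opprD ?scalerN.
Qed.

Lemma linear_zsum (f : int -> V -> V) : (forall k, linear (f k)) ->
  (forall v, bounded (f^~ v)) -> linear (fun v => zsum (f^~ v)).
Proof.
move=> fP fB c u v; rewrite -zsumZ // -zsumD //; last exact: bounded_scale.
by apply: eq_zsum => k; rewrite fP.
Qed.

Lemma sgG_linear p : linear (sgG p).
Proof.
apply: linear_add; apply: linear_scale; last exact: act_linear.
apply: linear_zsum => [k|v]; last exact: bounded_HF.
by apply: linear_comp; exact: act_linear.
Qed.

Lemma sgL_linear n : linear (sgL n).
Proof.
apply: linear_add; first apply: linear_add; try apply: linear_opp;
  apply: linear_scale; try exact: act_linear.
  by apply: linear_zsum => [k|v]; [exact: nHH_linear|exact: bounded_HH].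
apply: linear_zsum => [k|v]; last by apply: bounded_scale; exact: bounded_FF.
by apply: linear_scale; exact: nFF_linear.
Qed.

(** H and F have the same brackets with sgG as with G; this is the computation
    that makes the difference G - sgG supercommute with them. *)
Lemma H_sgG m p v : H m (sgG p v) = sgG p (H m v) + m%:~R *: F (m + p) v.
Proof.
rewrite /sgG actD !actZ swapHF -addrA.
rewrite [_ *: _ + m%:~R *: _]addrC addrA; congr (_ + _).
rewrite (zsum_lin (act_linear _)); last exact: bounded_HF.
have -> : m%:~R *: F (m + p) v = l^-1 *: zsum (fun k =>
    if k == - m then (m%:~R * l) *: F (- k + p) v else 0).
  by rewrite zsum_if1 opprK scalerA [m%:~R * l]mulrC mulrA mulVf // mul1r.
rewrite -scalerDr -zsumD; [|exact: bounded_HF|exact: bounded_if1].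
congr (_ *: _); apply: eq_zsum => k; rewrite swapHH swapHF.
have -> : (m + k == 0) = (k == - m) by lia.
by case: ifP.
Qed.

Lemma F_sgG q p v : F q (sgG p v) = - sgG p (F q v) +
  (H (p + q + 1) v + (if p + q + 1 == 0 then ((2 * half p + 1) * z) *: v else 0)).
Proof.
rewrite /sgG actD !actZ (zsum_lin (act_linear _)); last exact: bounded_HF.
have -> : H (p + q + 1) v = l^-1 *: zsum (fun k =>
    if k == p + q + 1 then l *: H k v else 0).
  by rewrite zsum_if1 scalerA mulVf // scale1r.
have -> : zsum (fun k => F q (H k (F (- k + p) v))) =
   - zsum (fun k => H k (F (- k + p) (F q v))) + zsum (fun k =>
    if k == p + q + 1 then l *: H k v else 0).
  rewrite -scaleN1r -zsumZ; last exact: bounded_HF.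
  rewrite -zsumD; [|apply: bounded_scale; exact: bounded_HF|exact: bounded_if1].
  apply: eq_zsum => k; rewrite -swapHF swapFF actD.
  rewrite actN scaleN1r; congr (_ + _).
  have -> : (q + (- k + p) + 1 == 0) = (k == p + q + 1) by lia.
  by case: ifP => _; rewrite ?act0 ?actZ.
rewrite swapFF scalerDr !scalerN opprD [RHS]addrACA; congr (_ + _).
rewrite scalerDr scalerN; congr (_ + _).
have -> : q + p + 1 = p + q + 1 by rewrite [q + p]addrC.
case: ifP => _; last by rewrite scaler0.
by rewrite scalerA divfK.
Qed.

(** The action of g decoupled from the Heisenberg-Clifford part: L and G with
    their Sugawara counterparts subtracted, c_1 with the central charge of
    H(z) subtracted, and 0 on all other basis elements. *)
Definition pr (x : gbasis) (v : V) : V :=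
  match x with
  | gL n => L n v - sgL n v
  | gG p => G p v - sgG p v
  | gC1 => a gC1 v - (3 / 2 - 12 * z ^+ 2 / l) *: v
  | _ => 0
  end.

Lemma pr_linear x : linear (pr x).
Proof.
case: x => [n|n|n|n|||] c u v /=; rewrite ?scaler0 ?addr0 //.
- by rewrite act_linear sgL_linear scalerBr opprD addrACA.
- by rewrite act_linear sgG_linear scalerBr opprD addrACA.
- by rewrite act_linear scalerBr scalerDr opprD addrACA !scalerA mulrC.
Qed.
Local Notation prN := (linN (pr_linear _)).
Local Notation prB := (linB (pr_linear _)).
Local Notation prZ := (linZ (pr_linear _)).

Lemma H_prG m p v : H m (pr (gG p) v) = pr (gG p) (H m v).
Proof.
rewrite /= actB H_sgG swapGH.
by rewrite opprD addrA addrAC.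
Qed.

Lemma F_prG q p v : F q (pr (gG p) v) = - pr (gG p) (F q v).
Proof.
rewrite /= actB F_sgG swapGF opprB opprD opprK.
by rewrite [in RHS]opprD opprK addrCA.
Qed.

Section Commuting.
Variables (f : V -> V) (e : bool).
Hypothesis fP : linear f.
Hypothesis fH : forall k v, f (H k v) = H k (f v).
Hypothesis fF : forall k v, f (F k v) = (-1) ^+ e *: F k (f v).

Lemma comm_nFF i j v : f (nFF i j v) = nFF i j (f v).
Proof.
have FF p q u : f (F p (F q u)) = F p (F q (f u)).
  by rewrite fF fF actZ scalerA -expr2 sqrr_sign scale1r.
by rewrite /nFF; case: ifP => _; rewrite ?(linN fP) FF.
Qed.

(** An operator that supercommutes with the H_k and F_k supercommutes with
    everything built from them. *)
Lemma comm_sgL n v : f (sgL n v) = sgL n (f v).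
Proof.
rewrite /sgL (linB fP) (linD fP) !(linZ fP) fH.
rewrite (zsum_lin fP); last exact: bounded_HH.
rewrite (zsum_lin fP); last by apply: bounded_scale; exact: bounded_FF.
congr (_ *: _ + _ - _ *: _); apply: eq_zsum => k.
  by rewrite /nHH; case: ifP => _; rewrite !fH.
by rewrite (linZ fP) comm_nFF.
Qed.

Lemma comm_sgG p v : f (sgG p v) = (-1) ^+ e *: sgG p (f v).
Proof.
rewrite /sgG (linD fP) !(linZ fP) (zsum_lin fP); last exact: bounded_HF.
rewrite fF [RHS]scalerDr !scalerA ![(-1) ^+ e * _]mulrC -!scalerA; congr (_ *: _ + _ *: _).
rewrite -zsumZ; last exact: bounded_HF.
by apply: eq_zsum => k; rewrite fH fF actZ.
Qed.
End Commuting.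

Lemma sgG_prG p q v : pr (gG p) (sgG q v) = - sgG q (pr (gG p) v).
Proof.
rewrite (@comm_sgG (pr (gG p)) true) ?scaleN1r //; first exact: pr_linear.
- by move=> k u; rewrite H_prG.
- by move=> k u; rewrite F_prG scaleN1r opprK.
Qed.

Lemma sgL_prG p n v : pr (gG p) (sgL n v) = sgL n (pr (gG p) v).
Proof.
apply: (@comm_sgL (pr (gG p)) true); first exact: pr_linear.
- by move=> k u; rewrite H_prG.
- by move=> k u; rewrite F_prG scaleN1r opprK.
Qed.

Lemma nFF_anti i j v : nFF i j v = - nFF j i v.
Proof.
rewrite /nFF; case: ltrgtP => [_|_|->]; rewrite ?opprK //.
suff -> : F j (F j v) = 0 by rewrite !oppr0.
have := swapFF j j v; rewrite ifF; last lia.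
rewrite addr0 => /eqP; rewrite -addr_eq0 -mulr2n -scaler_nat scaler_eq0.
by rewrite pnatr_eq0 /= => /eqP.
Qed.

(** The sum changes sign under k -> m - 1 - k. *)
Lemma zsum_FF m v : zsum (fun k => nFF k (- k - 1 + m) v) = 0.
Proof.
set A := zsum _; suff : A = - A.
  move/eqP; rewrite -addr_eq0 -mulr2n -scaler_nat scaler_eq0.
  by rewrite pnatr_eq0 /= => /eqP.
rewrite {1}/A (zsum_rev (m - 1)) -scaleN1r /A -zsumZ; last exact: bounded_FF.
apply: eq_zsum => k; rewrite nFF_anti scaleN1r; congr (- nFF _ _ v); lia.
Qed.

(** A shift of the coefficients is free, because of zsum_FF. *)
Lemma sum_FF_shift p m v :
  zsum (fun k => k%:~R *: nFF (k + p) (- k + (m - p - 1)) v) =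
  zsum (fun k => (half k + 2^-1) *: nFF k (- k - 1 + m) v).
Proof.
rewrite (zsum_shift (- p)).
have -> : zsum (fun k => (half k + 2^-1) *: nFF k (- k - 1 + m) v) =
    zsum (fun k => (half k + 2^-1) *: nFF k (- k - 1 + m) v)
    + zsum (fun k => - (p%:~R + 1) *: nFF k (- k - 1 + m) v).
  by rewrite zsumZ ?zsum_FF ?scaler0 ?addr0 //; exact: bounded_FF.
rewrite -zsumD; [|exact: bounded_scale (bounded_FF _ _)|exact: bounded_scale (bounded_FF _ _)].
apply: eq_zsum => k; rewrite -scalerDl subrK; congr (_ *: nFF _ _ v); last by lia.
by rewrite intrB /Defs.half; field.
Qed.

(** The bracket of G_p with one term of sgG q: terms of the two normally
    ordered sums of sgL, one more term at k = n, and a central correction when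
    n = 0. *)
Lemma G_HF p q k v (n := p + q + 1) :
  G p (H k (F (- k + q) v)) + H k (F (- k + q) (G p v)) =
    nHH k (- k + n) v + - 1 *: (k%:~R *: nFF (k + p) (- k + q) v)
    + ((if k == n then ((2 * half p + 1) * z) *: H k v else 0)
    + (if n == 0 then (k%:~R * ((0 <= k)%R%:R - (- p <= k)%R%:R)) *: (l *: v) else 0)).
Proof.
rewrite swapGH swapGF addrAC -actD addrAC addNr add0r.
rewrite actD.
have -> : p + (- k + q) + 1 = - k + n by rewrite /n; lia.
have -> : (- k + n == 0) = (k == n) by lia.
have -> : H k (if k == n then ((2 * half p + 1) * z) *: v else 0) =
    (if k == n then ((2 * half p + 1) * z) *: H k v else 0).
  by case: ifP => _; rewrite ?act0 ?actZ.
have -> : H k (H (- k + n) v) = nHH k (- k + n) v +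
    (if n == 0 then (k%:~R * (0 <= k)%R%:R) *: (l *: v) else 0).
  rewrite /nHH; case: ltrP => kn.
    case: eqP => n0; last by rewrite addr0.
    have -> : (0 <= k) = false by lia.
    by rewrite mulr0 scale0r addr0.
  have kE : k + (- k + n) = n by lia.
  rewrite swapHH kE; congr (_ + _); case: eqP => // n0.
  have -> : (0 <= k) by lia.
  by rewrite mulr1 scalerA.
have -> : F (k + p) (F (- k + q) v) = nFF (k + p) (- k + q) v +
    (if n == 0 then (- p <= k)%R%:R *: (l *: v) else 0).
  rewrite /nFF; case: ltrP => kn.
    case: eqP => n0; last by rewrite addr0.
    have -> : (- p <= k) = false by move: n0; rewrite /n; lia.
    by rewrite scale0r addr0.
  have nE : k + p + (- k + q) + 1 = n by rewrite /n; lia.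
  rewrite swapFF nE; congr (_ + _); case: eqP => // n0.
  have -> : (- p <= k) by move: n0; rewrite /n; lia.
  by rewrite scale1r.
case: eqP => _ /=; last by rewrite !addr0 scaleN1r addrAC.
rewrite scalerDr scaleN1r mulrBr scalerBl !scalerA !mulrA opprD -!addrA.
by congr (_ + _); rewrite addrCA [RHS]addrCA; congr (_ + _); rewrite addrCA.
Qed.

(** The super bracket of G_p and sgG q is twice sgL, plus the central charge
    of H(z): the shift by z contributes 12 z^2 / l and the reordering
    contributes 3/2. *)
Lemma G_sgG p q v : G p (sgG q v) + sgG q (G p v) =
  2 *: sgL (p + q + 1) v + (if p + q + 1 == 0 then
    (3^-1 * (half p ^+ 2 - 4^-1) * (3 / 2 - 12 * z ^+ 2 / l)) *: v else 0).
Proof.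
set n := p + q + 1.
rewrite /sgG actD !actZ (zsum_lin (act_linear _)); last exact: bounded_HF.
rewrite addrACA -!scalerDr -zsumD; [|  |exact: bounded_HF]; last first.
  have [N hN] := bounded_HF q v; exists N => k kN.
  by rewrite hN // act0.
rewrite swapGF -/n [X in _ + _ *: X]addrAC addNr add0r.
rewrite (eq_zsum (fun k => G_HF p q k v)) -/n.
have qE : q = n - p - 1 by rewrite /n; lia.
have [BS SS] := zsum_step p (l *: v).
have BF : bounded (fun k => k%:~R *: nFF (k + p) (- k + q) v).
  have [N hN] := bounded_FF n v; exists (N + `|p|)%N => k kN.
  have := hN (k + p); have -> : - (k + p) - 1 + n = - k + q by rewrite qE; lia.
  by move=> ->; rewrite ?scaler0 //; lia.
have B3 : bounded (fun k => if n == 0 then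
    (k%:~R * ((0 <= k)%R%:R - (- p <= k)%R%:R)) *: (l *: v) else 0).
  by case: eqP => _ //; exists 0%N.
have B4 : bounded (fun k => - 1 *: (k%:~R *: nFF (k + p) (- k + q) v)).
  exact: bounded_scale.
have B5 := bounded_if1 n (fun k => ((2 * half p + 1) * z) *: H k v).
have B6 := bounded_HH n v.
rewrite zsumD; [|exact: bounded_add|exact: bounded_add].
have SFFE : zsum (fun k => k%:~R *: nFF (k + p) (- k + q) v) =
    zsum (fun k => (half k + 2^-1) *: nFF k (- k - 1 + n) v).
  by rewrite -(sum_FF_shift p n v) -qE.
rewrite zsumD // zsumD // zsum_if1 zsumZ // SFFE.
rewrite /sgL; set SHH := zsum _; set SFF := zsum _; set S3 := zsum _.
have -> : S3 = if n == 0 then ((p%:~R ^+ 2 + p%:~R) / 2 : K) *: (l *: v) else 0.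
  by rewrite /S3; case: eqP => // _; apply: fsbig1.
have l2 : 2 * (2 * l)^-1 = l^-1 by rewrite invfM mulrA mulfV ?mul1r // pnatr_eq0.
rewrite !scalerDr !scalerN !scalerA l2 mulrN1 scaleNr.
rewrite -[LHS]addrA [X in _ + X = _]addrACA.
rewrite [X in _ = X + _]addrAC -[RHS]addrA -scalerDl; congr (_ + (_ *: _ + _)).
  rewrite /n !intrD /Defs.half; field; exact: l0.
case: eqP => n0; last by rewrite !scaler0 addr0.
rewrite !scalerA -scalerDl; congr (_ *: _).
have -> : half q = - half p.
  have -> : q = - p - 1 by move: n0; rewrite /n; lia.
  by rewrite /Defs.half intrB rmorphN /=; field.
by rewrite /Defs.half; field; exact: l0.
Qed.

(** As pr (gG p) supercommutes with sgG q, its bracket with pr (gG q) is its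
    bracket with G_q, which G_sgG computes. *)
Lemma prGG p q v : pr (gG p) (pr (gG q) v) + pr (gG q) (pr (gG p) v) =
  2 *: pr (gL (p + q + 1)) v + (if p + q + 1 == 0 then
    (3^-1 * (half p ^+ 2 - 4^-1)) *: pr gC1 v else 0).
Proof.
have e1 : pr (gG p) (pr (gG q) v) + pr (gG q) (pr (gG p) v) =
    pr (gG p) (G q v) + G q (pr (gG p) v).
  rewrite {1}[pr (gG q) v]/= prB sgG_prG.
  by rewrite [pr (gG q) (pr (gG p) v)]/= opprK addrACA subrr addr0.
rewrite {}e1 /= actB addrACA swapGG [X in X + _ = _]addrAC addNr add0r.
rewrite -opprD [sgG p _ + _]addrC G_sgG [q + p]addrC [RHS]addrC scalerBr.
rewrite opprD addrACA [RHS]addrC; congr (_ + _).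
case: eqP => n0; last by rewrite subr0.
rewrite scalerBr scalerA; congr (_ - (_ * _) *: _).
have -> : half q = - half p.
  have -> : q = - p - 1 by lia.
  by rewrite /Defs.half intrB rmorphN /=; field.
by rewrite sqrrN.
Qed.

(** All the L_n are brackets of odd elements, with G_(-1/2) as one factor, for
    which the central term vanishes. So the relations of L follow from those
    of G and no normally ordered product has to be commuted with another
    one. *)
Lemma prLE n v :
  pr (gL n) v = 2^-1 *: (pr (gG n) (pr (gG (-1)) v) + pr (gG (-1)) (pr (gG n) v)).
Proof.
have two0 : (2 : K) != 0 by rewrite pnatr_eq0.
rewrite prGG; have -> : n + -1 + 1 = n by lia.
have -> : (if n == 0 then (3^-1 * (half n ^+ 2 - 4^-1)) *: pr gC1 v else 0) = 0.
  by case: eqP => // ->; rewrite /Defs.half add0r exprVn -natrX subrr mulr0 scale0r.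
by rewrite addr0 scalerA mulVf // scale1r.
Qed.

Lemma H_prL m n v : H m (pr (gL n) v) = pr (gL n) (H m v).
Proof. by rewrite !prLE actZ actD !H_prG. Qed.

Lemma F_prL q n v : F q (pr (gL n) v) = pr (gL n) (F q v).
Proof.
rewrite !prLE actZ actD.
by rewrite !F_prG !prN !opprK.
Qed.

Lemma L_sgG m p v : L m (sgG p v) = sgG p (L m v) + (m%:~R / 2 - half p) *: sgG (m + p) v.
Proof.
rewrite /sgG actD !actZ (zsum_lin (act_linear _)); last exact: bounded_HF.
pose C (k : int) : K := m%:~R / 2 + half (- k + p).
have -> : zsum (fun k => L m (H k (F (- k + p) v))) =
    zsum (fun k => H k (F (- k + p) (L m v)))
    + (zsum (fun k => (- k%:~R) *: H (k + m) (F (- (k + m) + (m + p)) v))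
    + zsum (fun k => - C k *: H k (F (- k + (m + p)) v))
    + ((m%:~R ^+ 2 + m%:~R) * z) *: F (m + p) v).
  have -> : ((m%:~R ^+ 2 + m%:~R) * z) *: F (m + p) v = zsum (fun k =>
      if k == - m then ((m%:~R ^+ 2 + m%:~R) * z) *: F (- k + p) v else 0).
    by rewrite zsum_if1 opprK.
  have BHm : bounded (fun k => (- k%:~R) *: H (k + m) (F (- (k + m) + (m + p)) v)).
    apply: bounded_scale; have [N hN] := bounded_HF (m + p) v.
    by exists (N + `|m|)%N => k kN; rewrite hN //; lia.
  have BH := bounded_scale (fun k => - C k) (bounded_HF (m + p) v).
  have B1 := bounded_if1 (- m) (fun k => ((m%:~R ^+ 2 + m%:~R) * z) *: F (- k + p) v).
  rewrite -(zsumD BHm BH) -(zsumD (bounded_add BHm BH) B1).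
  rewrite -(zsumD (bounded_HF p (L m v)) (bounded_add (bounded_add BHm BH) B1)).
  apply: eq_zsum => k; rewrite swapLH swapLF actB actZ.
  have -> : - (k + m) + (m + p) = - k + p by lia.
  have -> : m + (- k + p) = - k + (m + p) by lia.
  have -> : (m + k == 0) = (k == - m) by lia.
  rewrite [m + k]addrC /C !scaleNr -!addrA; congr (_ + _).
  by rewrite addrCA.
have -> : zsum (fun k => (- k%:~R) *: H (k + m) (F (- (k + m) + (m + p)) v)) =
    zsum (fun k => - (k - m)%:~R *: H k (F (- k + (m + p)) v)).
  by rewrite [RHS](zsum_shift m); apply: eq_zsum => k; rewrite addrK.
rewrite -zsumD; [|exact: bounded_scale (bounded_HF _ _)|exact: bounded_scale (bounded_HF _ _)].
have -> : zsum (fun k => - (k - m)%:~R *: H k (F (- k + (m + p)) v)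
     + - C k *: H k (F (- k + (m + p)) v)) =
    (m%:~R / 2 - half p) *: zsum (fun k => H k (F (- k + (m + p)) v)).
  rewrite -zsumZ; last exact: bounded_HF.
  apply: eq_zsum => k; rewrite -scalerDl; congr (_ *: _).
  by rewrite /C /Defs.half intrB intrD rmorphN /=; field.
rewrite swapLF !scalerDr scalerN !scalerA -![in LHS]addrA -[RHS]addrA.
congr (_ + _); rewrite [RHS]addrCA [l^-1 * _]mulrC; congr (_ + _).
rewrite addrCA; congr (_ + _); rewrite -scalerBl; congr (_ *: _).
by rewrite /Defs.half intrD; field; exact: l0.
Qed.

Lemma prL_prG m p v : pr (gL m) (pr (gG p) v) =
  pr (gG p) (pr (gL m) v) + (m%:~R / 2 - half p) *: pr (gG (m + p)) v.
Proof.
have e2 : pr (gL m) (pr (gG p) v) - pr (gG p) (pr (gL m) v) =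
    L m (pr (gG p) v) - pr (gG p) (L m v).
  rewrite [pr (gL m) v]/= [pr (gL m) (pr (gG p) v)]/= prB sgL_prG.
  rewrite -[G p v - sgG p v]/(pr (gG p) v); move: (sgL m _) => s.
  by rewrite opprB addrA subrK.
rewrite -[LHS](subrK (pr (gG p) (pr (gL m) v))) e2 [RHS]addrC; congr (_ + _).
rewrite /= actB swapLG L_sgG.
move: (sgG p _) (sgG (m + p) _) (_ / 2 - half p) => s1 s2 g.
rewrite [- (s1 + _)]opprD addrACA [LHS]addrAC.
by rewrite addrN add0r scalerBr.
Qed.

Lemma prC1_comm x v : pr gC1 (pr x v) = pr x (pr gC1 v).
Proof.
have C1a y u : a gC1 (a y u) = a y (a gC1 u).
  rewrite (act_swap aP) /= lcomb_nil addr0.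
  by case: y => *; rewrite expr0 scale1r.
have fP := act_linear gC1.
have C1L n u : a gC1 (sgL n u) = sgL n (a gC1 u).
  apply: (@comm_sgL (a gC1) false) => [//|k w|k w]; first by rewrite C1a.
  by rewrite C1a scale1r.
have C1G n u : a gC1 (sgG n u) = sgG n (a gC1 u).
  transitivity ((-1) ^+ false *: sgG n (a gC1 u)); last by rewrite scale1r.
  apply: (@comm_sgG (a gC1) false) => [//|k w|k w]; first by rewrite C1a.
  by rewrite C1a scale1r.
rewrite [pr gC1 _]/= [pr gC1 v]/= prB prZ.
congr (_ - _); case: x => [m|m|m|m|||] /=; rewrite ?(lin0 fP) //.
- by rewrite (linB fP) C1a C1L.
- by rewrite (linB fP) C1a C1G.
- by rewrite (linB fP) (linZ fP).
Qed.

Lemma prL_prL m n v : pr (gL m) (pr (gL n) v) = pr (gL n) (pr (gL m) v) +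
  ((m%:~R - n%:~R) *: pr (gL (m + n)) v +
   (if m + n == 0 then ((m%:~R ^+ 3 - m%:~R) / 12) *: pr gC1 v else 0)).
Proof.
have two0 : (2 : K) != 0 by rewrite pnatr_eq0.
apply: (scalerI two0); rewrite [in LHS](prLE n) prZ scalerA mulfV // scale1r.
rewrite (linD (pr_linear (gL m))) !prL_prG.
rewrite (linD (pr_linear (gG n)) (pr (gG (-1)) (pr (gL m) v))).
rewrite (linD (pr_linear (gG (-1))) (pr (gG n) (pr (gL m) v))) !prZ.
have PN := prGG n (m - 1) v; have PM := prGG (m + n) (-1) v.
have nm : n + (m - 1) + 1 = m + n by lia.
have mn : m + n + -1 + 1 = m + n by lia.
rewrite nm in PN; rewrite mn in PM.
have PL := prLE n (pr (gL m) v).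
have -> : pr (gL n) (pr (gL m) v) = 2^-1 *: (pr (gG n) (pr (gG (-1)) (pr (gL m) v))
  + pr (gG (-1)) (pr (gG n) (pr (gL m) v))) by [].
move: (pr (gG n) (pr (gG (-1)) (pr (gL m) v))) (pr (gG (-1)) (pr (gG n) (pr (gL m) v))) => x1 x2.
move: PN PM {PL}; move: (pr gC1 v) (pr (gL (m + n)) v) (pr (gG n) _) (pr (gG (m - 1)) (pr (gG n) v)) => C1 Lmn y1 y2.
move: (pr (gG (m + n)) (pr (gG (-1)) v)) (pr (gG (-1)) (pr (gG (m + n)) v)) => w1 w2.
move=> PN PM.
set g1 := m%:~R / 2 - half (-1); set g2 := m%:~R / 2 - half n.
have -> : x1 + g1 *: y1 + g2 *: w1 + (x2 + g2 *: w2 + g1 *: y2) =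
   (x1 + x2) + (g1 *: (y1 + y2) + g2 *: (w1 + w2)).
  rewrite !scalerDr -!addrA; congr (_ + _).
  rewrite [RHS]addrCA; congr (_ + _).
  by rewrite addrCA; congr (_ + _); rewrite addrA addrC.
rewrite PN PM !scalerDr !scalerA mulfV // !scale1r; congr (_ + _).
rewrite addrACA -scalerDl; congr (_ *: _ + _).
  by rewrite /g1 /g2 /Defs.half; field.
case: eqP => mn0; last by rewrite !scaler0 addr0.
have -> : n = - m by lia.
rewrite addrN !scalerA -scalerDl; congr (_ *: _).
by rewrite /g1 /g2 /Defs.half rmorphN /=; field.
Qed.

(** The decoupled operators satisfy the relations of the super Virasoro
    algebra, so they make the space a module over g on which hc acts by
    zero. *)
Lemma pr_act : is_act pr.
Proof.
split=> [|x y v]; first exact: pr_linear.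
have zero w : pr w (0 : V) = 0 by apply: lin0; exact: pr_linear.
have sub0Z c : 0 - c *: (0 : V) = 0 by rewrite scaler0 subr0.
case: x => [m|m|m|m|||]; case: y => [n|n|n|n|||];
  rewrite ?[pr (gH _) _]/= ?[pr (gF _) _]/= ?[pr gC2 _]/= ?[pr gC3 _]/= ?zero ?sub0Z;
  rewrite [gbr _ _ _]/= ?/brLH ?/brHH ?/brLF ?/brFF ?/brGF ?/brHG ?lcombE
    ?[pr (gH _) _]/= ?[pr (gF _) _]/= ?[pr gC2 _]/= ?[pr gC3 _]/=
    ?scaler0 ?addr0 ?oppr0 ?if_same //;
  rewrite ?expr0 ?scale1r; try by rewrite ?addr0 ?subr0 ?subrr.
- by rewrite prL_prL [LHS]addrC addKr.
- by rewrite prL_prG [LHS]addrC addKr.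
- by rewrite prC1_comm subrr.
- by rewrite prL_prG [n + m]addrC -[RHS]opprK -scaleNr opprK -opprB [X in - X]addrC addKr.
- by rewrite expr1 scaleN1r opprK prGG.
- by rewrite prC1_comm subrr.
- by rewrite prC1_comm subrr.
- by rewrite prC1_comm subrr.
Qed.
End Sugawara.

(** * Submodules and restrictions *)

Record subv {K : numFieldType} {V : lmodType K} (E : set V) : Type :=
  Subv { svv : V; _ : svv \in in_lspan E }.

Section SubvInstances.
Context {K : numFieldType} {V : lmodType K} (E : set V).
HB.instance Definition _ := [isSub of subv E for @svv K V E].
HB.instance Definition _ := [Choice of subv E by <:].
HB.instance Definition _ := [SubChoice_isSubZmodule of subv E by <:].
HB.instance Definition _ := [SubZmodule_isSubLmodule of subv E by <:].

Lemma svv_linear : linear (@svv K V E).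
Proof. by []. Qed.

Lemma svv_inj : injective (@svv K V E).
Proof. exact: val_inj. Qed.

Lemma svvP (v : subv E) : lspan E (svv v).
Proof. by apply/asboolP; exact: (valP v). Qed.

(** Total for every f, with the value 0 if f does not preserve the span. *)
Definition restr (f : V -> V) (v : subv E) : subv E := insubd 0 (f (svv v)).

Lemma restrE f v : lspan E (f (svv v)) -> svv (restr f v) = f (svv v).
Proof. by move=> Ef; rewrite [LHS]insubdK //; apply/asboolP. Qed.

Lemma svv_lift (v : V) : E v -> exists u : subv E, svv u = v.
Proof.
move=> Ev; have Sv : v \in in_lspan E by apply/asboolP; exact: lspan_in.
by exists (Subv Sv).
Qed.
End SubvInstances.

Section Subrep.
Context {K : numFieldType} {L : lieSuper K}.

Definition subrep (V : rep L) (N : set V) : rep L :=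
  @Rep K L (subv N) (fun i => restr (@spr _ _ V i)) (fun x => restr (@act _ _ V x)).

Section Theory.
Variables (V : rep L) (N : set V).
Hypothesis NP : submodule N.
Local Notation W := (subrep N).
Let NS : subspace N. Proof. by case: NP. Qed.

Lemma subrep_in (v : W) : N (svv v).
Proof. exact: lspan_id (svvP v). Qed.

Lemma subrep_actE x (v : W) : svv (act x v) = act x (svv v).
Proof. by apply: restrE; apply: lspan_in; case: NP => _ _; apply; exact: subrep_in. Qed.

Lemma subrep_sprE i (v : W) : svv (spr i v) = spr i (svv v).
Proof. by apply: restrE; apply: lspan_in; case: NP => _ + _; apply; exact: subrep_in. Qed.

Lemma svv_lcomb (B : Type) (f : B -> W) s : svv (lcomb f s) = lcomb (fun b => svv (f b)) s.
Proof.
rewrite /lcomb (lin_sum (@svv_linear K V N)); apply: eq_bigr => t _.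
by rewrite (linZ (@svv_linear K V N)).
Qed.

Lemma subrep_module : is_module V -> is_module W.
Proof.
case=> [[sl s1 s2] al as_ ab]; split.
- split=> [i c u v|v|i j v]; apply: svv_inj.
  + by rewrite svv_linear !subrep_sprE -sl.
  + by rewrite (linD (@svv_linear K V N)) !subrep_sprE s1.
  + by rewrite !subrep_sprE s2; case: ifP => _; rewrite ?subrep_sprE.
- by move=> x c u v; apply: svv_inj; rewrite svv_linear !subrep_actE -al.
- by move=> x i v; apply: svv_inj; rewrite subrep_actE !subrep_sprE subrep_actE.
- move=> x y v; apply: svv_inj.
  rewrite (linB (@svv_linear K V N)) (linZ (@svv_linear K V N)) !subrep_actE ab.
  by rewrite svv_lcomb; apply: eq_bigr => t _; rewrite subrep_actE.
Qed.

Lemma subrep_smooth : smooth V -> smooth W.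
Proof.
move=> sV v; have [n nv] := sV (svv v); exists n => x /nv xv.
by apply: svv_inj; rewrite subrep_actE.
Qed.

Lemma subrep_simple (u : V) : N u -> u != 0 ->
  (forall (Q : set V) v, submodule Q -> Q `<=` N -> Q v -> v != 0 -> N `<=` Q) ->
  simple W.
Proof.
move=> Nu u0 max; split.
  have [w wu] := svv_lift Nu; exists w; apply: contra_neq u0 => w0.
  by rewrite -wu w0.
move=> M [[M0 ML] Ms Ma]; pose Q := [set v | exists2 w : W, M w & svv w = v].
have QP : submodule Q.
  split=> [|i _ [w Mw <-]|x _ [w Mw <-]].
  - split=> [|c _ _ [w Mw <-] [w' Mw' <-]]; first by exists 0.
    by exists (c *: w + w'); [exact: ML|].
  - by exists (spr i w); [exact: Ms|exact: subrep_sprE].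
  - by exists (act x w); [exact: Ma|exact: subrep_actE].
have [M00|/existsNP[v /not_implyP[Mv /eqP v0]]] := pselect (forall v, M v -> v = 0).
  by left.
right=> w; have /(max Q (svv v) QP) : Q `<=` N by move=> _ [w' _ <-]; exact: subrep_in.
case/(_ _ _ (svv w) (subrep_in w)) => [|| w' Mw' /svv_inj <- //].
  by exists v.
by apply: contra_neq v0 => v0; apply: svv_inj.
Qed.
End Theory.

Definition resrep (P : pred (lbasis L)) (Pbr : br_closed P) (V : rep L) : rep (lsub Pbr) :=
  @Rep K (lsub Pbr) V (@spr _ _ V) (fun b => @act _ _ V (val b)).

Lemma resrep_module (P : pred (lbasis L)) (Pbr : br_closed P) (V : rep L) :
  is_module V -> is_module (resrep Pbr V).
Proof.
case=> ss al as_ ab; split=> // [x|x i v|x y v]; [exact: al|exact: as_|].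
rewrite /= ab lcomb_sub; apply: eq_big_seq => t tP; congr (_ *: _).
rewrite /ext0; case: insubP => [u _ -> //|].
by rewrite (Pbr _ _ (valP x) (valP y) _ tP).
Qed.

Lemma resrep_smooth (P : pred (lbasis L)) (Pbr : br_closed P) (V : rep L) :
  smooth V -> smooth (resrep Pbr V).
Proof. by move=> sV v; have [n nv] := sV v; exists n => x /nv. Qed.
End Subrep.

Lemma isomorphic_sym {K : numFieldType} {L : lieSuper K} (V W : rep L) :
  isomorphic V W -> isomorphic W V.
Proof.
case=> f [fl [g fK gK] fs fa]; exists g; split.
- by move=> c u v; apply: (can_inj fK); rewrite gK fl !gK.
- by exists f.
- by move=> i v; apply: (can_inj fK); rewrite gK fs gK.
- by move=> x v; apply: (can_inj fK); rewrite gK fa gK.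
Qed.

(** The image is a nonzero submodule of a simple module. *)
Lemma simple_iso {K : numFieldType} {L : lieSuper K} (V W : rep L) (f : V -> W) v :
  simple W -> linear f -> (forall i u, f (spr i u) = spr i (f u)) ->
  (forall x u, f (act x u) = act x (f u)) -> f v != 0 ->
  (forall u, f u = 0 -> u = 0) -> isomorphic W V.
Proof.
move=> [_ Wsimple] fl fs fa fv0 finj; apply: isomorphic_sym.
have surj w : exists u, f u = w.
  have [|fz|h] := Wsimple [set w | exists u, f u = w]; last exact: h.
    split=> [|i _ [u <-]|x _ [u <-]].
    - split=> [|c _ _ [u <-] [u' <-]]; first by exists 0; exact: lin0.
      by exists (c *: u + u'); rewrite fl.
    - by exists (spr i u).
    - by exists (act x u).
  by rewrite (fz (f v)) ?eqxx // in fv0; exists v.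
have /choice[g gK] := surj.
exists f; split=> //; exists g => // u; apply/eqP; rewrite -subr_eq0; apply/eqP.
by apply: finj; rewrite (linB fl) gK subrr.
Qed.

(** * Enveloping algebras and tensor products *)

Lemma malg_span {K : numFieldType} {T : choiceType} {Z : lmodType K}
    (f : {malg K[T]} -> Z) (N : set Z) : linear f -> subspace N ->
  (forall w, N (f << w >>)) -> forall u, N (f u).
Proof.
move=> fP NP Nf u; rewrite (monalgE u) (lin_sum fP); apply: subspace_sum => // k _.
have -> : << u@_k *g k >> = u@_k *: << k >> :> {malg K[T]}.
  by apply/malgP => k'; rewrite mcoeffZ !mcoeffU mulrnAr mulr1.
by rewrite (linZ fP); apply: subspaceZ.
Qed.

Lemma subspace_zero {K : numFieldType} {Z : lmodType K} : subspace [set 0 : Z].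
Proof. by split=> // c u v /= -> ->; rewrite scaler0 addr0. Qed.

Lemma malg_lin_ext {K : numFieldType} {T : choiceType} {Z : lmodType K}
    (f g : {malg K[T]} -> Z) : linear f -> linear g ->
  (forall w, f << w >> = g << w >>) -> forall u, f u = g u.
Proof.
move=> fP gP fg u; apply/eqP; rewrite -subr_eq0; apply/eqP.
apply: (@malg_span _ _ _ (fun u => f u - g u) [set 0]).
- by apply: linear_add => //; exact: linear_opp.
- exact: subspace_zero.
- by move=> w /=; rewrite fg subrr.
Qed.

Section FreeAlgebra.
Context {K : numFieldType} {B : choiceType}.
Local Notation free := {malg K[{fmonom B}]}.

Lemma malgUM (u v : {fmonom B}) : (<< u >> : free) * (<< v >> : free) = << mmul u v >>.
Proof. by rewrite malgM_def fgmulUU mulr1. Qed.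

Lemma mulr_linear (g : free) : linear (fun u : free => u * g).
Proof. by move=> c u v; rewrite mulrDl scalerAl. Qed.
End FreeAlgebra.

Section UEA.
Context {K : numFieldType} (L : lieSuper K).
Local Notation free := {malg K[{fmonom (lbasis L)}]}.

Lemma mull_linear (g : free) : linear (fun u : free => g * u).
Proof. by move=> c u v; rewrite mulrDr free_mulrAr. Qed.

(** The defining relations of the enveloping algebra are stated with arbitrary
    factors on both sides; by linearity it is enough to take words there. *)
Lemma uea_rel_kill (Z : lmodType K) (f : {fmonom (lbasis L)} -> Z) :
  (forall (u v : {fmonom (lbasis L)}) x y,
     f (mmul (mmul u (mmul (fmu x) (fmu y))) v)
     - (-1) ^+ (lpar x && lpar y) *: f (mmul (mmul u (mmul (fmu y) (fmu x))) v)
     = lcomb (fun t => f (mmul (mmul u (fmu t)) v)) (lbr x y)) ->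
  forall r, @uea_rel K L r -> lext f r = 0.
Proof.
move=> fP _ [a x y b]; set r := (_ - _).
have fl := lext_linear f.
have h (u : {fmonom (lbasis L)}) : forall b, lext f (<< u >> * r * b) = 0.
  apply: (@malg_lin_ext _ _ _ _ (fun=> 0)) => [||v].
  - exact: (linear_comp fl (mull_linear (<< u >> * r))).
  - by move=> c p q; rewrite scaler0 addr0.
  rewrite /r /fgen !malgUM mulrBr mulrBl (linB fl) mulrBr mulrBl (linB fl).
  rewrite free_mulrAr -scalerAl (linZ fl) !malgUM !lextU fP.
  apply/eqP; rewrite subr_eq0; apply/eqP.
  rewrite /lcomb mulr_sumr mulr_suml (lin_sum fl); apply: eq_bigr => t _.
  by rewrite free_mulrAr -scalerAl (linZ fl) !malgUM lextU.
move: a; apply: (@malg_lin_ext _ _ _ _ (fun=> 0)) => [||u]; last exact: h.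
- exact: (linear_comp fl (linear_comp (mulr_linear b) (mulr_linear r))).
- by move=> c p q; rewrite scaler0 addr0.
Qed.
End UEA.

Section Tensor.
Context {K : numFieldType} {A B : lmodType K} {I : Type}.
Variables (rA : I -> A -> A) (lB : I -> B -> B).
Local Notation tens := (tens rA lB).
Local Notation tmul := (tmul rA lB).

Lemma tens_span (N : set tens) : subspace N -> (forall a b, N (tmul a b)) ->
  forall t, N t.
Proof.
move=> NP Nt t; rewrite -(lreprK t).
apply: (@malg_span _ _ _ (lpi (tens_rel rA lB)) N) => //; first exact: lpi_linear.
by case=> a b; exact: Nt.
Qed.

Lemma tens_lin_ext (Z : lmodType K) (f g : tens -> Z) : linear f -> linear g ->
  (forall a b, f (tmul a b) = g (tmul a b)) -> forall t, f t = g t.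
Proof.
move=> fP gP fg t; apply/eqP; rewrite -subr_eq0; apply/eqP.
apply: (@tens_span [set t | f t - g t = 0]) => [|a b /=]; last by rewrite fg subrr.
have hP := linear_add fP (linear_opp gP).
by split=> [|c u v /= u0 v0]; [exact: (lin0 hP)|rewrite /= hP u0 v0 scaler0 addr0].
Qed.

Lemma tlift_linear (Z : lmodType K) (f : A -> B -> Z) :
  (forall b, linear (f^~ b)) -> (forall a, linear (f a)) ->
  (forall i a b, f (rA i a) b = f a (lB i b)) ->
  linear (tlift f : tens -> Z).
Proof.
move=> fl fr fb.
have extP := lext_linear (fun ab : (A * B)%type => f ab.1 ab.2).
have kill r : tens_rel rA lB r -> lext (fun ab : (A * B)%type => f ab.1 ab.2) r = 0.
  case=> [a a' b|a b b'|c a b|c a b|i a b];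
    rewrite ?(linB extP) ?(linZ extP) !lextU /=.
  - by rewrite (linD (fl b)) addrAC addrK subrr.
  - by rewrite (linD (fr a)) addrAC addrK subrr.
  - by rewrite (linZ (fl b)) subrr.
  - by rewrite (linZ (fr a)) subrr.
  - by rewrite fb subrr.
move=> c u v; rewrite -[u]lreprK -[v]lreprK -lpi_linear /tlift.
by rewrite !(lquot_lift extP kill) extP.
Qed.
End Tensor.

Section Enveloping.
Context {K : numFieldType}.
Local Notation g := (scalg K).
Local Notation upi := (lpi (@uea_rel K g)).
Variable S : rep g.
Hypothesis SP : is_module S.
Local Notation a := (@act K g S : gbasis -> S -> S).
Local Notation free := {malg K[{fmonom (lbasis g)}]}.

Lemma rep_act : is_act a.
Proof. by case: SP => _ al _ ab. Qed.

Lemma wact_mmul (u v : {fmonom gbasis}) w :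
  wact a (mmul u v) w = wact a u (wact a v w).
Proof. by rewrite fmM wact_cat. Qed.

(** The action of the enveloping algebra. *)
Definition ev (u : uea g) (v : S) : S :=
  lext (fun w : {fmonom (lbasis g)} => wact a w v) (lrepr u).

Lemma evE (u : free) v :
  ev (upi u) v = lext (fun w : {fmonom (lbasis g)} => wact a w v) u.
Proof.
apply: lquot_lift; first exact: lext_linear.
apply: uea_rel_kill => p q x y; rewrite !wact_mmul !fmU /=.
rewrite -(linZ (wact_linear rep_act _)) -(linB (wact_linear rep_act _)).
rewrite rep_act.2 (lin_sum (wact_linear rep_act _)); apply: eq_bigr => t _.
by rewrite (linZ (wact_linear rep_act _)) !wact_mmul fmU.
Qed.

Lemma ev_linearl v : linear (ev^~ v).
Proof.
move=> c p q; rewrite -[p]lreprK -[q]lreprK -lpi_linear !evE.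
exact: lext_linear.
Qed.

Lemma ev_linearr u : linear (ev u).
Proof.
move=> c p q; rewrite -[u]lreprK !evE /lext scaler_sumr -big_split.
apply: eq_bigr => w _; rewrite (wact_linear rep_act) scalerDr !scalerA.
by rewrite mulrC.
Qed.

Lemma ev_lmul x u v : ev (@uea_lmul K (scalg K) x u) v = a x (ev u v).
Proof.
rewrite -[u]lreprK uea_lmulE !evE; move: (lrepr u).
have extP := lext_linear (fun w : {fmonom (lbasis g)} => wact a w v).
apply: malg_lin_ext => [||w].
- exact: (linear_comp extP (mull_linear _)).
- exact: (linear_comp (rep_act.1 x) extP).
- by rewrite /fgen malgUM !lextU wact_mmul fmU.
Qed.

Lemma ev_rmul x u v : ev (uea_rmul x u) v = ev u (a x v).
Proof.
rewrite -[u]lreprK uea_rmulE !evE; move: (lrepr u).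
apply: malg_lin_ext => [||w].
- exact: (linear_comp (lext_linear _) (mulr_linear _)).
- exact: lext_linear.
- by rewrite /fgen malgUM !lextU wact_mmul fmU.
Qed.

Lemma uea_rmul_linear x : linear (@uea_rmul K g x).
Proof.
move=> c u v; rewrite -[u]lreprK -[v]lreprK -lpi_linear !uea_rmulE -lpi_linear.
by congr (lpi _ _); rewrite mulrDl scalerAl.
Qed.

(** The relations are homogeneous for the parity, so the parity projections
    descend to the enveloping algebra. *)
Lemma uea_sprE i (u : free) : uea_spr i (upi u) =
  lext (fun w : {fmonom (lbasis g)} =>
    if fmonom_par w == i then upi << w >> else 0) u.
Proof.
apply: lquot_lift; first exact: lext_linear.
have lP := lpi_linear (@uea_rel K g).
apply: uea_rel_kill => p q x y; rewrite /fmonom_par !fmM !fmU !count_cat /=.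
have -> : ((count (@lpar K g) p + (lpar y + 0 + (lpar x + 0)) + count (@lpar K g) q) =
   (count (@lpar K g) p + (lpar x + 0 + (lpar y + 0)) + count (@lpar K g) q))%N by lia.
set par := odd _ == i.
have parE t : t \in lbr x y ->
    (odd (count (@lpar K g) (mmul (mmul p (fmu t.2)) q)) == i) = par.
  move=> tl; have tp : gpar t.2 = gpar x (+) gpar y := lbr_par tl.
  rewrite !fmM fmU !count_cat /= tp /par; congr (_ == _).
  by rewrite !oddD /=; case: (gpar x) (gpar y) => [] [].
have -> : lcomb (fun t => if odd (count (@lpar K g) (mmul (mmul p (fmu t)) q)) == i
       then upi << mmul (mmul p (fmu t)) q >> else 0) (lbr x y) =
    if par then lcomb (fun t => upi << mmul (mmul p (fmu t)) q >>) (lbr x y) else 0.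
  case: {+}par parE => parE.
    by apply: eq_big_seq => t tP; rewrite parE.
  by apply: big1_seq => t /andP[_ tP]; rewrite parE // scaler0.
case: par {parE} => //; last by rewrite scaler0 subr0.
rewrite -(linZ lP) -(linB lP).
have -> : lcomb (fun t => upi << mmul (mmul p (fmu t)) q >>) (lbr x y) =
    upi (<< p >> * lcomb (@fgen K g) (lbr x y) * << q >>).
  rewrite /lcomb mulr_sumr mulr_suml (lin_sum lP); apply: eq_bigr => t _.
  by rewrite free_mulrAr -scalerAl (linZ lP) /fgen !malgUM.
apply/lpi_eq => N _; apply; rewrite -!malgUM.
have := @UeaRel K g << p >> x y << q >>.
by rewrite !mulrBr !mulrBl free_mulrAr -scalerAl.
Qed.

Lemma uea_spr_linear i : linear (@uea_spr K g i).
Proof.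
move=> c u v; rewrite -[u]lreprK -[v]lreprK -lpi_linear !uea_sprE.
exact: lext_linear.
Qed.

Lemma uea_spr_rmul i (x : gbasis) (u : uea g) :
  uea_spr i (@uea_rmul K g x u) = @uea_rmul K g x (uea_spr (i (+) gpar x) u).
Proof.
rewrite -[u]lreprK; move: (lrepr u).
have l1 := linear_comp (uea_spr_linear i) (linear_comp (uea_rmul_linear x) (lpi_linear (@uea_rel K g))).
have l2 := linear_comp (uea_rmul_linear x) (linear_comp (uea_spr_linear (i (+) gpar x)) (lpi_linear (@uea_rel K g))).
apply: (malg_lin_ext l1 l2) => w.
rewrite uea_rmulE !uea_sprE /fgen malgUM !lextU /fmonom_par fmM fmU count_cat /=.
rewrite addn0 oddD oddb -[X in odd X (+) _]/(count (@lpar K g) w).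
have -> : (odd (count (@lpar K g) w) (+) gpar x == i) =
    (odd (count (@lpar K g) w) == i (+) gpar x).
  by case: (odd _) (gpar x) {l1 l2} (i) => [] [] [].
case: ifP => _; first by rewrite uea_rmulE /fgen malgUM.
by rewrite (lin0 (uea_rmul_linear x)).
Qed.

Lemma spr_wact i s v : spr i (wact a s v) = wact a s (spr (i (+) odd (count gpar s)) v).
Proof.
have [[_ _ _] _ sa _] := SP.
elim: s i => [|x s IH] i /=; first by rewrite addbF.
have -> : spr i (a x (wact a s v)) = a x (spr (i (+) gpar x) (wact a s v)).
  by rewrite sa -addbA addbb addbF.
by rewrite IH oddD oddb addbA.
Qed.

Lemma ev_spr i u v :
  spr i (ev u v) = \sum_(j : bool) ev (uea_spr j u) (spr (i (+) j) v).
Proof.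
have [[sl _ _] _ _ _] := SP.
rewrite -[u]lreprK; move: (lrepr u).
apply: malg_lin_ext => [||w].
- exact: (linear_comp (sl i) (linear_comp (ev_linearl v) (lpi_linear _))).
- move=> c p q; rewrite scaler_sumr -big_split; apply: eq_bigr => j _.
  by rewrite lpi_linear uea_spr_linear ev_linearl.
rewrite evE lextU spr_wact (bigD1 (fmonom_par w)) //= big1 => [|j jw].
  by rewrite uea_sprE lextU eqxx evE lextU addr0.
by rewrite uea_sprE lextU eq_sym (negPf jw) (lin0 (ev_linearl _)).
Qed.
End Enveloping.

Lemma uea_br {K : numFieldType} (x y : gbasis) (u : uea (scalg K)) :
  @uea_lmul K (scalg K) x (@uea_lmul K (scalg K) y u)
    - (-1) ^+ (gpar x && gpar y) *: @uea_lmul K (scalg K) y (@uea_lmul K (scalg K) x u)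
  = lcomb (fun b => @uea_lmul K (scalg K) b u) (gbr K x y).
Proof.
rewrite -[u]lreprK; move: (lrepr u) => {}u; rewrite !uea_lmulE.
have lP := lpi_linear (@uea_rel K (scalg K)).
have -> : lcomb (fun b => @uea_lmul K (scalg K) b (lpi (@uea_rel K (scalg K)) u)) (gbr K x y) =
    lpi (@uea_rel K (scalg K)) (lcomb (@fgen K (scalg K)) (gbr K x y) * u).
  rewrite /lcomb mulr_suml (lin_sum lP); apply: eq_bigr => t _.
  by rewrite uea_lmulE -scalerAl (linZ lP).
rewrite -(linZ lP) -(linB lP); apply/lpi_eq => N _; apply.
have := @UeaRel K (scalg K) 1 x y u.
by rewrite mul1r !mulrBl -scalerAl !mulrA.
Qed.

Lemma uea_lmul_word {K : numFieldType} (x : gbasis) (m : {fmonom gbasis}) :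
  @uea_lmul K (scalg K) x (lpi (@uea_rel K (scalg K)) << m >>) =
  lpi (@uea_rel K (scalg K)) << mmul (fmu x) m >>.
Proof. by rewrite uea_lmulE /fgen malgUM. Qed.

Lemma uea_one_comm {K : numFieldType} (x : gbasis)
    (one := lpi (@uea_rel K (scalg K)) << (mone : {fmonom gbasis}) >>) :
  @uea_rmul K (scalg K) x one = @uea_lmul K (scalg K) x one.
Proof.
rewrite /one uea_rmulE uea_lmulE /fgen !malgUM.
have -> // : mmul mone (fmu x) = mmul (fmu x) mone :> {fmonom gbasis}.
by apply/val_inj; rewrite /= !fmM fm1 fmU.
Qed.

(** The parity projections of a tensor product respect the balancing relation:
    an odd x shifts both parities at once. *)
Lemma tmul_parity {K : numFieldType} {A B : lmodType K} {I : Type}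
    (rA : I -> A -> A) (lB : I -> B -> B) (sA : bool -> A -> A) (sB : bool -> B -> B)
    (x : I) (p i : bool) u w :
  (forall j, sA j (rA x u) = rA x (sA (j (+) p) u)) ->
  (forall j, lB x (sB (j (+) p) w) = sB j (lB x w)) ->
  \sum_(j : bool) tmul rA lB (sA j (rA x u)) (sB (i (+) j) w) =
  \sum_(j : bool) tmul rA lB (sA j u) (sB (i (+) j) (lB x w)).
Proof.
move=> hA hB; rewrite (reindex_inj (@addbI p)); apply: eq_bigr => j _.
rewrite hA (tmul_balanced rA lB) [p (+) j]addbC addbA hB -addbA addbb addbF.
by [].
Qed.

(** * Induced modules inside a module *)

Section Induced.
Context {K : numFieldType}.
Local Notation g := (scalg K).
Variables (S : rep g) (P : pred gbasis) (Pbr : @br_closed K g P) (N : set S).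
Hypothesis SP : is_module S.
Hypothesis Ssimple : simple S.
Hypothesis NP : submodule (N : set (resrep Pbr S)).
Local Notation a := (@act K g S : gbasis -> S -> S).
Local Notation W := (@subrep K (lsub Pbr) (resrep Pbr S) N).
Local Notation Ind := (induced W).
Local Notation aP := (rep_act SP).
Local Notation rA := (fun x : lbasis (lsub Pbr) => @uea_rmul K g (val x)).
Local Notation lB := (@act K (lsub Pbr) W).
Local Notation tm := (tmul rA lB).

Let WP : is_module W. Proof. exact: (subrep_module NP (resrep_module Pbr SP)). Qed.

(** The canonical map from the induced module to S, u (x) w |-> u w. *)
Definition ind_eval (t : Ind) : S := tlift (fun u (w : W) => ev u (svv w)) t.

Let b1 (w : W) : linear ((fun u (w : W) => @ev K S u (svv w))^~ w).
Proof. exact: ev_linearl. Qed.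
Let b2 (u : uea g) : linear (fun w : W => @ev K S u (svv w)).
Proof. exact: (linear_comp (ev_linearr SP u) (@svv_linear _ _ N)). Qed.
Let b3 (x : lbasis (lsub Pbr)) (u : uea g) (w : W) :
  ev (uea_rmul (val x) u) (svv w) = ev u (svv (act x w)).
Proof. by rewrite (ev_rmul SP) (subrep_actE NP). Qed.

Lemma ind_eval_linear : linear ind_eval.
Proof. exact: (tlift_linear b1 b2 b3). Qed.
Lemma ind_evalE u w : ind_eval (tm u w) = ev u (svv w).
Proof. exact: (tlift_tmul b1 b2 b3). Qed.

Lemma ind_act_linear x : linear (@act K g Ind x).
Proof.
apply: (@tlift_linear _ _ _ _ rA lB) => [w|u|y u w].
- exact: (linear_comp (tmul_linearl rA lB w) (uea_lmul_linear x)).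
- exact: tmul_linearr.
- have -> : uea_lmul x (uea_rmul (val y) u) = uea_rmul (val y) (@uea_lmul K (scalg K) x u).
    by rewrite -[u]lreprK uea_lmulE !uea_rmulE uea_lmulE mulrA.
  exact: (tmul_balanced rA lB).
Qed.

Lemma ind_actE x u w : @act K g Ind x (tm u w) = tm (@uea_lmul K g x u) w.
Proof. exact: (@induced_actE K g P Pbr W x u w). Qed.

Lemma ind_eval_act x t : ind_eval (act x t) = a x (ind_eval t).
Proof.
move: t; apply: (@tens_lin_ext _ _ _ _ rA lB).
- exact: (linear_comp ind_eval_linear (ind_act_linear x)).
- exact: (linear_comp (aP.1 x) ind_eval_linear).
- move=> u w; transitivity (ind_eval (tm (@uea_lmul K g x u) w)).
    by congr ind_eval; exact: ind_actE.
  apply: etrans (ind_evalE (@uea_lmul K g x u) w) _.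
  apply: etrans (ev_lmul SP x u (svv w)) _.
  exact: (congr1 (a x) (esym (ind_evalE u w))).
Qed.

Let sprf (i : bool) (u : uea g) (w : W) : Ind :=
  \sum_(j : bool) tm (uea_spr j u) (spr (i (+) j) w).

Let s1 i w : linear ((sprf i)^~ w).
Proof.
move=> c u v; rewrite /sprf scaler_sumr -big_split; apply: eq_bigr => j _.
by rewrite uea_spr_linear (tmul_linearl rA lB).
Qed.
Let s2 i u : linear (sprf i u).
Proof.
have [[sl _ _] _ _ _] := WP.
move=> c v w; rewrite /sprf scaler_sumr -big_split; apply: eq_bigr => j _.
by rewrite sl (tmul_linearr rA lB).
Qed.
Let s3 i (x : lbasis (lsub Pbr)) (u : uea g) (w : W) :
  sprf i (uea_rmul (val x) u) w = sprf i u (act x w).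
Proof.
have [_ _ sa _] := WP.
apply: (@tmul_parity _ _ _ _ rA lB (@uea_spr K g) (@spr _ _ W) x (gpar (val x)) i).
  by move=> j; exact: uea_spr_rmul.
by move=> j; rewrite sa -addbA addbb addbF.
Qed.

Lemma ind_spr_linear i : linear (@spr K g Ind i).
Proof. exact: (tlift_linear (s1 i) (s2 i) (s3 i)). Qed.
Lemma ind_sprE i u w : @spr K g Ind i (tm u w) = sprf i u w.
Proof. exact: (tlift_tmul (s1 i) (s2 i) (s3 i)). Qed.

Lemma ind_eval_spr i t : ind_eval (spr i t) = spr i (ind_eval t).
Proof.
have [[sl _ _] _ _ _] := SP.
move: t; apply: (@tens_lin_ext _ _ _ _ rA lB).
- exact: (linear_comp ind_eval_linear (ind_spr_linear i)).
- exact: (linear_comp (sl i) ind_eval_linear).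
- move=> u w; apply: etrans (congr1 ind_eval (ind_sprE i u w)) _.
  apply: etrans (lin_sum ind_eval_linear _ _ _) _.
  apply: etrans _ (congr1 (spr i) (esym (ind_evalE u w))).
  apply: etrans _ (esym (ev_spr SP i u (svv w))).
  apply: eq_bigr => j _; apply: etrans (ind_evalE _ _) _.
  by congr ev; exact: (subrep_sprE NP).
Qed.

Lemma ind_act : is_act (@act K g Ind : gbasis -> Ind -> Ind).
Proof.
split=> [x|x y t]; first exact: ind_act_linear.
move: t; apply: (@tens_lin_ext _ _ _ _ rA lB).
- apply: linear_add; first exact: linear_comp (ind_act_linear x) (ind_act_linear y).
  apply: linear_opp; apply: linear_scale.
  exact: linear_comp (ind_act_linear y) (ind_act_linear x).
- move=> c p q; rewrite /lcomb scaler_sumr -big_split; apply: eq_bigr => k _.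
  by rewrite ind_act_linear scalerDr !scalerA mulrC.
move=> u w; pose f b := tm (@uea_lmul K g b u) w.
have tl := tmul_linearl rA lB w.
transitivity (tm (@uea_lmul K g x (@uea_lmul K (scalg K) y u)) w
    - (-1) ^+ (gpar x && gpar y) *: tm (@uea_lmul K g y (@uea_lmul K (scalg K) x u)) w).
  congr (_ - _ *: _).
    exact: etrans (congr1 (@act K g Ind x) (ind_actE y u w)) (ind_actE x _ w).
  exact: etrans (congr1 (@act K g Ind y) (ind_actE x u w)) (ind_actE y _ w).
transitivity (lcomb f (gbr K x y)); last first.
  by apply: eq_bigr => k _; congr (_ *: _); exact: esym (ind_actE _ u w).
apply: etrans (esym (congr1 (fun v => _ - v) (linZ tl _ _))) _.
apply: etrans (esym (linB tl _ _)) _.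
apply: etrans (congr1 (tm^~ w) (uea_br x y u)) _.
apply: etrans (lin_sum tl _ _ _) _; apply: eq_bigr => k _.
exact: linZ tl _ _.
Qed.

Definition tm1 (w : W) : Ind := tm (lpi (@uea_rel K g) (<< (mone : {fmonom (lbasis g)}) >> : {malg K[{fmonom (lbasis g)}]})) w.

Lemma tm1_linear : linear tm1. Proof. exact: tmul_linearr. Qed.

Lemma ind_eval_tm1 w : ind_eval (tm1 w) = svv w.
Proof.
apply: etrans (ind_evalE _ _) _; rewrite (evE SP) lextU.
by rewrite -[X in wact _ X]/(fmonom_val (mone : {fmonom gbasis})) fm1.
Qed.

Local Notation wI := (wact (@act K g Ind : gbasis -> Ind -> Ind)).

Lemma ind_word (m : {fmonom gbasis}) w : tm (lpi (@uea_rel K g) << m >>) w = wI m (tm1 w).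
Proof.
case: m => s; elim: s => [|x s IH].
  have e : FMonom [::] = mone :> {fmonom gbasis} by apply/val_inj; rewrite /= fm1.
  exact: (congr1 (fun m => tm (lpi (@uea_rel K g) << m >>) w) e).
have e : FMonom (x :: s) = mmul (fmu x) (FMonom s) :> {fmonom gbasis}.
  by apply/val_inj; rewrite /= fmM fmU.
apply: etrans (congr1 (fun m => tm (lpi (@uea_rel K g) << m >>) w) e) _.
apply: etrans (congr1 (tm^~ w) (esym (uea_lmul_word x (FMonom s)))) _.
apply: etrans (esym (ind_actE x _ w)) _.
by apply: etrans (congr1 (@act K g Ind x) IH) _.
Qed.

Variable Q : pred gbasis.
Hypothesis Qbr : forall x y, Q x -> Q y -> forall t, t \in gbr K x y -> Q t.2.
Hypothesis Qneg : forall x, Q x -> gdeg2 x < 0.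
Hypothesis PQ : forall x, ~~ Q x -> P x.
Hypothesis indep : forall (L : seq word) (b : word -> S), uniq L ->
  (forall s, s \in L -> all Q s && std s) -> (forall s, N (b s)) ->
  \sum_(s <- L) wact a s (b s) = 0 -> forall s, s \in L -> b s = 0.

(** By the spanning half of the Poincare-Birkhoff-Witt theorem, the induced
    module is spanned by the sorted Q-words applied to 1 (x) W. *)
Lemma ind_span (t : Ind) : lspan [set t | exists s w,
   [/\ all Q s && std s, range tm1 w & t = wI s w]] t.
Proof.
have NPI x (w : Ind) : ~~ Q x -> range tm1 w -> range tm1 (@act K g Ind x w).
  move=> /PQ Px [v _ <-]; pose y : lbasis (lsub Pbr) := Sub x Px.
  exists (act y v) => //.
  apply: etrans _ (esym (ind_actE x _ v)).
  apply: etrans (esym (tmul_balanced rA lB y _ v)) _.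
  have e := uea_one_comm (K := K) x.
  exact: (f_equal (fun u => tm u v) e).
apply: (wspan_std ind_act Qbr Qneg).
apply: (@tens_span _ _ _ _ rA lB (wspan (@act K g Ind : gbasis -> Ind -> Ind) Q (range tm1))).
  exact: lspan_subspace.
move=> u w; rewrite -[u]lreprK; move: (lrepr u).
apply: (@malg_span _ _ _ (fun u => tm (lpi (@uea_rel K g) u) w)).
- exact: (linear_comp (tmul_linearl rA lB w) (lpi_linear _)).
- exact: lspan_subspace.
move=> m; rewrite ind_word; elim: (fmonom_val m) => [|x s IH] /=.
  by apply: lspan_in; exists [::], (tm1 w); split=> //; exists w.
exact: (wspan_stable ind_act NPI).
Qed.

(** In terms of ind_span this is the independence of the sorted words over
    N. *)
Lemma ind_eval_inj t : ind_eval t = 0 -> t = 0.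
Proof.
have tP := ind_span t.
have {}tP : lspan [set t | exists s w, [/\ (all Q s && std s : Prop), setT w &
    t = (fun s (w : W) => wI s (tm1 w)) s w]] t.
  apply: lspan_subset tP => _ [s [_ [sQ [w _ <-] ->]]].
  by exists s, w.
have [||L [b [uL LQ _ ->]]] := @lspan_family _ _ _ _ _ _ _ _ _ _ tP.
- by move=> s; exact: (linear_comp (wact_linear ind_act s) tm1_linear).
- by split.
rewrite (lin_sum ind_eval_linear) => b0.
have iw s w : ind_eval (wI s w) = wact a s (ind_eval w).
  by elim: s => //= x s IH; rewrite ind_eval_act IH.
rewrite big_seq big1 // => s sL.
have -> : b s = 0.
  apply: svv_inj; apply: (indep uL (b := fun s => svv (b s))) => //.
    by move=> s'; exact: (subrep_in NP).
  by rewrite -[RHS]b0; apply: eq_bigr => s' _; rewrite iw ind_eval_tm1.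
by rewrite (lin0 tm1_linear) (lin0 (wact_linear ind_act s)).
Qed.

Variables (v0 : S).
Hypothesis Nv0 : N v0.
Hypothesis v00 : v0 != 0.

(** The map ind_eval is injective, and onto since S is simple. *)
Lemma induced_iso : isomorphic S Ind.
Proof.
have [w0 w0E] := svv_lift Nv0.
apply: (@simple_iso _ _ Ind S ind_eval (tm1 w0)) => //.
- exact: ind_eval_linear.
- exact: ind_eval_spr.
- exact: ind_eval_act.
- by rewrite ind_eval_tm1 w0E.
- exact: ind_eval_inj.
Qed.

(** A submodule M of N generates S by simplicity, so a vector w of N is a
    combination of sorted words over M. By independence over N only the empty
    word contributes, and w is in M. *)
Lemma induced_simple : simple W.
Proof.
apply: (subrep_simple NP Nv0 v00) => M v [MS Ms Ma] MN Mv v_n0 w Nw.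
have MPI x u : ~~ Q x -> M u -> M (a x u).
  by move=> /PQ Px Mu; exact: (Ma (Sub x Px : lbasis (lsub Pbr)) u Mu).
have MM : submodule (wspan a Q M : set S).
  split; first exact: lspan_subspace.
    have [[sl _ _] _ _ _] := SP.
    move=> i u; apply: (lspan_map (sl i)) => _ [s [m [sQ Mm ->]]].
    rewrite (spr_wact SP); apply: lspan_in; exists s, (spr (i (+) odd (count gpar s)) m).
    by split=> //; exact: Ms.
  by move=> x u; exact: (wspan_stable aP MPI).
have Mv' : wspan a Q M v by apply: lspan_in; exists [::], v; split.
have [_ /(_ _ MM) [Mz|Mall]] := Ssimple; first by rewrite (Mz v) ?eqxx in v_n0.
have {Mall} := wspan_std aP Qbr Qneg (Mall w).
move=> /(@lspan_family _ _ _ _ (fun s => wact a s) (fun s => all Q s && std s) M).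
case=> [s||L [b [uL LQ Mb wE]]] //; first exact: (wact_linear aP s).
(* w, as the empty word, minus its expression in words over M *)
pose c s := (if s \in L then b s else 0) - (if s == [::] then w else 0).
have Nc s : N (c s).
  have [NS _ _] := NP.
  apply: (subspaceB NS); case: ifP => _; first [exact: (MN _ (Mb s)) | exact: (subspace0 NS) | exact: Nw].
have c0 : \sum_(s <- undup ([::] :: L)) wact a s (c s) = 0.
  have wl := wact_linear aP.
  rewrite (eq_bigr (fun s => (if s \in L then wact a s (b s) else 0)
    - (if s == [::] then w else 0))); last first.
    move=> s _; rewrite /c (linB (wl s)); congr (_ - _).
      by case: ifP => // _; rewrite (lin0 (wl s)).
    by case: eqP => [-> //|_]; rewrite (lin0 (wl s)).
  rewrite sumrB; apply/eqP; rewrite subr_eq0; apply/eqP.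
  transitivity w.
    rewrite wE -big_mkcond -big_filter; apply: perm_big.
    apply: uniq_perm; rewrite ?filter_uniq ?undup_uniq // => s.
    by rewrite mem_filter mem_undup inE andb_idr // => ->; rewrite orbT.
  rewrite (bigD1_seq [::]) ?undup_uniq ?mem_undup ?mem_head //= big1 ?addr0 //.
  by move=> s /negPf->.
have LQ' s : s \in undup ([::] :: L) -> all Q s && std s.
  by rewrite mem_undup inE => /orP[/eqP-> //|/LQ].
have := indep (undup_uniq ([::] :: L)) LQ' Nc c0 (s := [::]).
rewrite mem_undup mem_head => /(_ isT) /eqP; rewrite /c /= subr_eq0 => /eqP <-.
by case: ifP => _; [exact: Mb|exact: subspace0].
Qed.
End Induced.

(** * Simple smooth modules of nonzero level *)

Lemma zsum_in {K : numFieldType} {V : lmodType K} (N : set V) (F : int -> V) :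
  subspace N -> (forall k, N (F k)) -> N (zsum F).
Proof. by move=> NP NF; rewrite /zsum; apply: subspace_sum. Qed.

Section LevelRep.
Context {K : numFieldType}.
Local Notation g := (scalg K).
Variables (S : rep g) (l z c : K).
Hypothesis SP : is_module S.
Hypothesis Ssmooth : smooth S.
Hypothesis l0 : l != 0.
Local Notation a := (@act K g S : gbasis -> S -> S).
Hypothesis c1P : forall v, a gC1 v = c *: v.
Hypothesis c2P : forall v, a gC2 v = z *: v.
Hypothesis c3P : forall v, a gC3 v = l *: v.

Local Notation aP := (rep_act SP).
Local Notation p := (pr a l z).

Lemma rep_smooth v : exists n : nat, forall x, n%:Z < gdeg2 x -> a x v = 0.
Proof. exact: Ssmooth. Qed.
Local Notation sm := rep_smooth.

Lemma p_act : is_act p. Proof. exact: (pr_act aP sm l0 c2P c3P). Qed.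
Local Notation pP := p_act.

Lemma p_c1 v : p gC1 v = (c - (3 / 2 - 12 * z ^+ 2 / l)) *: v.
Proof. by rewrite /= c1P -scalerBl. Qed.

Lemma p_hc x v : ~~ in_svir x -> p x v = 0. Proof. by case: x. Qed.

(** This is what the subtraction of the Sugawara operators achieves. *)
Lemma hc_swap y x v : in_hc y ->
  a y (p x v) = (-1) ^+ (gpar y && gpar x) *: p x (a y v).
Proof.
case: y => // [m|m|] _; case: x => [n|n|n|n|||]; rewrite ?expr0 ?expr1 ?scale1r ?scaleN1r;
  try by rewrite ?oppr0 /= ?oppr0 (lin0 (aP.1 _)).
- exact: (H_prL aP sm l0 c2P c3P).
- exact: (@H_prG _ _ a l z aP sm l0 c3P).
- by rewrite !p_c1 (linZ (aP.1 _)).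
- exact: (F_prL aP sm l0 c2P c3P).
- exact: (F_prG aP sm l0 c2P c3P).
- by rewrite !p_c1 (linZ (aP.1 _)).
- by rewrite !c3P (linZ (pP.1 _)).
- by rewrite !c3P (linZ (pP.1 _)).
- by rewrite !c3P (linZ (pP.1 _)).
Qed.

Lemma hc_wact y s v : in_hc y ->
  a y (wact p s v) = (-1) ^+ (gpar y && odd (count gpar s)) *: wact p s (a y v).
Proof.
move=> yh; elim: s v => [|x s IH] v; first by rewrite andbF scale1r.
rewrite /= hc_swap // IH (linZ (pP.1 _)) scalerA -signr_addb; congr (_ ^+ _ *: _).
by rewrite oddD oddb; case: (gpar y) (gpar x) (odd _) => [] [] [].
Qed.

(** It commutes with the H_k and anticommutes with the F_k, so that comm_sgL
    and comm_sgG apply to it. *)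
Definition parity_inv (v : S) : S := twist true v.

Let sprL i : linear (@spr K g S i). Proof. by case: SP => [[]]. Qed.

Lemma parity_inv_linear : linear parity_inv.
Proof. by apply: linear_add; [|apply: linear_scale]; exact: sprL. Qed.

Lemma spr_parity_inv i v : spr i v = 2^-1 *: (v + (-1) ^+ i *: parity_inv v).
Proof.
have [[_ s1 _] _ _ _] := SP.
have two0 : (2 : K) != 0 by rewrite pnatr_eq0.
apply: (scalerI two0); rewrite scalerA mulfV // scale1r scaler_nat mulr2n.
have := s1 v; rewrite /parity_inv /twist expr1 scaleN1r.
case: i; move: (spr false v) (spr true v) => e o <-.
  by rewrite scaleN1r opprB [RHS]addrC addrA subrK.
by rewrite scale1r addrACA subrr addr0.
Qed.

Lemma parity_inv_act x v : parity_inv (a x v) = (-1) ^+ gpar x *: a x (parity_inv v).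
Proof.
have [_ _ sa _] := SP.
rewrite /parity_inv /twist expr1 !scaleN1r (linB (aP.1 x)) !sa /=.
case: (gpar x) => /=; rewrite ?expr1 ?expr0 ?scaleN1r ?scale1r //.
by rewrite opprB.
Qed.

Lemma parity_inv_p x v : parity_inv (p x v) = (-1) ^+ gpar x *: p x (parity_inv v).
Proof.
have tH k u : parity_inv (a (gH k) u) = a (gH k) (parity_inv u) by rewrite parity_inv_act scale1r.
have tF k u : parity_inv (a (gF k) u) = (-1) ^+ true *: a (gF k) (parity_inv u) by rewrite parity_inv_act.
have tl := parity_inv_linear.
case: x => [m|m|m|m|||] /=; rewrite ?expr0 ?expr1 ?scale1r ?scaleN1r ?(lin0 tl) ?oppr0 //.
- rewrite (linB tl) parity_inv_act (comm_sgL z aP sm l0 tl tH tF).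
  by move: (sgL _ _ _ _ _) (a _ _) => s u; rewrite scale1r.
- rewrite (linB tl) parity_inv_act (comm_sgG z aP sm l0 tl tH tF).
  by move: (sgG _ _ _ _ _) (a _ _) => s u; rewrite !scaleN1r -opprD.
- by rewrite (linB tl) (linZ tl) parity_inv_act scale1r.
Qed.

Lemma spr_p i x v : spr i (p x v) = p x (spr (i (+) gpar x) v).
Proof.
rewrite !spr_parity_inv parity_inv_p (linZ (pP.1 x)) (linD (pP.1 x)) (linZ (pP.1 x)).
by rewrite scalerA -signr_addb.
Qed.

Lemma p_smooth v : exists n : nat, forall x, n%:Z < gdeg2 x -> p x v = 0.
Proof.
have [n nv] := sm v; exists (n.*2.+4)%N => x xn.
have a0 y : n%:Z < gdeg2 y -> a y v = 0 by exact: nv.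
have al y := lin0 (aP.1 y).
case: x xn => [m|m|m|m|||] // mn; rewrite /pr a0 ?sub0r; try by move: mn => /=; lia.
- have e1 : zsum (fun k => nHH a k (- k + m) v) = 0.
    apply: fsbig1 => k _; rewrite /nHH; case: ltP => km.
      by rewrite (a0 (gH (- k + m))) ?al //=; move: mn km; clear => /=; lia.
    by rewrite (a0 (gH k)) ?al //=; move: mn km; clear => /=; lia.
  have e2 : zsum (fun k => (Defs.half k + 2^-1) *: nFF a k (- k - 1 + m) v) = 0.
    apply: fsbig1 => k _; rewrite /nFF; case: ltP => km.
      by rewrite (a0 (gF (- k - 1 + m))) ?al ?scaler0 //=; move: mn km; clear => /=; lia.
    by rewrite (a0 (gF k)) ?al ?oppr0 ?scaler0 //=; move: mn km; clear => /=; lia.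
  rewrite /sgL e1 e2 (a0 (gH m)); last by move: mn; clear => /=; lia.
  by rewrite !scaler0 addr0 subr0 oppr0.
- have e1 : zsum (fun k => a (gH k) (a (gF (- k + m)) v)) = 0.
    apply: fsbig1 => k _; have [k0|k0] := lerP (n%:Z + 1) (k *+ 2).
      by rewrite (swapHF aP) (a0 (gH k)) ?al //=; move: k0; clear => /=; lia.
    by rewrite (a0 (gF (- k + m))) ?al //=; move: mn k0; clear => /=; lia.
  rewrite /sgG e1 (a0 (gF m)); last by move: mn; clear => /=; lia.
  by rewrite !scaler0 !addr0 !oppr0.
Qed.

Definition decoupled : rep g := @Rep K g S (@spr K g S) p.

Lemma decoupled_module : is_module decoupled.
Proof.
have [[s1 s2 s3] _ _ _] := SP; split=> //; first exact: pP.1.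
- by move=> x i v /=; rewrite spr_p -addbA addbb addbF.
- exact: pP.2.
Qed.

Lemma sgL_in (N : set S) n v : subspace N ->
  (forall y u, in_hc y -> N u -> N (a y u)) -> N v -> N (sgL a l z n v).
Proof.
move=> NS Nh Nv; apply: (subspaceB NS); first apply: (subspaceD NS).
- apply: (subspaceZ _ NS); apply: zsum_in => // k; rewrite /nHH.
  by case: ifP => _; apply: (Nh) => //; apply: (Nh).
- by apply: (subspaceZ _ NS); exact: Nh.
- apply: (subspaceZ _ NS); apply: zsum_in => // k; apply: (subspaceZ _ NS); rewrite /nFF.
  by case: ifP => _; [|apply: (subspaceN NS)]; apply: (Nh) => //; apply: (Nh).
Qed.

Lemma sgG_in (N : set S) n v : subspace N ->
  (forall y u, in_hc y -> N u -> N (a y u)) -> N v -> N (sgG a l z n v).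
Proof.
move=> NS Nh Nv; apply: (subspaceD NS); apply: (subspaceZ _ NS); last exact: Nh.
by apply: zsum_in => // k; apply: (Nh) => //; apply: (Nh).
Qed.

(** S is a module over the decoupled algebra and hc together; stability under
    both is stability under g. *)
Lemma stable_all (N : set S) x v : subspace N ->
  (forall y u, in_hc y -> N u -> N (a y u)) -> (forall u, N u -> N (p x u)) ->
  N v -> N (a x v).
Proof.
move=> NS Nh Np Nv; case: x Np => [n|n|n|n|||] Np; try exact: Nh.
- rewrite -(subrK (sgL a l z n v) (a _ v)); apply: (subspaceD NS); first exact: Np.
  exact: sgL_in.
- rewrite -(subrK (sgG a l z n v) (a _ v)); apply: (subspaceD NS); first exact: Np.
  exact: sgG_in.
- by rewrite c1P; exact: subspaceZ.
- by rewrite c2P; exact: subspaceZ.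
Qed.

Lemma comm_wact_sgL s n v : wact p s (sgL a l z n v) = sgL a l z n (wact p s v).
Proof.
apply: (comm_sgL z aP sm l0 (wact_linear pP s) (e := odd (count gpar s))) => k u.
  by rewrite (hc_wact _ _ (isT : in_hc (gH k))) scale1r.
by rewrite (hc_wact _ _ (isT : in_hc (gF k))) scalerA -expr2 sqrr_sign scale1r.
Qed.

Lemma comm_wact_sgG s n v :
  wact p s (sgG a l z n v) = (-1) ^+ odd (count gpar s) *: sgG a l z n (wact p s v).
Proof.
apply: (comm_sgG z aP sm l0 (wact_linear pP s) (e := odd (count gpar s))) => k u.
  by rewrite (hc_wact _ _ (isT : in_hc (gH k))) scale1r.
by rewrite (hc_wact _ _ (isT : in_hc (gF k))) scalerA -expr2 sqrr_sign scale1r.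
Qed.
End LevelRep.

(** * The tensor factorization *)

(** A combination of eigenvectors for eigenvalues other than h is killed by a
    polynomial in T without root h. *)
Lemma eigen_independent {K : numFieldType} {V : lmodType K} (T : V -> V) (h : K)
    (E : set V) y : linear T ->
  (forall u, E u -> exists2 m, m != h & T u = m *: u) ->
  lspan E y ->
  exists2 q : {poly K}, q.[h] != 0 & polyop T q y = 0.
Proof.
move=> TP Eu; apply: (@lspan_le _ _ _ [set y | exists2 q : {poly K}, q.[h] != 0 & polyop T q y = 0]).
  split=> [|k u v [q q0 qu] [r r0 rv]].
    by exists 1; [rewrite hornerC oner_neq0|rewrite (lin0 (polyop_linear TP 1))].
  exists (q * r); first by rewrite hornerM mulf_neq0.
  have polyopM s t w : polyop T (s * t) w = polyop T s (polyop T t w).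
    elim/poly_ind: s => [|s b IH]; first by rewrite mul0r !polyop0.
    rewrite mulrDl !polyopD mul_polyC polyopZ polyopC; congr (_ + _).
    by rewrite mulrAC !polyopMX // IH.
  rewrite (polyop_linear TP) mulrC {1}polyopM qu (lin0 (polyop_linear TP _)) scaler0 add0r.
  by rewrite mulrC polyopM rv (lin0 (polyop_linear TP _)).
move=> u /Eu[m mh Tu]; exists ('X - m%:P).
  by rewrite hornerXsubC subr_eq0 eq_sym.
have := polyopMXsubC TP 1 m u; rewrite mul1r => ->.
by rewrite polyopC scale1r Tu subrr.
Qed.

Section LowestWeight.
Context {K : numFieldType}.
Local Notation g := (scalg K).
Variables (S : rep g) (l z c h : K).
Hypothesis SP : is_module S.
Hypothesis Ssimple : simple S.
Hypothesis Ssmooth : smooth S.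
Hypothesis l0 : l != 0.
Local Notation a := (@act K g S : gbasis -> S -> S).
Hypothesis c1P : forall v, a gC1 v = c *: v.
Hypothesis c2P : forall v, a gC2 v = z *: v.
Hypothesis c3P : forall v, a gC3 v = l *: v.

Local Notation aP := (rep_act SP).
Local Notation p := (pr a l z).
Local Notation pP := (p_act SP Ssmooth l0 c2P c3P).
Local Notation T := (p (gL 0)).
Local Notation hcw := (hc_wact SP Ssmooth l0 c1P c2P c3P).
Local Notation hcs := (hc_swap SP Ssmooth l0 c1P c2P c3P).
Let sprL i : linear (@spr K g S i). Proof. by case: SP => [[]]. Qed.

(** The lowest weight vectors of weight h for the decoupled super Virasoro
    action. As hc supercommutes with that action, they form an hc-module. *)
Definition lowest : set S := [set v | LGann p 0 v /\ T v = h *: v].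

Lemma lowest_subspace : subspace lowest.
Proof.
have [A0 AL] := LGann_subspace pP 0.
split=> [|k u v [uA uT] [vA vT]].
  by split=> //; rewrite (lin0 (pP.1 _)) scaler0.
by split; [exact: AL|rewrite pP.1 uT vT scalerDr !scalerA mulrC].
Qed.

Lemma lowest_hc y v : in_hc y -> lowest v -> lowest (a y v).
Proof.
move=> yh [vA vT]; have swap x : a y (p x v) = (-1) ^+ (gpar y && gpar x) *: p x (a y v).
  exact: hcs.
split=> [x xl xd|].
  have := swap x; rewrite vA // (lin0 (aP.1 y)) => /esym/eqP.
  by rewrite scaler_eq0 signr_eq0 => /eqP.
by have := swap (gL 0); rewrite andbF scale1r => <-; rewrite vT (linZ (aP.1 y)).
Qed.

Lemma lowest_spr i v : lowest v -> lowest (spr i v).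
Proof.
have sp := spr_p SP Ssmooth l0 c2P c3P.
move=> [vA vT]; split=> [x xl xd|].
  have := sp (i (+) gpar x) x v; rewrite -addbA addbb addbF => <-.
  by rewrite vA // (lin0 (sprL _)).
by have := sp i (gL 0) v; rewrite addbF => <-; rewrite vT (linZ (sprL i)).
Qed.

Lemma lowest_p x v : ~~ LGlow x -> lowest v -> exists k, p x v = k *: v.
Proof.
move=> xn [vA vT]; have [xl|xl] := boolP (inLG x).
  have [x0|x0] := lerP 1 (gdeg2 x).
    by exists 0; rewrite scale0r vA.
  have -> : x = gL 0.
    by rewrite -(inLG_K xl) -[gL 0]LGletL; congr LGlet; move: xn; rewrite LGlowE xl; move: x0; clear; lia.
  by exists h.
case: x xn xl => [m|m|m|m|||] // _ _; try by exists 0; rewrite scale0r.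
by exists (c - (3 / 2 - 12 * z ^+ 2 / l)); rewrite /= c1P -scalerBl.
Qed.

Lemma T_LGlow x u : LGlow x -> T (p x u) = p x (T u) + ((wl x)%:R / 2) *: p x u.
Proof.
move=> xs; rewrite (act_swap pP) scale1r; congr (_ + _).
have wE := LGlow_wl xs.
case: x xs wE => // m m0 wE; rewrite [gbr _ _ _]/= /brLL /brLG !lcombE.
  have -> : (0 + m == 0) = false by move: m0; clear => /=; lia.
  rewrite [(_, _).1]/= [(_, _).2]/= addr0 !add0r; congr (_ *: _).
  rewrite -/(- m%:~R).
  have -> : m%:~R = - ((wl (gL m))%:R / 2) :> K.
    have /(congr1 (fun k : int => k%:~R : K)) := wE.
    rewrite rmorphN /= rmorphMn /= -mulr_natr => /(canRL (mulfK _)) -> //.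
      by rewrite mulNr.
    by rewrite pnatr_eq0.
  by rewrite opprK.
rewrite addr0 add0r; congr (_ *: _).
transitivity (- Defs.half m : K); first by rewrite -[RHS]add0r -[in RHS](mul0r (2^-1)).
have /(congr1 (fun k : int => k%:~R : K)) := wE.
rewrite rmorphN /= rmorphD rmorphMn /= -mulr_natr => e.
apply: (@mulIf _ 2); first by rewrite pnatr_eq0.
rewrite divfK ?pnatr_eq0 // -[(wl _)%:R]opprK -[X in _ = - X]e /Defs.half.
by field.
Qed.

Lemma T_word s v : all LGlow s -> lowest v ->
  T (wact p s v) = (h + (wt s)%:R / 2) *: wact p s v.
Proof.
move=> + [_ vT]; elim: s => [_|x s IH].
  by rewrite -[wact p [::] v]/v -[wt [::]]/0%N vT mul0r addr0.
move=> /andP[xs sP]; rewrite -[wact p (x :: s) v]/(p x (wact p s v)) T_LGlow // IH // (linZ (pP.1 x)) -scalerDl.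
by rewrite wt_cons natrD mulrDl -addrA [_ / 2 + _]addrC.
Qed.

(** A nonempty word raises the eigenvalue of T = L_0 by half its weight, so it
    lands in an eigenspace other than that of h. *)
Lemma wspan_weight (Q : set S) v : subspace Q -> Q `<=` lowest ->
  wspan p LGlow Q v -> exists q y, [/\ Q q, v = q + y &
    lspan [set u | exists2 m, m != h & T u = m *: u] y].
Proof.
move=> QS Qh; apply: (@lspan_le _ _ _ [set v | exists q y, [/\ Q q, v = q + y &
    lspan [set u | exists2 m, m != h & T u = m *: u] y]]).
  split=> [|k _ _ [q [y [Qq -> yE]]] [q' [y' [Qq' -> yE']]]].
    by exists 0, 0; rewrite addr0; split=> //; [exact: subspace0|exact: lspan0].
  exists (k *: q + q'), (k *: y + y'); split; first by case: QS => _; apply.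
    by rewrite scalerDr addrACA.
  by apply: lspanD => //; apply: lspanZ.
move=> _ [[|x s] [q [sP Qq ->]]].
  by exists q, 0; rewrite addr0; split=> //; exact: lspan0.
exists 0, (wact p (x :: s) q); rewrite add0r; split=> //; first exact: subspace0.
apply: lspan_in; exists (h + (wt (x :: s))%:R / 2); last first.
  by rewrite T_word //; exact: Qh.
rewrite -subr_eq0 addrAC subrr add0r mulf_neq0 ?invr_eq0 ?pnatr_eq0 //.
have xs : LGlow x by case/andP: sP.
by rewrite wt_cons; have := LGlow_neg xs; rewrite /wl; clear; lia.
Qed.

Lemma wspan_eigen (Q : set S) v : subspace Q -> Q `<=` lowest ->
  wspan p LGlow Q v -> T v = h *: v -> Q v.
Proof.
move=> QS Qh /(wspan_weight QS Qh)[q [y [Qq vE yE]]] Tv.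
have [r rh ry] := eigen_independent (pP.1 (gL 0)) (fun u hu => hu) yE.
have Ty : T y = h *: y.
  have -> : y = v - q by rewrite vE addrC addKr.
  by rewrite (linB (pP.1 _)) Tv (Qh q Qq).2 scalerBr.
move: ry; rewrite (polyop_eigen (pP.1 _) r Ty) => /eqP.
rewrite scaler_eq0 (negPf rh) /= => /eqP y0.
by rewrite vE y0 addr0.
Qed.

(** The words over a nonzero hc-submodule Q of lowest weight vectors span a
    submodule of S, since hc supercommutes with them; by simplicity it is
    S. *)
Lemma wspan_full (Q : set S) q : subspace Q -> Q `<=` lowest ->
  (forall i v, Q v -> Q (spr i v)) -> (forall y v, in_hc y -> Q v -> Q (a y v)) ->
  Q q -> q != 0 -> forall v, wspan p LGlow Q v.
Proof.
move=> QS Qh Qs Qa Qq q0.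
have Qp x u : ~~ LGlow x -> Q u -> Q (p x u).
  move=> xn Qu; have [k ->] := lowest_p xn (Qh u Qu); exact: subspaceZ.
have YS : submodule (wspan p LGlow Q : set S).
  split; first exact: lspan_subspace.
  - move=> i v; apply: (lspan_map (sprL i)) => _ [s [u [sP Qu ->]]].
    have -> : spr i (wact p s u) = wact p s (spr (i (+) odd (count gpar s)) u).
      exact: (@spr_wact K (decoupled S l z) (decoupled_module SP Ssmooth l0 c2P c3P) i s u).
    by apply: lspan_in; exists s, (spr (i (+) odd (count gpar s)) u); split=> //; exact: Qs.
  move=> x v; apply: (stable_all (l := l) c1P c2P (N := wspan p LGlow Q)); first exact: lspan_subspace.
  - move=> y u yh; apply: (lspan_map (aP.1 y)) => _ [s [w [sP Qw ->]]].
    rewrite hcw //; apply: lspanZ; apply: lspan_in; exists s, (a y w).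
    by split=> //; exact: Qa.
  - by move=> u; exact: (wspan_stable pP Qp).
have [_ /(_ _ YS) [Yz|]] := Ssimple; last by [].
have : wspan p LGlow Q q by apply: lspan_in; exists [::], q; split.
by move/Yz => qz; rewrite qz eqxx in q0.
Qed.

Local Notation Hmod := (resrep hc_closed S).

Lemma lowest_submodule : submodule (lowest : set Hmod).
Proof.
split; first exact: lowest_subspace.
- exact: lowest_spr.
- by move=> x v; apply: lowest_hc; exact: (valP x).
Qed.

(** The part of weight h in the span of the words over Q is Q itself; this
    gives the simplicity of the hc-module of lowest weight vectors. *)
Lemma lowest_min (Q : set S) q : subspace Q -> Q `<=` lowest ->
  (forall i v, Q v -> Q (spr i v)) -> (forall y v, in_hc y -> Q v -> Q (a y v)) ->
  Q q -> q != 0 -> lowest `<=` Q.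
Proof.
move=> QS Qh Qs Qa Qq q0 v [vA vT]; apply: (wspan_eigen QS Qh) => //.
exact: (wspan_full QS Qh Qs Qa Qq q0).
Qed.

(** An odd lowest weight vector v is replaced by F_(1/2) v or F_(-1/2) v: they
    are not both zero, as F_(1/2) F_(-1/2) + F_(-1/2) F_(1/2) = l. *)
Lemma lowest_even v : lowest v -> v != 0 -> exists w, [/\ lowest w, w != 0 & spr false w = w].
Proof.
have [[_ s1 s2] _ sa _] := SP.
move=> vh v0; have [e0|e0] := eqVneq (spr false v) 0; last first.
  by exists (spr false v); split=> //; first [exact: lowest_spr | by rewrite s2].
have od : spr true v = v by rewrite -[RHS]s1 e0 add0r.
have ev y : gpar y -> spr false (a y v) = a y v.
  move=> yp; rewrite -{2}od sa /=.
  by rewrite yp.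
have FF := swapFF aP c3P 0 (-1) v.
rewrite -[0 + -1 + 1 == 0]/true in FF.
have [F0|F0] := eqVneq (a (gF 0) v) 0; last first.
  by exists (a (gF 0) v); split=> //; [exact: lowest_hc|exact: ev].
exists (a (gF (-1)) v); split; [exact: lowest_hc| |exact: ev].
apply: contra_neq v0 => F1; move/eqP: FF; rewrite F1 F0 !(lin0 (aP.1 _)) oppr0 add0r.
by rewrite eq_sym scaler_eq0 (negPf l0) => /eqP.
Qed.

Section Factor.
Variable w0 : S.
Hypothesis w0h : lowest w0.
Hypothesis w00 : w0 != 0.
Hypothesis w0e : spr false w0 = w0.

Let w0o : spr true w0 = 0.
Proof. by have [[_ _ s2] _ _ _] := SP; rewrite -w0e s2. Qed.

Let spr_w0 i : spr i w0 = if i then 0 else w0.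
Proof. by case: i. Qed.

Definition line : set S := [set v | exists k, v = k *: w0].

Lemma line_subspace : subspace line.
Proof.
split=> [|k _ _ [r ->] [s ->]]; first by exists 0; rewrite scale0r.
by exists (k * r + s); rewrite scalerDl scalerA.
Qed.

Lemma line_lowest : line `<=` lowest.
Proof. by move=> _ [k ->]; apply: subspaceZ => //; exact: lowest_subspace. Qed.

Lemma line_p x v : ~~ LGlow x -> line v -> line (p x v).
Proof.
move=> xn [k ->]; have [r rE] := lowest_p xn w0h.
by rewrite (linZ (pP.1 x)) rE; exists (k * r); rewrite scalerA.
Qed.

(** The factor U of the tensor factorization. *)
Definition svir_span : set S := wspan p LGlow line.

Lemma svir_span_subspace : subspace svir_span. Proof. exact: lspan_subspace. Qed.
Lemma svir_span_p x v : svir_span v -> svir_span (p x v). Proof. exact: (wspan_stable pP line_p). Qed.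
Lemma svir_span_w0 : svir_span w0.
Proof. by apply: lspan_in; exists [::], w0; split=> //; exists 1; rewrite scale1r. Qed.

Lemma spr_word i s v : spr i (wact p s v) = wact p s (spr (i (+) odd (count gpar s)) v).
Proof. exact: (@spr_wact K (decoupled S l z) (decoupled_module SP Ssmooth l0 c2P c3P) i s v). Qed.

Lemma svir_span_spr i v : svir_span v -> svir_span (spr i v).
Proof.
apply: (lspan_map (sprL i)) => _ [s [_ [sP [k ->] ->]]].
rewrite spr_word (linZ (sprL _)) spr_w0; case: ifP => _.
  by rewrite scaler0 (lin0 (wact_linear pP s)); exact: lspan0.
by apply: lspan_in; exists s, (k *: w0); split=> //; exists k.
Qed.

Lemma svir_span_word v : svir_span v -> lspan [set u | exists s, u = wact p s w0] v.
Proof.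
apply: lspan_mono => _ [s [_ [_ [k ->] ->]]]; rewrite (linZ (wact_linear pP s)).
by apply: lspanZ; apply: lspan_in; exists s.
Qed.

Lemma svir_span_eigen v : svir_span v -> T v = h *: v -> line v.
Proof. exact: (wspan_eigen line_subspace line_lowest). Qed.

(** A nonzero submodule M of U contains w0. Otherwise M has no component of
    weight h, and neither has the g-submodule Z generated by M, since hc
    commutes with T; but Z = S contains w0. *)
Lemma svir_span_core (M : set S) v : subspace M -> (forall i u, M u -> M (spr i u)) ->
  (forall x u, M u -> M (p x u)) -> M `<=` svir_span -> M v -> v != 0 -> M w0.
Proof.
move=> MS Ms Mp MU Mv v0; apply: contrapT => Mw0.
pose E := [set u | exists2 m, m != h & T u = m *: u].
have ME u : M u -> lspan E u.
  move=> Mu; have [q [y [[k qE] uE yE]]] := wspan_weight line_subspace line_lowest (MU u Mu).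
  have [r rh ry] := eigen_independent (pP.1 (gL 0)) (fun u hu => hu) yE.
  have : M (polyop T r u) by apply: polyop_stable => // u' /Mp.
  rewrite uE (linD (polyop_linear (pP.1 _) r)) ry addr0.
  rewrite (polyop_eigen (pP.1 _) r (a := h)); last exact: (line_lowest (ex_intro _ k qE)).2.
  rewrite qE scalerA; have [k0|k0] := eqVneq k 0.
    by rewrite k0 scale0r add0r.
  move=> Mkw; case: Mw0.
  have rk0 : r.[h] * k != 0 by rewrite mulf_neq0.
  rewrite -[w0](scalerK rk0); exact: subspaceZ.
(* the submodule of S generated by M *)
pose Z := lspan [set u | exists s m, [/\ all in_hc s, M m & u = wact a s m]].
have Zh y u : in_hc y -> Z u -> Z (a y u).
  move=> yh; apply: (lspan_map (aP.1 y)) => _ [s [m [sP Mm ->]]].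
  by apply: lspan_in; exists (y :: s), m; rewrite /= yh.
have Zp x u : Z u -> Z (p x u).
  apply: (lspan_map (pP.1 x)) => _ [s [m [sP Mm ->]]].
  elim: s sP => [|y s IH] /= => [_|/andP[yh sP]].
    by apply: lspan_in; exists [::], (p x m); split=> //; exact: Mp.
  have -> : p x (a y (wact a s m)) =
      (-1) ^+ (gpar y && gpar x) *: a y (p x (wact a s m)).
    by rewrite hcs // scalerA -expr2 sqrr_sign scale1r.
  by apply: lspanZ; apply: Zh => //; exact: IH.
have ZS : submodule (Z : set S).
  split; first exact: lspan_subspace.
  - move=> i u; apply: (lspan_map (sprL i)) => _ [s [m [sP Mm ->]]].
    rewrite (spr_wact SP); apply: lspan_in.
    by exists s, (spr (i (+) odd (count gpar s)) m); split=> //; exact: Ms.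
  - move=> x u; apply: (stable_all (l := l) c1P c2P (N := Z)) => //.
      exact: lspan_subspace.
    exact: Zp.
have ZE u : Z u -> lspan E u.
  apply: lspan_mono => _ [s [m [sP /ME mE ->]]].
  elim: s sP => //= y s IH /andP[yh sP]; move: (IH sP).
  apply: (lspan_map (aP.1 y)) => w [k kh Tw]; apply: lspan_in; exists k => //.
  have := hcs (gL 0) w yh; rewrite andbF scale1r => <-.
  by rewrite Tw (linZ (aP.1 y)).
have [_ /(_ _ ZS) [Zz|Zall]] := Ssimple.
  have : Z v by apply: lspan_in; exists [::], v; split.
  by move/Zz => vz; rewrite vz eqxx in v0.
have [r rh rw] := eigen_independent (pP.1 (gL 0)) (fun u hu => hu) (ZE w0 (Zall w0)).
move: rw; rewrite (polyop_eigen (pP.1 _) r w0h.2) => /eqP.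
by rewrite scaler_eq0 (negPf rh) (negPf w00).
Qed.

Local Notation Umod := (resrep svir_closed (decoupled S l z)).

Lemma svir_span_submodule : submodule (svir_span : set Umod).
Proof.
split; [exact: svir_span_subspace|exact: svir_span_spr|].
by move=> x v; exact: svir_span_p.
Qed.

Lemma svir_span_min (M : set Umod) v : submodule M -> M `<=` svir_span -> M v -> v != 0 -> svir_span `<=` M.
Proof.
move=> [MS Ms Ma] MU Mv v0.
have Mp x u : M u -> M (p x u).
  move=> Mu; have [xs|xs] := boolP (in_svir x).
    exact: (Ma (Sub x xs : lbasis svir) u Mu).
  by rewrite p_hc //; exact: subspace0.
have Mw0 : M w0 by apply: (svir_span_core MS Ms Mp MU Mv).
move=> u; apply: lspan_le => // _ [s [_ [_ [k ->] ->]]].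
elim: s => [|x s IH] /=; last exact: Mp.
exact: subspaceZ.
Qed.

Lemma lowest_words v : lowest v -> lspan [set u | exists2 s, all in_hc s & u = wact a s w0] v.
Proof.
move=> vh; set Q := lspan _.
have Qh : Q `<=` lowest.
  move=> u; apply: lspan_le; first exact: lowest_subspace.
  move=> _ [s sP ->]; elim: s sP => //= y s IH /andP[yh sP].
  by apply: lowest_hc => //; exact: IH.
apply: (@lowest_min Q w0) => //.
- exact: lspan_subspace.
- move=> i u; apply: (lspan_map (sprL i)) => _ [s sP ->].
  rewrite (spr_wact SP) spr_w0; case: ifP => _.
    by rewrite (lin0 (wact_linear aP s)); exact: lspan0.
  by apply: lspan_in; exists s.
- move=> y u yh; apply: (lspan_map (aP.1 y)) => _ [s sP ->].
  by apply: lspan_in; exists (y :: s); rewrite //= yh.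
- by apply: lspan_in; exists [::].
Qed.

(** The graph of the map x w0 |-> x h' from U to S, for words x in the
    decoupled operators. That it is single-valued is graph_zero. *)
Let graph (h' : S) : set (S * S)%type :=
  lspan [set xy : (S * S)%type | exists s, xy = (wact p s w0, wact p s h')].

Let pair_linear (f k : S -> S) : linear f -> linear k ->
  linear (fun xy : (S * S)%type => (f xy.1, k xy.2) : (S * S)%type).
Proof. by move=> fP kP r u v /=; rewrite fP kP. Qed.

Let graph_map (f k : S -> S) h1 h2 v s : linear f -> linear k ->
  (forall t, graph h2 (f (wact p t w0), k (wact p t h1))) ->
  graph h1 (v, s) -> graph h2 (f v, k s).
Proof.
move=> fP kP H gv.
apply: (@lspan_map _ _ _ (fun xy : (S * S)%type => (f xy.1, k xy.2) : (S * S)%type) _ _ (v, s)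
  (pair_linear fP kP) _ gv).
by move=> _ [t ->]; exact: H.
Qed.

Let graph_gen h' t : graph h' (wact p t w0, wact p t h').
Proof. by apply: lspan_in; exists t. Qed.

Let graph_total h' v : svir_span v -> exists s, graph h' (v, s).
Proof.
move=> /svir_span_word; apply: (@lspan_le _ _ _ [set v | exists s, graph h' (v, s)]).
  split=> [|k u w [s us] [t wt]]; first by exists 0; exact: lspan0.
  exists (k *: s + t).
  exact: (lspanD (lspanZ k us) wt).
by move=> _ [t ->]; exists (wact p t h'); exact: graph_gen.
Qed.

(** For h' = y w0 with y a word in hc, the map is the action of y up to sign,
    as y supercommutes with x. In particular it is well defined. *)
Let graph_word t v s : all in_hc t -> graph (wact a t w0) (v, s) ->
  s = wact a t (twist (odd (count gpar t)) v).
Proof.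
move=> tP gv; pose N := [set xy : (S * S)%type |
  xy.2 = wact a t (twist (odd (count gpar t)) xy.1)].
have twl e : linear (@twist K g S e).
  by apply: linear_add; [|apply: linear_scale]; exact: sprL.
apply: (@lspan_le _ _ _ N _ _ _ gv).
  split=> [|k u w uN wN]; rewrite /N /=.
    by rewrite (lin0 (twl _)) (lin0 (wact_linear aP t)).
  by rewrite uN wN (twl _) (wact_linear aP t).
move=> _ [r ->]; rewrite /N /=.
have -> : twist (odd (count gpar t)) (wact p r w0) =
    (-1) ^+ (odd (count gpar t) && odd (count gpar r)) *: wact p r w0.
  rewrite /twist !spr_word !spr_w0.
  by case: (odd (count gpar r)); case: (odd (count gpar t));
    rewrite /= ?(lin0 (wact_linear pP r)) ?scaler0 ?addr0 ?add0r ?scale1r.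
rewrite (linZ (wact_linear aP t)); elim: t tP {gv N} => [|y t IH] /=.
  by rewrite scale1r.
move=> /andP[yh tP].
have -> : wact p r (a y (wact a t w0)) =
    (-1) ^+ (gpar y && odd (count gpar r)) *: a y (wact p r (wact a t w0)).
  by rewrite hcw // scalerA -expr2 sqrr_sign scale1r.
rewrite (IH tP) (linZ (aP.1 y)) scalerA -signr_addb oddD oddb.
by congr (_ ^+ _ *: _); case: (gpar y) (odd _) (odd _) => [] [] [].
Qed.

Let graph_add k h1 h2 v s : graph (k *: h1 + h2) (v, s) ->
  exists s1 s2, [/\ graph h1 (v, s1), graph h2 (v, s2) & s = k *: s1 + s2].
Proof.
pose N := [set xy : (S * S)%type | exists s1 s2,
  [/\ graph h1 (xy.1, s1), graph h2 (xy.1, s2) & xy.2 = k *: s1 + s2]].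
apply: (@lspan_le _ _ _ N).
  split=> [|r x y [s1 [s2 [g1 g2 e]]] [t1 [t2 [g3 g4 e']]]].
    by exists 0, 0; rewrite scaler0 addr0; split=> //; exact: lspan0.
  exists (r *: s1 + t1), (r *: s2 + t2); split.
  - exact: (lspanD (lspanZ r g1) g3).
  - exact: (lspanD (lspanZ r g2) g4).
  by rewrite /= e e' !scalerDr !scalerA mulrC addrACA.
move=> _ [t ->]; exists (wact p t h1), (wact p t h2); split; try exact: graph_gen.
by rewrite /= (wact_linear pP t).
Qed.

(** Every lowest weight vector is a combination of the y w0, and the graph is
    linear in h'. *)
Let graph_zero h' s : lowest h' -> graph h' (0, s) -> s = 0.
Proof.
move=> /lowest_words hw; move: s.
apply: (@lspan_le _ _ _ [set h' | forall s, graph h' (0, s) -> s = 0] _ _ _ hw).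
  split=> [s g0|k u v uP vP s /graph_add[s1 [s2 [/uP -> /vP -> ->]]]]; last first.
    by rewrite scaler0 addr0.
  move: g0; apply: (@lspan_le _ _ _ [set xy : (S * S)%type | xy.2 = 0]) => [|_ [t ->]].
    by split=> // k u v /= -> ->; rewrite scaler0 addr0.
  by rewrite /= (lin0 (wact_linear pP t)).
move=> _ [t tP ->] s /(graph_word tP) ->.
rewrite /twist !(lin0 (sprL _)) scaler0 addr0; exact: (lin0 (wact_linear aP t)).
Qed.

(** The map U x H -> S with Phi (x w0) h' = x h', which will induce the
    isomorphism of U (x) H with S; it is 0 off U. *)
Definition Phi (v h' : S) : S := xget 0 [set s | graph h' (v, s)].

Let PhiP v h' : svir_span v -> graph h' (v, Phi v h').
Proof. by move=> /(graph_total h') ex; exact: (@xgetPex _ 0 [set r | graph h' (v, r)] ex). Qed.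

Let Phi_eq v h' s : lowest h' -> graph h' (v, s) -> Phi v h' = s.
Proof.
move=> hh gv; have gP : graph h' (v, Phi v h') by exact: (@xgetPex _ 0 [set r | graph h' (v, r)] (ex_intro _ s gv)).
apply/eqP; rewrite -subr_eq0; apply/eqP; apply: (graph_zero hh).
by have := lspanB gP gv; rewrite -[(v, _) - _]/(v - v, _) subrr.
Qed.

Lemma Phi_linearl h' k u v : lowest h' -> svir_span u -> svir_span v ->
  Phi (k *: u + v) h' = k *: Phi u h' + Phi v h'.
Proof.
move=> hh uU vU; apply: Phi_eq => //.
exact: (lspanD (lspanZ k (@PhiP u h' uU)) (@PhiP v h' vU)).
Qed.

Lemma Phi_linearr v k h1 h2 : svir_span v -> lowest h1 -> lowest h2 ->
  Phi v (k *: h1 + h2) = k *: Phi v h1 + Phi v h2.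
Proof.
move=> vU hh1 hh2; have := @PhiP v (k *: h1 + h2) vU.
by move=> /graph_add[s1 [s2 [/(Phi_eq hh1) -> /(Phi_eq hh2) -> ->]]].
Qed.

Lemma PhiZ v k h' : svir_span v -> lowest h' -> Phi v (k *: h') = k *: Phi v h'.
Proof.
move=> vU hh; have := Phi_linearr (-1) vU hh hh; rewrite !scaleN1r !addNr => P0.
have := Phi_linearr k vU hh (subspace0 lowest_subspace).
by rewrite P0 !addr0.
Qed.

Lemma Phi_p x v h' : svir_span v -> lowest h' -> Phi (p x v) h' = p x (Phi v h').
Proof.
move=> vU hh; apply: Phi_eq => //.
apply: (graph_map (pP.1 x) (pP.1 x) _ (@PhiP v h' vU)) => t.
exact: (@graph_gen h' (x :: t)).
Qed.

Lemma Phi_w0 h' : lowest h' -> Phi w0 h' = h'.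
Proof. by move=> hh; apply: Phi_eq => //; exact: (@graph_gen h' [::]). Qed.

Let tw_word e s : twist e (wact p s w0) =
  (-1) ^+ (e && odd (count gpar s)) *: wact p s w0.
Proof.
rewrite /twist !spr_word !spr_w0.
by case: (odd (count gpar s)); case: e;
  rewrite /= ?(lin0 (wact_linear pP s)) ?scaler0 ?addr0 ?add0r ?scale1r.
Qed.

Let twl e : linear (@twist K g S e).
Proof. by apply: linear_add; [|apply: linear_scale]; exact: sprL. Qed.

Lemma Phi_hc y v h' : in_hc y -> svir_span v -> lowest h' ->
  Phi (twist (gpar y) v) (a y h') = a y (Phi v h').
Proof.
move=> yh vU hh; apply: Phi_eq; first exact: lowest_hc.
apply: (graph_map (twl _) (aP.1 y) _ (@PhiP v h' vU)) => t.
rewrite tw_word hcw //; exact: (lspanZ _ (@graph_gen (a y h') t)).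
Qed.

Lemma lowest_sgL n h' : lowest h' -> lowest (sgL a l z n h').
Proof. by apply: sgL_in; [exact: lowest_subspace|move=> y u; exact: lowest_hc]. Qed.

Lemma lowest_sgG n h' : lowest h' -> lowest (sgG a l z n h').
Proof. by apply: sgG_in; [exact: lowest_subspace|move=> y u; exact: lowest_hc]. Qed.

Lemma Phi_sgL n v h' : svir_span v -> lowest h' ->
  Phi v (sgL a l z n h') = sgL a l z n (Phi v h').
Proof.
move=> vU hh; apply: Phi_eq; first exact: lowest_sgL.
have id_lin : linear (@id S) by [].
apply: (graph_map id_lin (sgL_linear z aP (rep_smooth Ssmooth) l0 n) _ (@PhiP v h' vU)) => t.
rewrite -(comm_wact_sgL SP Ssmooth l0 c1P c2P c3P); exact: graph_gen.
Qed.

Lemma Phi_sgG n v h' : svir_span v -> lowest h' ->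
  Phi (twist true v) (sgG a l z n h') = sgG a l z n (Phi v h').
Proof.
move=> vU hh; apply: Phi_eq; first exact: lowest_sgG.
apply: (graph_map (twl true) (sgG_linear z aP (rep_smooth Ssmooth) l0 n) _ (@PhiP v h' vU)) => t.
have -> : sgG a l z n (wact p t h') =
    (-1) ^+ odd (count gpar t) *: wact p t (sgG a l z n h').
  rewrite (comm_wact_sgG SP Ssmooth l0 c1P c2P c3P) scalerA.
  by rewrite -expr2 sqrr_sign scale1r.
rewrite tw_word; exact: (lspanZ _ (@graph_gen (sgG a l z n h') t)).
Qed.

Lemma Phi_spr i v h' : svir_span v -> lowest h' ->
  spr i (Phi v h') = Phi (spr false v) (spr i h') + Phi (spr true v) (spr (~~ i) h').
Proof.
move=> vU hh; have := @PhiP v h' vU.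
pose N := [set xy : (S * S)%type | exists s1 s2, [/\ graph (spr i h') (spr false xy.1, s1),
  graph (spr (~~ i) h') (spr true xy.1, s2) & spr i xy.2 = s1 + s2]].
move=> gv; have : N (v, Phi v h').
  apply: (@lspan_le _ _ _ N _ _ _ gv).
    split=> [|r x y [s1 [s2 [g1 g2 e]]] [t1 [t2 [g3 g4 e']]]].
      exists 0, 0; rewrite !(lin0 (sprL _)) addr0.
      by split=> //; exact: lspan0.
    exists (r *: s1 + t1), (r *: s2 + t2); rewrite /= !sprL; split.
    - exact: (lspanD (lspanZ r g1) g3).
    - exact: (lspanD (lspanZ r g2) g4).
    by rewrite e e' scalerDr addrACA.
  move=> _ [t ->]; rewrite /N /= !spr_word !spr_w0.
  case: (odd (count gpar t)) => /=.
    exists 0, (wact p t (spr (~~ i) h')); rewrite add0r addbT.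
    by rewrite (lin0 (wact_linear pP t)); split=> //; exact: lspan0.
  exists (wact p t (spr i h')), 0; rewrite addr0 addbF.
  by rewrite (lin0 (wact_linear pP t)); split=> //; exact: lspan0.
move=> [s1 [s2 /= [g1 g2 ->]]].
by rewrite (Phi_eq (lowest_spr i hh) g1) (Phi_eq (lowest_spr (~~ i) hh) g2).
Qed.

Lemma Phi_parity j e v h' : svir_span v -> lowest h' -> spr e h' = h' ->
  spr j (Phi v h') = Phi (spr (j (+) e) v) h'.
Proof.
move=> vU hh eh; have [[_ _ s2] _ _ _] := SP.
have sprh i : spr i h' = if i == e then h' else 0 by rewrite -{1}eh s2 eh.
have Phi0 u : svir_span u -> Phi u 0 = 0.
  move=> uU; have := Phi_linearr (-1) uU hh hh.
  by rewrite !scaleN1r !addNr.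
rewrite Phi_spr // !sprh.
have U0 := svir_span_spr false vU; have U1 := svir_span_spr true vU.
by case: j; case: e {eh sprh} => /=; rewrite ?(Phi0 _ U0) ?(Phi0 _ U1) ?addr0 ?add0r.
Qed.

(** Linear independence of a list, in the recursive form used by Phi_inj. *)
Fixpoint indep (hs : seq S) : Prop :=
  if hs is h1 :: hs' then ~ lspan [set` hs'] h1 /\ indep hs' else True.

Definition homog (v : S) : Prop := exists e, spr e v = v.

Let good (hs : seq S) := forall x, x \in hs -> lowest x /\ homog x.

Let parity (v : S) : bool := `[< spr true v = v >].

Let parityP v : homog v -> spr (parity v) v = v.
Proof.
by move=> [[] e]; rewrite /parity; case: asboolP => //; rewrite e.
Qed.

Let psum (hs : seq S) (cs : nat -> S) : S := \sum_(i < size hs) Phi (cs i) hs`_i.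

Let psum_cons h1 hs cs : psum (h1 :: hs) cs = Phi (cs 0%N) h1 + psum hs (fun i => cs i.+1).
Proof. by rewrite /psum big_ord_recl. Qed.

Let psum_map hs (cs ds : nat -> S) (f : S -> S) : linear f -> good hs ->
  (forall i : 'I_(size hs), f (Phi (cs i) hs`_i) = Phi (ds i) hs`_i) ->
  f (psum hs cs) = psum hs ds.
Proof. by move=> fP hsP fi; rewrite /psum (lin_sum fP); apply: eq_bigr => i _. Qed.

Let psum_lin hs k (cs ds : nat -> S) : good hs -> (forall i, svir_span (cs i)) -> (forall i, svir_span (ds i)) ->
  psum hs (fun i => k *: cs i + ds i) = k *: psum hs cs + psum hs ds.
Proof.
move=> hsP cU dU; rewrite /psum scaler_sumr -big_split; apply: eq_bigr => i _.
by apply: Phi_linearl => //; case: (hsP _ (mem_nth 0 (ltn_ord i))).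
Qed.

(** By induction on the list. The first coefficients of relations form a
    submodule Z of U, so if one is nonzero then w0 is in Z. In that relation
    all other coefficients may be multiplied by T - h, which kills the first
    term; by induction they are then eigenvectors for h, hence multiples of
    w0, and the relation expresses h1 through the other vectors. *)
Lemma Phi_inj hs (cs : nat -> S) : indep hs -> (forall x, x \in hs -> lowest x /\ homog x) ->
  (forall i, svir_span (cs i)) -> \sum_(i < size hs) Phi (cs i) hs`_i = 0 ->
  forall i, (i < size hs)%N -> cs i = 0.
Proof.
rewrite -/(psum hs cs).
elim: hs cs => [//|h1 hs IH] cs [h1n hsI] hsP csU.
have hsP' : good hs by move=> x xs; apply: hsP; rewrite inE xs orbT.
have hsh (i : 'I_(size hs)) : lowest hs`_i by case: (hsP' _ (mem_nth 0 (ltn_ord i))).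
have hsq (i : 'I_(size hs)) : spr (parity hs`_i) hs`_i = hs`_i.
  by apply: parityP; case: (hsP' _ (mem_nth 0 (ltn_ord i))).
have [h1h /parityP h1e] := hsP h1 (mem_head _ _).
have [U0 UL] := svir_span_subspace.
pose Z : set S := [set v | svir_span v /\ exists2 ds, (forall i : nat, svir_span (ds i)) &
  Phi v h1 + psum hs ds = 0].
have ZU : Z `<=` svir_span by move=> v [].
have ZS : subspace Z.
  split=> [|k u v [uU [ds dU du]] [vU [es eU ev]]].
    split=> //; exists (fun=> 0) => //.
    have psum0 := psum_lin (-1) hsP' (fun=> U0) (fun=> U0).
    have := Phi_linearl (-1) h1h U0 U0; rewrite !scaleN1r !addNr => ->.
    by rewrite add0r; move: psum0; rewrite !scaleN1r !addNr.
  split; first exact: UL.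
  exists (fun i => k *: ds i + es i); first by move=> i; exact: UL.
  rewrite Phi_linearl // psum_lin // addrACA -scalerDr du ev scaler0.
  by rewrite addr0.
have Zp x v : Z v -> Z (p x v).
  move=> [vU [ds dU dv]]; split; first exact: svir_span_p.
  exists (fun i => p x (ds i)); first by move=> i; exact: svir_span_p.
  rewrite Phi_p // -(@psum_map hs ds _ (p x) (pP.1 x) hsP'); last first.
    by move=> i; rewrite Phi_p.
  by rewrite -(linD (pP.1 x)) dv (lin0 (pP.1 x)).
have Zs i v : Z v -> Z (spr i v).
  move=> [vU [ds dU dv]]; split; first exact: svir_span_spr.
  pose j := i (+) parity h1.
  exists (fun k => spr (j (+) parity hs`_k) (ds k)); first by move=> k; exact: svir_span_spr.
  rewrite -(@psum_map hs ds _ (spr j) (sprL j) hsP'); last first.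
    by move=> k; apply: Phi_parity.
  have -> : Phi (spr i v) h1 = spr j (Phi v h1).
    by rewrite (Phi_parity _ vU h1h h1e) /j -addbA addbb addbF.
  by rewrite -(linD (sprL j)) dv (lin0 (sprL j)).
have Z0 v : Z v -> v = 0.
  move=> Zv; apply: contrapT => /eqP v0.
  have [_ [ds dU dw]] := svir_span_core ZS Zs Zp ZU Zv v0.
  move: dw; rewrite Phi_w0 // => dw.
  (* T - h kills the first term of the relation *)
  have Tn : linear (fun u => p (gL 0) u - h *: u).
    by apply: linear_add; [exact: pP.1|apply/linear_opp/linear_scale].
  have := congr1 (fun u => T u - h *: u) dw.
  rewrite (linD Tn) h1h.2 subrr add0r (lin0 Tn) => dz.
  have lineT (i : 'I_(size hs)) : line (ds i).
    apply: svir_span_eigen => //; apply/eqP; rewrite -subr_eq0; apply/eqP.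
    apply: (IH (fun i => T (ds i) - h *: ds i)) => //.
      move=> k; apply: (subspaceB svir_span_subspace); first exact: svir_span_p.
      exact: (subspaceZ _ svir_span_subspace).
    rewrite -dz; apply/esym; apply: (@psum_map hs ds _ _ Tn hsP') => k.
    rewrite addrC -scaleNr [X in _ = Phi X _]addrC -scaleNr Phi_linearl //; last exact: svir_span_p.
    by rewrite Phi_p.
  apply: h1n; have -> : h1 = - psum hs ds by apply/eqP; rewrite -subr_eq0 opprK dw.
  apply: lspanN; apply: subspace_sum => [|i _]; first exact: lspan_subspace.
  have [k ->] := lineT i.
  have -> : Phi (k *: w0) hs`_i = k *: hs`_i.
    have := Phi_linearl k (hsh i) svir_span_w0 U0; rewrite addr0 => ->.
    have := Phi_linearl (-1) (hsh i) U0 U0; rewrite !scaleN1r !addNr => ->.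
    by rewrite addr0 Phi_w0.
  apply: lspanZ; apply: lspan_in; exact: (mem_nth 0 (ltn_ord i)).
rewrite psum_cons => cz.
have c0 : cs 0%N = 0 by apply: Z0; split=> //; exists (fun i => cs i.+1).
move=> [_|i ilt]; first exact: c0.
apply: (IH (fun i => cs i.+1)) => //.
move: cz; rewrite c0.
have := Phi_linearl (-1) h1h U0 U0; rewrite !scaleN1r !addNr => ->.
by rewrite add0r.
Qed.

Local Notation U := (@subrep K (lsub svir_closed) (Umod) svir_span).
Local Notation H := (@subrep K (lsub hc_closed) (resrep hc_closed S) lowest).
Let svU_linear : linear (fun v : U => svv v : S). Proof. exact: svv_linear. Qed.
Let svH_linear : linear (fun v : H => svv v : S). Proof. exact: svv_linear. Qed.
Let svU_in (v : U) : svir_span (svv v : S). Proof. exact: (subrep_in svir_span_submodule). Qed.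
Let svH_in (v : H) : lowest (svv v : S). Proof. exact: (subrep_in lowest_submodule). Qed.

Let svU_act x (v : U) : (svv (act_svir x v) : S) = p x (svv v).
Proof.
rewrite /act_svir /ext0; case: insubP => [u us <-|xs].
  exact: (subrep_actE svir_span_submodule).
by rewrite p_hc // (lin0 svU_linear).
Qed.

Let svH_act y (v : H) : in_hc y -> (svv (act_hc y v) : S) = a y (svv v).
Proof.
move=> yh; rewrite /act_hc /ext0; case: insubP => [u us <-|]; last by rewrite yh.
exact: (subrep_actE lowest_submodule).
Qed.

Let svH_L n (v : H) : (svv (opL l z n v) : S) = sgL a l z n (svv v).
Proof.
rewrite /opL (linB svH_linear) (linD svH_linear) !(linZ svH_linear) /sgL.
have -> : (svv (\sum_(k \in [set: int]) normHH k (- k + n) v) : S) =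
    zsum (fun k => nHH a k (- k + n) (svv v)).
  rewrite -[\sum_(k \in _) _]/(zsum _) (zsum_inj _ svH_linear (@svv_inj _ _ _)).
  by apply: eq_zsum => k; rewrite /normHH /nHH; case: ifP => _; rewrite !svH_act.
have -> : (svv (\sum_(k \in [set: int]) (Defs.half k + 2^-1) *: normFF k (- k - 1 + n) v) : S) =
    zsum (fun k => (Defs.half k + 2^-1) *: nFF a k (- k - 1 + n) (svv v)).
  rewrite -[\sum_(k \in _) _]/(zsum _) (zsum_inj _ svH_linear (@svv_inj _ _ _)).
  apply: eq_zsum => k; rewrite (linZ svH_linear) /normFF /nFF.
  by case: ifP => _; rewrite ?(linN svH_linear) !svH_act.
by rewrite svH_act.
Qed.

Let svH_G n (v : H) : (svv (opG l z n v) : S) = sgG a l z n (svv v).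
Proof.
rewrite /opG (linD svH_linear) !(linZ svH_linear) /sgG svH_act //.
congr (_ *: _ + _).
rewrite -[\sum_(k \in _) _]/(zsum _) (zsum_inj _ svH_linear (@svv_inj _ _ _)).
by apply: eq_zsum => k; rewrite !svH_act.
Qed.

Local Notation rU := (fun (i : void) (t : U) => t).
Local Notation rH := (fun (i : void) (t : H) => t).
Local Notation tm := (tmul rU rH).
Local Notation X := (tens_rep (svir_ext U) (hc_ext l z H)).

Let phi (v : U) (w : H) : S := Phi (svv v) (svv w).

Let phi_linearl w : linear (phi^~ w).
Proof. by move=> k u v; rewrite /phi svU_linear Phi_linearl. Qed.

Let phi_linearr v : linear (phi v).
Proof. by move=> k u w; rewrite /phi svH_linear Phi_linearr. Qed.

Let F (t : tens rU rH) : S := tlift phi t.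

Let F_linear : linear F.
Proof. exact: (@tlift_linear K U H void rU rH S phi). Qed.

Let F_tm v w : F (tm v w) = phi v w.
Proof. exact: (@tlift_tmul K U H void rU rH S phi). Qed.

Let Uact_linear x : linear (fun v : U => act_svir x v).
Proof.
by move=> k u v; apply: (@svv_inj _ _ svir_span); rewrite svU_act [RHS]svU_linear !svU_act svU_linear pP.1.
Qed.

Let spU_linear i : linear (fun v : U => spr i v).
Proof.
move=> k u v; apply: (@svv_inj _ _ svir_span); rewrite [RHS]svU_linear.
by rewrite !(subrep_sprE svir_span_submodule) svU_linear [LHS](sprL i).
Qed.

Let spH_linear i : linear (fun v : H => spr i v).
Proof.
move=> k u v; apply: (@svv_inj _ _ lowest); rewrite [RHS]svH_linear.
by rewrite !(subrep_sprE lowest_submodule) svH_linear [LHS](sprL i).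
Qed.

Let hact : gbasis -> H -> H := @act K g (hc_ext l z H).

Let hact_sv x (w : H) : (svv (hact x w) : S) = match x with
    | gL n => sgL a l z n (svv w)
    | gG n => sgG a l z n (svv w)
    | gC1 => (3 / 2 - 12 * z ^+ 2 / l) *: (svv w : S)
    | gC2 => z *: (svv w : S)
    | _ => a x (svv w) end.
Proof.
case: x => [n|n|n|n|||]; [exact: svH_L|exact: svH_act|exact: svH_G|exact: svH_act|..].
- exact: (linZ svH_linear).
- exact: (linZ svH_linear).
exact: svH_act.
Qed.

Let Hact_linear x : linear (hact x).
Proof.
move=> k u v; apply: (@svv_inj _ _ lowest); rewrite [RHS]svH_linear !hact_sv svH_linear.
case: x => [n|n|n|n|||]; try exact: aP.1; try by rewrite scalerDr !scalerA mulrC.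
  exact: (sgL_linear z aP (rep_smooth Ssmooth) l0).
exact: (sgG_linear z aP (rep_smooth Ssmooth) l0).
Qed.

Let actX x v w : tens rU rH :=
  tm (act_svir x v) w + tm (@twist K svir U (gpar x) v) (hact x w).

Let actX_linearl x w : linear (fun v => actX x v w).
Proof.
apply: linear_add; first exact: (linear_comp (tmul_linearl _ _ _) (Uact_linear x)).
apply: (linear_comp (tmul_linearl rU rH _)).
by apply: linear_add; [|apply: linear_scale]; exact: spU_linear.
Qed.

Let actX_linearr x v : linear (actX x v).
Proof.
apply: linear_add; first exact: tmul_linearr.
exact: (linear_comp (tmul_linearr _ _ _) (Hact_linear x)).
Qed.

Let X_bal (Z : lmodType K) (f : U -> H -> Z) (i : void) v w : f (rU i v) w = f v (rH i w).
Proof. by case: i. Qed.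

Let X_act_linear x : linear (@act K g X x).
Proof. exact: (tlift_linear (actX_linearl x) (actX_linearr x) (X_bal (actX x))). Qed.

Let X_act x v w : @act K g X x (tm v w) = actX x v w.
Proof. exact: (tlift_tmul (actX_linearl x) (actX_linearr x) (X_bal (actX x))). Qed.

Let sprX i v w : tens rU rH := \sum_(j : bool) tm (spr j v) (spr (i (+) j) w).

Let sprX_linearl i w : linear (fun v => sprX i v w).
Proof.
move=> k u v; rewrite /sprX scaler_sumr -big_split; apply: eq_bigr => j _.
by rewrite spU_linear (tmul_linearl rU rH).
Qed.

Let sprX_linearr i v : linear (sprX i v).
Proof.
move=> k u w; rewrite /sprX scaler_sumr -big_split; apply: eq_bigr => j _.
by rewrite spH_linear (tmul_linearr rU rH).
Qed.

Let X_spr_linear i : linear (@spr K g X i).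
Proof. exact: (tlift_linear (sprX_linearl i) (sprX_linearr i) (X_bal (sprX i))). Qed.

Let X_spr i v w : @spr K g X i (tm v w) = sprX i v w.
Proof. exact: (tlift_tmul (sprX_linearl i) (sprX_linearr i) (X_bal (sprX i))). Qed.

Let F_spr i (t : X) : F (spr i t) = spr i (F t).
Proof.
apply: (@tens_lin_ext K U H void rU rH S (fun t => F (@spr K g X i t)) (fun t => spr i (F t))).
- exact: (linear_comp F_linear (X_spr_linear i)).
- exact: (linear_comp (sprL i) F_linear).
move=> v w; apply: etrans (congr1 F (X_spr i v w)) _.
apply: etrans _ (congr1 (spr i) (esym (F_tm v w))).
rewrite /sprX big_bool; apply: etrans (linD F_linear _ _) _.
rewrite addrC addbF addbT; apply: etrans (congr2 +%R (F_tm _ _) (F_tm _ _)) _.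
rewrite /phi Phi_spr //.
by rewrite !(subrep_sprE svir_span_submodule) !(subrep_sprE lowest_submodule).
Qed.

Let F_act x (t : X) : F (act x t) = a x (F t).
Proof.
apply: (@tens_lin_ext K U H void rU rH S (fun t => F (@act K g X x t)) (fun t => a x (F t))).
- exact: (linear_comp F_linear (X_act_linear x)).
- exact: (linear_comp (aP.1 x) F_linear).
move=> v w; apply: etrans (congr1 F (X_act x v w)) _.
apply: etrans _ (congr1 (a x) (esym (F_tm v w))).
apply: etrans (linD F_linear _ _) _.
apply: etrans (congr2 +%R (F_tm _ _) (F_tm _ _)) _.
rewrite /phi svU_act hact_sv Phi_p //.
have -> e : (svv (@twist K svir U e v) : S) = twist e (svv v : S).
  by rewrite /twist (linD svU_linear) (linZ svU_linear) !(subrep_sprE svir_span_submodule).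
have tw0 (u : S) : twist false u = u.
  by rewrite /twist expr0 scale1r; case: SP => [[_ -> _]].
case: x => [n|n|n|n|||] //=.
- by rewrite tw0 Phi_sgL // subrK.
- by rewrite tw0 -[RHS]add0r -(@Phi_hc (gH n)) // tw0.
- by rewrite Phi_sgG // subrK.
- by rewrite add0r (@Phi_hc (gF n)).
- by rewrite tw0 PhiZ // subrK.
- by rewrite tw0 PhiZ // add0r c2P.
by rewrite add0r -(@Phi_hc gC3) // tw0.
Qed.

Let tens_indep (t : tens rU rH) : exists (hs : seq H) (cs : nat -> U),
  [/\ indep [seq (svv w : S) | w <- hs], forall w, w \in hs -> homog (svv w : S)
    & t = \sum_(i < size hs) tm (cs i) hs`_i].
Proof.
have [[_ s1 s2] _ _ _] := SP.
have [r rP ->] : exists2 r : seq (U * H)%type, forall vw, vw \in r -> homog (svv vw.2 : S)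
    & t = \sum_(vw <- r) tm vw.1 vw.2.
  move: t; apply: (@tens_span K U H void rU rH).
    split=> [|k _ _ [r rP ->] [s sP ->]]; first by exists [::]; rewrite ?big_nil.
    exists ([seq (k *: vw.1, vw.2) | vw <- r] ++ s).
      move=> vw; rewrite mem_cat => /orP[/mapP[vw' vr ->]|vs]; last exact: (sP vw vs).
      exact: (rP vw' vr).
    rewrite big_cat big_map scaler_sumr; congr (_ + _); apply: eq_bigr => vw _.
    by rewrite (linZ (tmul_linearl rU rH _)).
  move=> v w; exists [:: (v, spr false w); (v, spr true w)].
    move=> vw; rewrite !inE => /orP[] /eqP -> /=; rewrite (subrep_sprE lowest_submodule).
      by exists false; rewrite s2.
    by exists true; rewrite s2.
  rewrite big_cons big_seq1 /= -(linD (tmul_linearr rU rH v)); congr tmul.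
  apply: (@svv_inj _ _ lowest); rewrite (linD svH_linear).
  by rewrite !(subrep_sprE lowest_submodule) [RHS]s1.
elim: r rP => [|[v w] r IH] rP.
  by exists [::], (fun=> 0); rewrite big_nil big_ord0.
have [|hs [cs [hsI hsh E]]] := IH; first by move=> vw vr; apply: rP; rewrite inE vr orbT.
have wh : homog (svv w : S) by exact: (rP (v, w) (mem_head _ _)).
rewrite big_cons /= E.
have [ws|wn] := pselect (lspan [set` [seq (svv w : S) | w <- hs]] (svv w : S)).
  have [k0 k0E] := lspan_seq ws.
  pose k (i : nat) : K := oapp k0 0 (insub i).
  have wE : w = \sum_(i < size hs) k i *: hs`_i.
    apply: (@svv_inj _ _ lowest); rewrite (lin_sum svH_linear) [LHS]k0E.
    rewrite -(size_map (fun w : H => svv w : S)); apply: eq_bigr => i _.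
    rewrite (linZ svH_linear) /k valK; congr (_ *: _).
    by rewrite (nth_map 0) //; have := ltn_ord i; rewrite [X in (_ < X)%N](size_map _ hs).
  exists hs, (fun i => k i *: v + cs i); split; [exact: hsI|exact: hsh|].
  rewrite {1}wE (lin_sum (tmul_linearr rU rH v)) -big_split; apply: eq_bigr => i _.
  by rewrite (tmul_linearl rU rH) (linZ (tmul_linearr rU rH v)).
exists (w :: hs), (fun i => if i is i'.+1 then cs i' else v); split; first by split.
  by move=> w'; rewrite inE => /orP[/eqP->|/hsh].
by rewrite big_ord_recl.
Qed.

Let F_inj (t : tens rU rH) : F t = 0 -> t = 0.
Proof.
have [hs [cs [hsI hsh ->]]] := tens_indep t; rewrite (lin_sum F_linear) => F0.
apply: big1 => i _; suff -> : cs i = 0 by rewrite (lin0 (tmul_linearl rU rH _)).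
apply: (@svv_inj _ _ svir_span); rewrite (lin0 svU_linear).
pose hs' := [seq (svv w : S) | w <- hs].
apply: (@Phi_inj hs' (fun i => svv (cs i)) hsI) => //.
- by move=> _ /mapP[w ws ->]; split; [exact: svH_in|exact: hsh].
- apply: etrans _ F0; rewrite /hs' size_map; apply: eq_bigr => j _.
  by rewrite F_tm /phi (nth_map 0).
by rewrite /hs' size_map.
Qed.

(** Phi is compatible with the two actions because L = L' + sgL, where L' acts
    on the factor U and sgL on the factor H, and similarly for G. It is
    injective by Phi_inj and onto since S is simple. *)
Theorem factor_iso : isomorphic S X.
Proof.
have [u uE] := svv_lift svir_span_w0; have [w wE] := svv_lift w0h.
apply: (@simple_iso K g X S F (tm u w) Ssimple F_linear F_spr F_act _ F_inj).
by rewrite F_tm /phi uE wE Phi_w0.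
Qed.

Lemma Umod_module : is_module U.
Proof.
apply: (subrep_module svir_span_submodule); apply: resrep_module.
exact: decoupled_module.
Qed.

Lemma Umod_smooth : smooth U.
Proof.
apply: (subrep_smooth svir_span_submodule); apply: resrep_smooth.
exact: (p_smooth z SP Ssmooth l0).
Qed.

Lemma Umod_simple : simple U.
Proof. exact: (subrep_simple svir_span_submodule svir_span_w0 w00 svir_span_min). Qed.

Lemma Hmod_module : is_module H.
Proof. exact: (subrep_module lowest_submodule (resrep_module _ SP)). Qed.

Lemma Hmod_smooth : smooth H.
Proof. exact: (subrep_smooth lowest_submodule (resrep_smooth Ssmooth)). Qed.

Lemma Hmod_simple : simple H.
Proof.
apply: (subrep_simple lowest_submodule w0h w00) => Q v [QS Qs Qa] Qh Qv v0.
apply: (lowest_min QS Qh Qs) (Qv) v0 => y u yh Qu.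
exact: (Qa (Sub y yh : lbasis hc) u Qu).
Qed.

Lemma Hmod_level : hc_has_level l H.
Proof. by move=> v; apply: (@svv_inj _ _ lowest); rewrite svH_act // (linZ svH_linear) c3P. Qed.

End Factor.
End LowestWeight.

(** * Inducing from vectors killed in high degrees *)

(** The super Virasoro letters come first in a sorted word. *)
Lemma std_split (s : word) : std s -> s = [seq x <- s | ~~ hcl x] ++ [seq x <- s | hcl x].
Proof.
move=> ss; apply: std_perm => //; last by rewrite perm_sym perm_catC perm_filterC.
rewrite /std pairwise_cat.
have sf (q : pred gbasis) : pairwise ltl [seq x <- s | q x].
  by apply: subseq_pairwise ss; exact: filter_subseq.
rewrite !sf !andbT; apply/allrelP => x y.
by rewrite !mem_filter => /andP[xh _] /andP[yh _]; rewrite /ltl /kl xh yh.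
Qed.

Section Induced.
Context {K : numClosedFieldType}.
Local Notation g := (scalg K).
Variables (S : rep g) (l z c : K).
Hypothesis SP : is_module S.
Hypothesis Ssimple : simple S.
Hypothesis Ssmooth : smooth S.
Hypothesis l0 : l != 0.
Local Notation a := (@act K g S : gbasis -> S -> S).
Hypothesis c1P : forall v, a gC1 v = c *: v.
Hypothesis c2P : forall v, a gC2 v = z *: v.
Hypothesis c3P : forall v, a gC3 v = l *: v.

Local Notation aP := (rep_act SP).
Local Notation p := (pr a l z).
Local Notation pP := (p_act SP Ssmooth l0 c2P c3P).
Local Notation hcs := (hc_swap SP Ssmooth l0 c1P c2P c3P).

Variable M : nat.
Local Notation A := (LGann p M).
Let AS : subspace A := LGann_subspace pP M.

Lemma LGann_hc y v : in_hc y -> A v -> A (a y v).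
Proof.
move=> yh vA x xl xd; have := hcs x v yh.
rewrite vA // (lin0 (aP.1 y)) => /esym/eqP.
by rewrite scaler_eq0 signr_eq0 => /eqP.
Qed.

Lemma LGann_word s v : all in_hc s -> A v -> A (wact a s v).
Proof. by elim: s => //= y s IH /andP[yh sP] vA; apply: LGann_hc => //; exact: IH. Qed.

Let q x v := a x v - p x v.

Let qL n v : q (gL n) v = sgL a l z n v. Proof. by rewrite /q /= opprB addrC subrK. Qed.
Let qG n v : q (gG n) v = sgG a l z n v. Proof. by rewrite /q /= opprB addrC subrK. Qed.

Let q_lann x v : inLG x -> A v -> A (q x v).
Proof.
move=> xl vA; case: x xl => // n _.
  by rewrite qL; apply: (sgL_in l z n AS _ vA) => y u; exact: LGann_hc.
by rewrite qG; apply: (sgG_in l z n AS _ vA) => y u; exact: LGann_hc.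
Qed.

Let q_word x s v : inLG x ->
  exists e : bool, q x (wact p s v) = (-1) ^+ e *: wact p s (q x v).
Proof.
case: x => // n _.
  exists false; rewrite scale1r !qL.
  by rewrite (comm_wact_sgL SP Ssmooth l0 c1P c2P c3P).
exists (odd (count gpar s)); rewrite !qG (comm_wact_sgG SP Ssmooth l0 c1P c2P c3P).
by rewrite scalerA -expr2 sqrr_sign scale1r.
Qed.

Let q_linear x : linear (q x).
Proof. by apply: linear_add; [exact: aP.1|apply: linear_opp; exact: pP.1]. Qed.

Local Notation fil := (fil p LGlow A).

(** On words the actions a and p have the same leading terms: the difference a
    x - p x is a Sugawara operator, which supercommutes with the decoupled
    words, preserves LGann, and adds no letter. *)
Lemma word_leading s v : all LGlow s -> A v -> fil (wt s) (wact a s v - wact p s v).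
Proof.
move=> + vA; elim: s => [_|x s IH] /=; first by rewrite subrr; exact: lspan0.
move=> /andP[xs sP]; have {IH} := IH sP; set e := _ - _ => eF.
have -> : wact a s v = wact p s v + e by rewrite addrC subrK.
have x0 : (0 < wl x)%N by have := LGlow_neg xs; rewrite /wl; clear; lia.
have aE u : a x u = p x u + q x u by rewrite /q addrC subrK.
rewrite (linD (aP.1 x)) !aE addrAC [p x _ + _]addrC addrK.
have xl := LGlow_lg xs.
apply: lspanD; last apply: lspanD.
- have [i ->] := q_word s v xl; apply: lspanZ; apply: lspan_in.
  by exists s, (q x v); split=> //; [rewrite wt_cons; lia|exact: q_lann].
- move: eF; apply: (lspan_map (pP.1 x)) => _ [t [b [tP tw Ab ->]]].
  by apply: lspan_in; exists (x :: t), b; rewrite /= xs !wt_cons; split=> //; lia.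
- move: eF; apply: (lspan_map (q_linear x)) => _ [t [b [tP tw Ab ->]]].
  have [i ->] := q_word t b xl; apply: lspanZ; apply: lspan_in.
  by exists t, (q x b); rewrite wt_cons; split=> //; [lia|exact: q_lann].
Qed.

Hypothesis noeig : forall h v, A v -> p (gL M) v = h *: v -> M = 0%N \/ h = 0 -> v = 0.

Section Level.
Variable r : nat.
(** The module that S is induced from. *)
Definition inducing : set S := [set v | A v /\ HFann a r v].
(** The basis elements outside g^(0,-r). *)
Definition creation (x : gbasis) : bool := LGlow x || HFlow r x.

(** A relation between the words is grouped by their super Virasoro parts.
    Applying hc-words does not leave LGann, so virasoro_independent separates
    the groups, and heisenberg_independent the words in each group. *)
Lemma creation_independent (L : seq word) (b : word -> S) : uniq L ->
  (forall s, s \in L -> all creation s && std s) -> (forall s, inducing (b s)) ->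
  \sum_(s <- L) wact a s (b s) = 0 -> forall s, s \in L -> b s = 0.
Proof.
move=> uL LP bN b0.
pose f1 (s : word) := [seq x <- s | ~~ hcl x]; pose f2 (s : word) := [seq x <- s | hcl x].
have sE s : s \in L -> s = f1 s ++ f2 s by move=> /LP/andP[_]; exact: std_split.
have s1P s : s \in L -> all LGlow (f1 s) && std (f1 s).
  move=> sL; have /andP[sQ ss] := LP s sL; apply/andP; split.
    apply/allP => x; rewrite mem_filter => /andP[xh xs].
    have := allP sQ x xs; rewrite /creation => /orP[//|]; move: xh.
    by case: x {xs} => // i.
  by apply: subseq_pairwise ss; exact: filter_subseq.
have s2P s : s \in L -> all (HFlow r) (f2 s) && std (f2 s).
  move=> sL; have /andP[sQ ss] := LP s sL; apply/andP; split.
    apply/allP => x; rewrite mem_filter => /andP[xh xs].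
    have := allP sQ x xs; rewrite /creation => /orP[|//]; move: xh.
    by case: x {xs} => // i.
  by apply: subseq_pairwise ss; exact: filter_subseq.
have f2h s : all in_hc (f2 s) by exact: filter_all.
(* the coefficient of the super Virasoro word t *)
pose B t := \sum_(s <- L | f1 s == t) wact a (f2 s) (b s).
have BA t : A (B t).
  apply: subspace_sum => // s _; apply: LGann_word => //; by case: (bN s).
pose L1 := undup (map f1 L).
have B0 : \sum_(t <- L1) wact a t (B t) = 0.
  rewrite -[RHS]b0 /B.
  rewrite (eq_bigr (fun t => \sum_(s <- L | f1 s == t) wact a s (b s))); last first.
    move=> t _; rewrite (lin_sum (wact_linear aP t)) big_seq_cond [RHS]big_seq_cond.
    apply: eq_bigr => s /andP[sL /eqP <-].
    by rewrite -wact_cat -sE.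
  rewrite (exchange_big_dep predT) //= big_seq [RHS]big_seq; apply: eq_bigr => s sL.
  rewrite (eq_bigl (fun t => t == f1 s)) => [|t]; last by rewrite eq_sym.
  by rewrite -big_filter filter_pred1_uniq ?big_seq1 ?undup_uniq ?mem_undup ?map_f.
move=> s sL.
have Bs : B (f1 s) = 0.
  apply: (virasoro_independent pP (p_c1 l z c1P) noeig (wact_linear aP) _ _ _ BA B0) => //.
  - exact: undup_uniq.
  - by move=> t; rewrite mem_undup => /mapP[s' s'L ->]; exact: s1P.
  - move=> t v; rewrite mem_undup => /mapP[s' s'L ->]; apply: word_leading.
    by case/andP: (s1P _ s'L).
  - by rewrite mem_undup map_f.
pose L2 := [seq f2 s' | s' <- L & f1 s' == f1 s].
have := @heisenberg_independent K S a l aP l0 c3P r L2 (fun u => b (f1 s ++ u)).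
move=> /(_ _ _ _ _ (f2 s)); rewrite -sE //; apply.
- rewrite map_inj_in_uniq ?filter_uniq // => s1 s2; rewrite !mem_filter.
  move=> /andP[/eqP e1 L1s] /andP[/eqP e2 L2s] e.
  by rewrite (sE s1) // (sE s2) // e1 e2 e.
- by move=> t /mapP[s']; rewrite mem_filter => /andP[_ s'L] ->; exact: s2P.
- by move=> u; case: (bN (f1 s ++ u)).
- rewrite -[RHS]Bs /L2 big_map big_filter /B big_seq_cond [RHS]big_seq_cond.
  by apply: eq_bigr => s' /andP[s'L /eqP <-]; rewrite -sE.
- by apply/mapP; exists s => //; rewrite mem_filter eqxx.
Qed.

Let raising (x : gbasis) : bool :=
  match x with gH k => r%:Z < k | gF k => r%:Z <= k | _ => false end.

Let raisingE v : HFann a r v <-> forall x, raising x -> a x v = 0.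
Proof.
split=> [vh [k|k|k|k|||] //= hk|vh k]; [exact: (vh k).1|exact: (vh k).2|].
by split=> hk; apply: vh.
Qed.

Let raising_br x y : raising x -> in_gmn 0 (- r%:Z) y -> forall t, t \in gbr K x y -> raising t.2.
Proof.
move=> xs ys t; apply/allP: t; case: x xs => //= i i0; case: y ys => //= j j0;
  rewrite /Defs.oppc /= ?all_map ?all_nseq /= ?all_nseq /=; lia.
Qed.

Lemma HFann_stable y v : in_gmn 0 (- r%:Z) y -> HFann a r v -> HFann a r (a y v).
Proof.
move=> yP /raisingE vh; apply/raisingE => x xh; rewrite (act_swap aP) vh //.
rewrite (lin0 (aP.1 y)) scaler0 add0r; apply: big1_seq => t /andP[_ tP].
by rewrite vh ?scaler0 //; exact: (raising_br xh yP).
Qed.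

Lemma inducing_submodule : submodule (inducing : set (resrep (@gmn_closed K 0 (- r%:Z)) S)).
Proof.
have [[sl _ _] _ sa _] := SP.
have hS : subspace (HFann a r).
  split=> [|k u v /raisingE uh /raisingE vh]; apply/raisingE => x xh; first exact: (lin0 (aP.1 x)).
  by rewrite aP.1 uh // vh // scaler0 addr0.
split.
- split=> [|k u v [uA uh] [vA vh]]; first exact: (conj AS.1 hS.1).
  by split; [case: AS => _; apply|case: hS => _; apply].
- move=> i v [vA /raisingE vh]; split.
    move=> x xl xd; have := spr_p SP Ssmooth l0 c2P c3P (i (+) gpar x) x v.
    by rewrite -addbA addbb addbF => <-; rewrite vA // (lin0 (sl _)).
  apply/raisingE => x xh; have := sa x i v => /= ->.
  by have := vh x xh => /= ->; exact: (lin0 (sl _)).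
move=> x v [vA vh]; have xP : in_gmn 0 (- r%:Z) (val x) := valP x.
split; last exact: HFann_stable.
apply: (stable_all (l := l) c1P c2P (N := A)) (vA) => //.
  by move=> y u; exact: LGann_hc.
move=> u uA; have [xl|xl] := boolP (inLG (val x)).
  apply: (LGann_stable pP (p_c1 l z c1P)) => //.
  by move: xP xl; case: (val x) => //= i; clear; lia.
case: (val x) xl => // [i|i|||] _; try exact: (subspace0 AS).
by rewrite (p_c1 l z c1P); exact: (subspaceZ _ AS).
Qed.

Lemma creation_br x y : creation x -> creation y -> forall t, t \in gbr K x y -> creation t.2.
Proof.
move=> xs ys t; apply/allP: t; rewrite /creation in xs ys *.
case: x xs => //= i i0; case: y ys => //= j j0;
  rewrite /Defs.oppc /= ?all_map ?all_nseq /= ?all_nseq /=; lia.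
Qed.

Lemma creation_neg x : creation x -> gdeg2 x < 0.
Proof. by case/orP; [exact: LGlow_neg|exact: HFlow_neg]. Qed.

Lemma creation_compl x : ~~ creation x -> in_gmn 0 (- r%:Z) x.
Proof. by rewrite /creation; case: x => //= i; lia. Qed.

End Level.

(** By smoothness v is in HFann r for large r, so that the module to induce
    from is not zero. *)
Lemma induced_case v : A v -> v != 0 ->
  exists (n : nat) (W : rep (gmn 0 (- n%:Z))),
    [/\ (0 < n)%N, is_module W, simple W, smooth W & isomorphic S (induced W)].
Proof.
move=> vA v0; have [n nv] := Ssmooth v.
have vN : inducing n.+1 v.
  split=> // k; split=> hk; apply: nv => /=; lia.
exists n.+1, (@subrep K _ (resrep (@gmn_closed K 0 (- n.+1%:Z)) S) (inducing n.+1)).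
have NP := inducing_submodule n.+1.
split=> //.
- exact: (subrep_module NP (resrep_module _ SP)).
- exact: (induced_simple SP Ssimple NP (@creation_br n.+1) (@creation_neg n.+1) (@creation_compl n.+1) (@creation_independent n.+1) vN v0).
- exact: (subrep_smooth NP (resrep_smooth Ssmooth)).
- exact: (induced_iso SP Ssimple NP (@creation_br n.+1) (@creation_neg n.+1) (@creation_compl n.+1) (@creation_independent n.+1) vN v0).
Qed.
End Induced.

(** * The alternative *)

Section Dichotomy.
Context {K : numClosedFieldType}.
Local Notation g := (scalg K).
Variables (S : rep g) (l z c : K).
Hypothesis SP : is_module S.
Hypothesis Ssimple : simple S.
Hypothesis Ssmooth : smooth S.
Hypothesis l0 : l != 0.
Local Notation a := (@act K g S : gbasis -> S -> S).
Hypothesis c1P : forall v, a gC1 v = c *: v.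
Hypothesis c2P : forall v, a gC2 v = z *: v.
Hypothesis c3P : forall v, a gC3 v = l *: v.

Local Notation p := (pr a l z).
Local Notation pP := (p_act SP Ssmooth l0 c2P c3P).

Let ann (t : nat) (v : S) : Prop := forall x, inLG x -> t%:Z <= gdeg2 x -> p x v = 0.

Let ann_low t v : ann t.+1 v -> p (LGlet t) v = 0 -> ann t v.
Proof.
move=> vA v0 x xl xd; have [xt|xt] := eqVneq (gdeg2 x) t%:Z.
  by rewrite -(inLG_K xl) xt.
by apply: vA => //; move: xd xt; clear; lia.
Qed.

Let ann_odd m v : ann m.+1.*2 v -> v != 0 -> exists2 u, ann m.*2.+1 u & u != 0.
Proof.
move=> vA v0; pose G := gG m%:Z; have GE : LGlet (m.*2.+1)%:Z = G.
  by rewrite -[G]inLG_K //; congr LGlet; rewrite /G /=; clear; lia.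
have [Gv|Gv] := eqVneq (p G v) 0.
  by exists v => //; apply: ann_low; rewrite ?GE.
exists (p G v) => //.
have br x w : inLG x -> (m.*2.+1)%:Z <= gdeg2 x -> w = v ->
    lcomb (fun b => p b w) (gbr K x G) = 0.
  move=> xl xd ->; apply: big1_seq => t /andP[_ tP].
  have [_ td] := gbr_homog tP.
  have tl : inLG t.2.
    move: tP td xd; case: x xl => // i _; rewrite /G [gbr _ _ _]/=.
      by rewrite /brLG inE => /eqP ->.
    move=> + + xd; rewrite /brGG inE => /orP[/eqP -> //|].
    by rewrite mem_nseq; move: xd; rewrite /=; clear; lia.
  rewrite vA ?scaler0 // td /G /=; move: xd; clear; lia.
apply: ann_low => [x xl xd|].
  rewrite (act_swap pP) br //; last by move: xd; clear; lia.
  by rewrite vA // (lin0 (pP.1 G)) scaler0 addr0.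
rewrite GE.
have := pP.2 G G v; rewrite br //; last by rewrite /G /=; clear; lia.
rewrite /= expr1 scaleN1r opprK -mulr2n -scaler_nat => /eqP.
by rewrite scaler_eq0 pnatr_eq0 => /eqP.
Qed.

(** The smallest degree bound at which nonzero vectors are killed is of the
    form M + 1/2. If it were an integer m + 1, then G = G_(m+1/2) could be
    applied to such a vector: G^2 is a multiple of L_(2m+1), which kills it,
    so that G v, or v itself if G v = 0, would be killed from the degree m +
    1/2 on. By minimality L_M is injective on these vectors if M > 0. *)
Lemma least_level : exists M v, [/\ LGann p M v, v != 0 &
  forall u, M <> 0%N -> LGann p M u -> p (gL M) u = 0 -> u = 0].
Proof.
have [[v v0] _] := Ssimple.
pose P t := `[< exists2 u, ann t.+1 u & u != 0 >].
have exP : exists t, P t.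
  have [n nv] := p_smooth z SP Ssmooth l0 v; exists n; apply/asboolP; exists v => //.
  by move=> x xl xd; apply: nv; move: xd; clear; lia.
have [t /asboolP[u uA u0] tmin] := ex_minnP exP.
have tE : exists M, t = M.*2.
  have [/negbTE to|/negPn to] := boolP (~~ odd t); last first.
    have te : t = (t./2).*2.+1 by rewrite -[LHS]odd_double_half to.
    rewrite te in uA; have [w wA w0] := ann_odd uA u0.
    have : (t <= t./2.*2)%N by apply: tmin; apply/asboolP; exists w.
    by move: te; clear; lia.
  by exists t./2; rewrite -[LHS]odd_double_half to.
have [M ME] := tE; exists M, u; split=> //; first by rewrite ME in uA.
move=> w M0 wA Xw; apply: contrapT => /eqP w0.
have [M' MM'] : exists M', M = M'.+1 by exists M.-1; case: (M) M0.
suff /tmin : P M'.*2.+1 by rewrite ME MM'; clear; lia.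
apply/asboolP; exists w => //; apply: ann_low.
  by rewrite -doubleS -MM'.
by have -> : LGlet (M'.*2.+2)%:Z = gL M; [rewrite -[gL M]inLG_K //; congr LGlet; rewrite /= MM'; clear; lia|].
Qed.

(** The alternative is whether L_0 has an eigenvector on the vectors killed by
    all letters of positive degree. *)
Lemma factor_or_induced :
  (exists (U : rep svir) (H : rep hc),
     [/\ is_module U /\ is_module H, simple U /\ simple H, smooth U /\ smooth H,
         hc_has_level l H & isomorphic S (tens_rep (svir_ext U) (hc_ext l z H))]) \/
  (exists (n : nat) (W : rep (gmn 0 (- n%:Z))),
     [/\ (0 < n)%N, is_module W, simple W, smooth W & isomorphic S (induced W)]).
Proof.
have [M [v [vA v0 vmin]]] := least_level.
have [[h [w [wA Xw w0 M0]]]|noeig] := pselect (exists h w,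
    [/\ LGann p M w, p (gL M) w = h *: w, w != 0 & M = 0%N]).
  left; rewrite M0 in wA Xw.
  have [w1 [w1h w10 w1e]] := lowest_even SP Ssmooth l0 c1P c2P c3P (conj wA Xw) w0.
  exists (@subrep K (lsub svir_closed) (resrep svir_closed (decoupled S l z)) (svir_span l z w1)).
  exists (@subrep K (lsub hc_closed) (resrep hc_closed S) (lowest l z h)).
  split.
  - split.
      exact: (Umod_module SP Ssmooth l0 c1P c2P c3P w1h w1e).
    exact: (Hmod_module h SP Ssmooth l0 c1P c2P c3P).
  - split.
      exact: (Umod_simple SP Ssimple Ssmooth l0 c1P c2P c3P w1h w10 w1e).
    exact: (Hmod_simple SP Ssimple Ssmooth l0 c1P c2P c3P w1h w10).
  - split.
      exact: (Umod_smooth SP Ssmooth l0 c1P c2P c3P w1h w1e).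
    exact: (Hmod_smooth SP Ssmooth l0 c1P c2P c3P).
  - exact: (Hmod_level SP Ssmooth l0 c1P c2P c3P).
  - exact: (factor_iso SP Ssimple Ssmooth l0 c1P c2P c3P w1h w10 w1e).
right; apply: (induced_case SP Ssimple Ssmooth l0 c1P c2P c3P _ vA v0).
move=> h w wA Xw hM; apply: contrapT => /eqP w0.
have [M0|M0] := pselect (M = 0%N); first by apply: noeig; exists h, w.
case: hM => // h0; move/eqP: w0; apply; apply: vmin => //.
by rewrite Xw h0 scale0r.
Qed.
End Dichotomy.

(** * Central elements act by scalars *)

Section Dixmier.
Context {K : numClosedFieldType}.
Local Notation g := (scalg K).
Variable S : rep g.
Hypothesis SP : is_module S.
Hypothesis Ssimple : simple S.
Hypothesis K_uncountable : forall f : nat -> K, exists c, forall n, f n != c.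
Local Notation a := (@act K g S : gbasis -> S -> S).
Local Notation aP := (rep_act SP).

(** The lemma of Schur in the form of Dixmier: T - c has trivial kernel and
    full image for each c unless it is zero, and S has countable dimension,
    being spanned by the words applied to one vector. *)
Lemma endomorphism_scalar (T : S -> S) : linear T ->
  (forall i v, T (spr i v) = spr i (T v)) -> (forall x v, T (a x v) = a x (T v)) ->
  exists c, forall v, T v = c *: v.
Proof.
move=> TP Ts Ta; have [[v0 v00] smin] := Ssimple.
have [[sl s1 _] _ sa _] := SP.
apply: contrapT => /forallNP nT.
pose f c v := T v - c *: v.
have fP c : linear (f c) by apply: linear_add; [|apply/linear_opp/linear_scale].
have fs c i v : f c (spr i v) = spr i (f c v).
  by rewrite /f Ts (linB (sl i)) (linZ (sl i)).
have fa c x v : f c (a x v) = a x (f c v).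
  by rewrite /f Ta (linB (aP.1 x)) (linZ (aP.1 x)).
have noeig c w : T w = c *: w -> w = 0.
  move=> Tw; have kerS : submodule [set v : S | f c v = 0].
    split=> [|i v /= v_0|x v /= v_0].
    - split=> [|k u v /= u_0 v_0]; first exact: (lin0 (fP c)).
      by rewrite /= fP u_0 v_0 scaler0 addr0.
    - by rewrite /= fs v_0 (lin0 (sl i)).
    - by rewrite /= fa v_0 (lin0 (aP.1 x)).
  have [ker0|kerT] := smin _ kerS; first by apply: ker0; rewrite /= /f Tw subrr.
  by case: (nT c) => v; apply/eqP; rewrite -subr_eq0; apply/eqP/(kerT v).
pose b n := if choice.unpickle n is Some (i, s) then wact a (map gbasis_decode s) (spr i v0) else 0.
have bE i s : wact a s (spr i v0) = b (choice.pickle (i, map gbasis_code s)).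
  by rewrite /b choice.pickleK -map_comp (eq_map gbasis_codeK) map_id.
suff v0E : v0 = 0 by rewrite v0E eqxx in v00.
apply: (countable_not_resolvent TP K_uncountable (b := b)) => // [v|c v].
  have spanS : submodule (lspan (range b) : set S).
    have bP n : b n = 0 \/ exists i s, b n = wact a s (spr i v0).
      rewrite /b; case: choice.unpickle => [[i s]|]; last by left.
      by right; exists i, (map gbasis_decode s).
    split; first exact: lspan_subspace.
    - move=> i u; apply: (lspan_map (sl i)) => _ [n _ <-].
      have [->|[j [s ->]]] := bP n; first by rewrite (lin0 (sl i)); exact: lspan0.
      rewrite (spr_wact SP); have [[_ _ ->] _ _ _] := SP.
      case: ifP => _; last by rewrite (lin0 (wact_linear aP s)); exact: lspan0.
      by rewrite bE; apply: lspan_in; eexists.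
    - move=> x u; apply: (lspan_map (aP.1 x)) => _ [n _ <-].
      have [->|[j [s ->]]] := bP n; first by rewrite (lin0 (aP.1 x)); exact: lspan0.
      by rewrite -[a x _]/(wact a (x :: s) _) bE; apply: lspan_in; eexists.
  have [span0|//] := smin _ spanS.
  have sv0 i : spr i v0 = 0.
    by apply: span0; rewrite -[spr i v0]/(wact a [::] _) bE; apply: lspan_in; eexists.
  by rewrite -(s1 v0) !sv0 addr0 eqxx in v00.
have imS : submodule [set w : S | exists u, f c u = w].
  split=> [|i _ [u <-]|x _ [u <-]].
  - split=> [|k _ _ [u <-] [w <-]]; first by exists 0; exact: lin0.
    by exists (k *: u + w); rewrite fP.
  - by exists (spr i u).
  - by exists (a x u).
have [im0|imT] := smin _ imS; last exact: imT.
have := noeig c v0; move=> h; move: v00; rewrite h ?eqxx //.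
by apply/eqP; rewrite -subr_eq0; apply/eqP/im0; exists v0.
Qed.

Lemma central_scalar x : ~~ gpar x -> (forall y, gbr K x y = [::]) ->
  exists c, forall v, a x v = c *: v.
Proof.
move=> xp xc; have [_ _ sa _] := SP; apply: endomorphism_scalar; first exact: aP.1.
  by move=> i v; have := sa x i v => /= ->; rewrite (negPf xp) addbF.
by move=> y v; rewrite (act_swap aP) xc lcomb_nil addr0 (negPf xp) scale1r.
Qed.
End Dixmier.

(** * The classification *)

Local Open Scope complex_scope.

Theorem theorem1 (R : realType) (l : R[i]) (S : rep (scalg R[i])) :
  l != 0 ->
  is_module S -> simple S -> smooth S -> has_level l S ->
  [\/ exists (H : rep hc) (z : R[i]),
        [/\ is_module H, simple H, smooth H, hc_has_level l H
          & isomorphic S (hc_ext l z H)],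
      exists (n : nat) (W : rep (gmn 0 (- n%:Z))),
        [/\ (0 < n)%N, is_module W, simple W, smooth W
          & isomorphic S (induced W)]
    | exists (U : rep svir) (H : rep hc) (z : R[i]),
        [/\ is_module U /\ is_module H, simple U /\ simple H,
            smooth U /\ smooth H, hc_has_level l H
          & isomorphic S (tens_rep (svir_ext U) (hc_ext l z H))]].
Proof.
move=> l0 SP Ssimple Ssmooth Slevel.
have unc := @complex_uncountable R.
have [c c1P] := central_scalar SP Ssimple unc (x := gC1) isT (fun=> erefl).
have [z c2P] := central_scalar SP Ssimple unc (x := gC2) isT (fun=> erefl).
have [[U [H UH]]|WP] := factor_or_induced SP Ssimple Ssmooth l0 c1P c2P Slevel.
  by constructor 3; exists U, H, z.
by constructor 2.
Qed.
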